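(* Consider a $d$-dimensional time series following the recursion $X_i=f_0(X_{i-1},\dots,X_{i-r})+\varepsilon_i$, $i=r+1,\dots,n$, where $f_0:\mathbb R^{dr}\to\mathbb R^d$ satisfies the encoder-decoder assumption and the smoothness assumption of the context. Let $N\in\{1,\dots,n\}$. Suppose that the parameters of $\mathcal F(L,L_1,p,s,F,\mathrm{Lip})$ satisfy (i) $K\le F$; (ii) $\sum_{i\in\{(enc,0),(enc,1)\}}\log_2(4(t_i\vee\beta_i))\log_2(n)\le L_1$ and $L_1+\log_2(4(t_{dec}\vee\beta_{dec}))\log_2(n)\le L$; (iii) $N\lesssim\min_{i\in\{1,\dots,L\}\setminus\{L_1\}}p_i$; (iv) $N\log_2(n)\lesssim s$; (v) $\mathrm{Lip}\gtrsim1$. Then $$\inf_{f^*\in\mathcal F(L,L_1,p,s,F,\mathrm{Lip})}\|f^*-f_0\|_\infty^2\ \le\ C\max_{k\in\{dec;(enc,0);(enc,1)\}}\Big\{\frac Nn+N^{-\frac{2\beta_k}{t_k}}\Big\}$$ for a large enough constant $C$ that only depends on $\tilde d$, $d$, $(t_{dec},t_{enc,0},t_{enc,1})$ and $(\beta_{dec},\beta_{enc,0},\beta_{enc,1})$.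
   Context: Notation: $x_n\lesssim y_n$ (equivalently $y_n\gtrsim x_n$) means that there is a constant $c>0$ independent of $n$ with $x_n\le cy_n$ for $n\in\mathbb N$. $|\cdot|_\infty$ is the maximum norm of the entries of a vector or matrix, $|\cdot|_0$ the number of nonzero entries. For $f:\mathbb R^t\to\mathbb R^d$, $\|f\|_\infty:=\sup_{x\in\mathbb R^t}|f(x)|_\infty$. $a\vee b=\max\{a,b\}$. $d,r\in\mathbb N$; $(\varepsilon_i)$ is an i.i.d. sequence of $d$-dimensional random variables. Encoder-decoder assumption: $f_0=f_{dec}\circ f_{enc}$, $f_{enc}=g_{enc,1}\circ g_{enc,0}$, with $\tilde d\in\{1,\dots,d\}$, $D\in\mathbb N$, $g_{enc,0}:\mathbb R^{dr}\to\mathbb R^D$, $g_{enc,1}:\mathbb R^D\to\mathbb R^{\tilde d}$, $f_{dec}:\mathbb R^{\tilde d}\to\mathbb R^d$; each component of $g_{enc,0}$, $g_{enc,1}$, $f_{dec}$ depends on at most $t_{enc,0}\in\{1,\dots,dr\}$, $t_{enc,1}\in\{1,\dots,D\}$, $t_{dec}\in\{1,\dots,\tilde d\}$ arguments respectively. Hölder balls: with $\lfloor\beta\rfloor:=\max\{k\in\mathbb N_0:k<\beta\}$, $C^\beta(P,K)$ is the set of $f:P\to\mathbb R$ whose partial derivatives up to order $\lfloor\beta\rfloor$ exist with $\sum_{|\alpha|<\beta}\|\partial^\alpha f\|_\infty+\sum_{|\alpha|=\lfloor\beta\rfloor}\sup_{x\ne y\in P}\frac{|\partial^\alpha f(x)-\partial^\alpha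 f(y)|}{|x-y|_\infty^{\beta-\lfloor\beta\rfloor}}\le K$ ($\alpha$ a multi-index, the first supremum norm being over $P$). Vector-valued functions belong to it componentwise. Smoothness assumption: for constants $K\ge1$ and $\beta_{dec},\beta_{enc,0},\beta_{enc,1}\ge1$: $g_{enc,0}\in C^{\beta_{enc,0}}([0,1]^{dr},K)$ with $g_{enc,0}([0,1]^{dr})\subset[0,1]^D$; $g_{enc,1}\in C^{\beta_{enc,1}}([0,1]^D,K)$ with $g_{enc,1}([0,1]^D)\subset[0,1]^{\tilde d}$; $f_{dec}\in C^{\beta_{dec}}([0,1]^{\tilde d},K)$. Networks: $\sigma(x)=\max\{x,0\}$, and $\sigma_v(x)=(\sigma(x_1-v_1),\dots,\sigma(x_m-v_m))'$ for $v\in\mathbb R^m$. For $L\in\mathbb N_0$ (number of hidden layers) and $p=(p_0,\dots,p_{L+1})\in\mathbb N^{L+2}$ (widths), a network with architecture $(L,p)$ is $f(x)=W^{(L)}\sigma_{v^{(L)}}W^{(L-1)}\sigma_{v^{(L-1)}}\cdots W^{(1)}\sigma_{v^{(1)}}W^{(0)}x$ with $W^{(i)}\in\mathbb R^{p_{i+1}\times p_i}$, $v^{(i)}\in\mathbb R^{p_i}$ (and $v^{(0)}:=0$). Here $p_0=dr$, $p_{L+1}=d$. For $L_1\in\{1,\dots,L\}$, $s\in\mathbb N$, $F>0$, $\mathrm{Lip}>0$, $\mathcal F(L,L_1,p,s,F,\mathrm{Lip})$ is the set of such $f$ with all $|W^{(j)}|_\infty\vee|v^{(j)}|_\infty\le1$,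 $p_{L_1}=\tilde d$, $\sum_{j=0}^L(|W^{(j)}|_0+|v^{(j)}|_0)\le s$, $\|f\|_\infty\le F$, and $\|f\|_{Lip}:=\sup_{x\ne x'}\frac{|f(x)-f(x')|_\infty}{|x-x'|_\infty}\le\mathrm{Lip}$.
   Formalization: Added: $L\lesssim s$ (if $L\ge s$ all networks in the class are constant) and $n>r$; $\|f^*-f_0\|_\infty$ is taken over $[0,1]^{dr}$, as $f_0$ is arbitrary off the cube; the constants in (iii)-(v) are suitable ones depending on $K,r,D$ and the structural parameters. *)

(* Defs.v *)
From HB Require Import structures.
From mathcomp Require Export all_boot all_order all_algebra.
From mathcomp Require Export all_classical all_reals all_analysis.

Set Implicit Arguments.
Unset Strict Implicit.
Unset Printing Implicit Defensive.

Export Order.TTheory GRing.Theory Num.Theory.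
Export numFieldNormedType.Exports.

Local Open Scope classical_set_scope.
Local Open Scope ring_scope.

(* Vectors are column vectors; on matrices [`|A|] is the maximum norm. *)

Definition log2 (R : realType) (x : R) : R := ln x / ln 2.

Definition unit_cube (R : realType) (t : nat) : set 'cV[R]_t :=
  [set x | forall i, 0 <= x i 0 <= 1].

Definition supnorm (R : realType) (T : Type) (V : normedZmodType R)
    (P : set T) (f : T -> V) : \bar R :=
  ereal_sup [set `|f x|%:E | x in P].

Definition lipnorm (R : realType) (m o : nat) (f : 'cV[R]_m -> 'cV[R]_o) :
    \bar R :=
  ereal_sup [set e | exists x y, x <> y /\ e = (`|f x - f y| / `|x - y|)%:E].

(* Every component of [f] is a function of at most [t] of its arguments. *)
Definition depends_on_at_most (R : realType) (a b : nat)
    (f : 'cV[R]_a -> 'cV[R]_b) (t : nat) : Prop :=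
  forall j : 'I_b, exists S : {set 'I_a}, (#|S| <= t)%N /\
    forall x y : 'cV[R]_a, (forall i, i \in S -> x i 0 = y i 0) ->
      f x j 0 = f y j 0.

(** Hoelder balls *)

(* The largest natural number strictly below [b] (so [b - 1] for integer [b]);
   any such number is at most [Num.truncn b]. *)
Definition sfloor (R : realType) (b : R) : nat :=
  (\max_(k < (Num.truncn b).+1 | ((k : nat)%:R < b)%R) k)%N.

Definition mdeg (t : nat) (a : {ffun 'I_t -> nat}) : nat := (\sum_i a i)%N.

Definition mincr (t : nat) (a : {ffun 'I_t -> nat}) (i : 'I_t) :
    {ffun 'I_t -> nat} := [ffun j => (a j + (j == i))%N].

Definition mindex (t k : nat) (a : {ffun 'I_t -> 'I_k}) : {ffun 'I_t -> nat} :=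
  [ffun j => (a j : nat)].

(* [l] is the [i]-th partial derivative at [x] of [g] as a function on [P]:
   increments leaving [P] are ignored (one-sided at the faces of a cube). *)
Definition is_partial (R : realType) (t : nat) (P : set 'cV[R]_t) (i : 'I_t)
    (g : 'cV[R]_t -> R) (x : 'cV[R]_t) (l : R) : Prop :=
  (fun h : R => (g (x + h *: delta_mx i 0) - g x) / h)
    @ within [set h | P (x + h *: delta_mx i 0)] (0 : R)^' --> l.

Definition is_mpartials (R : realType) (t : nat) (P : set 'cV[R]_t) (k : nat)
    (f : 'cV[R]_t -> R) (D : {ffun 'I_t -> nat} -> 'cV[R]_t -> R) : Prop :=
  (forall x, P x -> D [ffun=> 0%N] x = f x) /\
  (forall a i x, (mdeg a < k)%N -> P x ->
     is_partial P i (D a) x (D (mincr a i) x)).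

Definition holder_seminorm (R : realType) (t : nat) (P : set 'cV[R]_t) (e : R)
    (g : 'cV[R]_t -> R) : \bar R :=
  ereal_sup [set q | exists x y, [/\ P x, P y, x <> y &
                       q = (`|g x - g y| / `|x - y| `^ e)%:E]].

(* Multi-indices of order at most [k = sfloor b] have all entries below [k.+1],
   and for a natural number [j] one has [j < b] iff [j <= sfloor b]. *)
Definition holder_ball (R : realType) (t : nat) (P : set 'cV[R]_t) (b K : R)
    (f : 'cV[R]_t -> R) : Prop :=
  let k := sfloor b in
  exists2 D : {ffun 'I_t -> nat} -> 'cV[R]_t -> R, is_mpartials P k f D &
    (\sum_(a : {ffun 'I_t -> 'I_k.+1} | ((mdeg (mindex a))%:R < b)%R)
        supnorm P (D (mindex a))
     + \sum_(a : {ffun 'I_t -> 'I_k.+1} | mdeg (mindex a) == k)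
        holder_seminorm P (b - k%:R)%R (D (mindex a)) <= K%:E)%E.

Definition vholder_ball (R : realType) (a o : nat) (P : set 'cV[R]_a) (b K : R)
    (f : 'cV[R]_a -> 'cV[R]_o) : Prop :=
  forall j : 'I_o, holder_ball P b K (fun x => f x j 0).

(** Neural networks *)

(* Only [p 1, ..., p L] (the hidden widths) are used; the input and output
   widths are [m] and [o]. The matrix [W^(i)] is [weight i] for [i < L] and
   [W^(L)] is [out_weight], which keeps the output type free of casts. *)
Definition width (m : nat) (p : nat -> nat) (i : nat) : nat :=
  if i is j.+1 then p j.+1 else m.

Record network (R : realType) (m o L : nat) (p : nat -> nat) := Network {
  weight : forall i, 'M[R]_(width m p i.+1, width m p i);
  out_weight : 'M[R]_(o, width m p L);
  shift : forall i, 'cV[R]_(width m p i) }.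

Definition srelu (R : realType) (q : nat) (v x : 'cV[R]_q) : 'cV[R]_q :=
  \col_i Num.max (x i 0 - v i 0) 0.

Fixpoint hidden (R : realType) (m o L : nat) (p : nat -> nat)
    (w : network R m o L p) (x : 'cV[R]_m) (i : nat) : 'cV[R]_(width m p i) :=
  if i is j.+1 then srelu (shift w j.+1) (weight w j *m hidden w x j) else x.

Definition realize (R : realType) (m o L : nat) (p : nat -> nat)
    (w : network R m o L p) (x : 'cV[R]_m) : 'cV[R]_o :=
  out_weight w *m hidden w x L.

Definition nnz (R : realType) (a b : nat) (A : 'M[R]_(a, b)) : nat :=
  #|[pred ij : 'I_a * 'I_b | A ij.1 ij.2 != 0]|.

Definition sparsity (R : realType) (m o L : nat) (p : nat -> nat)
    (w : network R m o L p) : nat :=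
  (\sum_(0 <= j < L) nnz (weight w j) + nnz (out_weight w)
   + \sum_(1 <= j < L.+1) nnz (shift w j))%N.

Definition bounded_by_one (R : realType) (m o L : nat) (p : nat -> nat)
    (w : network R m o L p) : Prop :=
  [/\ forall j, (j < L)%N -> `|weight w j| <= 1,
      `|out_weight w| <= 1 &
      forall j, (1 <= j <= L)%N -> `|shift w j| <= 1].

(* Networks with bottleneck width [dt] in the hidden layer [L1]. *)
Definition encdec_networks (R : realType) (m o dt L L1 : nat) (p : nat -> nat)
    (s : nat) (F Lip : R) : set ('cV[R]_m -> 'cV[R]_o) :=
  [set f | p L1 = dt /\
     (exists w : network R m o L p,
        [/\ f = realize w, bounded_by_one w & (sparsity w <= s)%N]) /\
     (supnorm setT f <= F%:E)%E /\ (lipnorm f <= Lip%:E)%E].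

(** Time series *)

Definition tvec (R : realType) (d : nat) (x : d.-tuple R) : 'cV[R]_d :=
  \col_j tnth x j.

(* The vector [(X_(i-1), ..., X_(i-r))] of [R^(dr)], block after block. *)
Definition lags (R : realType) (d r : nat) (X : nat -> d.-tuple R) (i : nat) :
    'cV[R]_(r * d) :=
  (mxvec (\matrix_(l < r, j < d) tnth (X (i - l.+1)%N) j))^T.

Definition iid (dT : measure_display) (T : measurableType dT) (R : realType)
    (P : probability T R) (d : nat) (eps : nat -> {RV P >-> d.-tuple R}) :
    Prop :=
  (forall i j A, measurable A ->
     distribution P (eps i) A = distribution P (eps j) A) /\
  (forall (J : seq nat) (A : nat -> set (d.-tuple R)), uniq J ->
     (forall i, measurable (A i)) ->
     P (\bigcap_(i in [set` J]) (eps i @^-1` A i)) =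
       (\prod_(i <- J) P (eps i @^-1` A i))%E).

(* Main.v *)
(* The mesh width for a component with exponent [b] and [t] arguments is about
   [N^(-1/t)]. Hat functions times local Taylor polynomials approximate the
   component up to [N^(-b/t)] and with a bounded Lipschitz constant, and the
   approximant is a sum of [O(N)] products of boundedly many piecewise linear
   factors. Products are differences of squares, and the parabola is
   self-similar: [m] layers of a zigzag with [B] teeth reproduce it with an
   error that is [B^(-m)] even in the Lipschitz norm. As [c] may depend on [K],
   [r] and [D], the base [B], the number of copies of each unit (which emulate
   weights larger than [1]) and the constant in the mesh width are at our
   disposal; hence a depth that is any fixed multiple of [log n] makes the
   product error smaller than every fixed power of [1/n], and [C = 1] will do.

   For [n] below a constant there are too few layers for this, but then a
   constant error suffices. Two hidden layers achieve it: rounding the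
   arguments by a steep staircase and looking the value up fails only where the
   staircase climbs, and averaging over many staircases that climb in disjoint
   places makes these failures negligible. *)
Require Import Defs.
From mathcomp Require Import ring lra zify.
Set Implicit Arguments.
Unset Strict Implicit.
Unset Printing Implicit Defensive.
Local Open Scope classical_set_scope.
Local Open Scope ring_scope.

(** * ReLU nets *)

(** The class leaves no slack in three places. Its depth is tied to [log2 n] by a factor only known
    to be at least [2] per stage, whereas a product of many factors needs many squaring blocks; so a
    block gets about [log2 n / Q] layers, where [Q] absorbs the number of blocks, and a larger base
    [B] restores the accuracy. The sup norm may be limited to exactly [K], so the deep decoder is
    shrunk by [K / (K + eta)]. The bottleneck has only [dt] units, so its values cannot be split
    into positive and negative parts; they pass through a bare ReLU, harmless for values meant to
    lie in [[0, 1]]. Sup norm and Lipschitz constant are restricted on the whole space, while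
    approximation is needed on the cube only: the deep nets clip their inputs to the cube before
    each stage. Hats have slope [J], yet the Lipschitz constant must stay bounded, so errors have to
    be controlled in the Lipschitz norm too. *)

Section PartialInverse.
Context (V : nmodType).

Lemma inj_ord (H : finType) (w : nat) : (#|H| <= w)%N ->
  exists (f : H -> 'I_w) (g : 'I_w -> option H), pcancel f g /\ ocancel g f.
Proof.
move=> Hw; pose f (h : H) : 'I_w := widen_ord Hw (enum_rank h).
have fI : injective f.
  by move=> a b /(congr1 val) /= e; apply: enum_rank_inj; apply: val_inj.
exists f, (fun k => [pick h | f h == k]); split => [h|k].
  by case: pickP => [h' /eqP /fI -> //|/(_ h)]; rewrite eqxx.
by case: pickP => [h /eqP|].
Qed.

(** Zero extension along an embedding with partial inverse [g]. Slots outside its image become dead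
    units with zero weights and zero shift. *)
Definition extend (A B : Type) (g : B -> option A) (F : A -> V) (k : B) : V :=
  if g k is Some h then F h else 0.

Lemma sum_extend (A B : finType) (f : A -> B) (g : B -> option A) (F : A -> V) :
  pcancel f g -> ocancel g f -> \sum_k extend g F k = \sum_h F h.
Proof.
move=> fK gK.
rewrite (bigID (fun k => isSome (g k))) /= [X in _ + X]big1 ?addr0; last first.
  by move=> k; rewrite /extend; case: (g k).
rewrite (reindex_omap f g) /=; last first.
  by move=> k; have := gK k; case: (g k) => //= a ->.
apply: eq_big => [h|h _]; first by rewrite fK eqxx.
by rewrite /extend fK.
Qed.

End PartialInverse.

Section Nets.
Context {R : realType}.

Definition relu (x : R) : R := Num.max x 0.

Lemma reluD (x : R) : relu x - relu (- x) = x.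
Proof. by rewrite /relu; case: (lerP x 0) => ?; case: (lerP (- x) 0) => ?; lra. Qed.

Definition nnzf (I J : finType) (W : I -> J -> R) : nat :=
  (\sum_i \sum_j (W i j != 0%R))%N.

Lemma leq_nnzf (I J : finType) (W W' : I -> J -> R) :
  (forall i j, W i j != 0 -> W' i j != 0) -> (nnzf W <= nnzf W')%N.
Proof.
move=> h; apply: leq_sum => i _; apply: leq_sum => j _.
by have := h i j; case: (W i j != 0) => // /(_ isT) ->.
Qed.

Lemma nnzf_card (I J : finType) (W : I -> J -> R) : (nnzf W <= #|I| * #|J|)%N.
Proof.
apply: leq_trans (_ : \sum_(i : I) \sum_(j : J) 1 <= _)%N.
  by apply: leq_sum => i _; apply: leq_sum => j _; case: (_ != _).
by rewrite sum_nat_const sum1_card.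
Qed.

(** A layer is a relation between the families of functions that its units compute, over arbitrary
    finite index types and an abstract domain [X]. The budget [w] counts nonzero weights only;
    shifts are charged later through the number of units. *)
Definition layer (X : Type) (c : R) (w : nat) (I I' : finType)
    (u : I -> X -> R) (u' : I' -> X -> R) : Prop :=
  exists (W : I' -> I -> R) (v : I' -> R),
    [/\ forall k x, u' k x = relu (\sum_i W k i * u i x - v k),
        forall k i, `|W k i| <= c, forall k, `|v k| <= 1 & (nnzf W <= w)%N].

Definition readout (X : Type) (c : R) (w : nat) (I O : finType)
    (u : I -> X -> R) (f : O -> X -> R) : Prop :=
  exists Z : O -> I -> R,
    [/\ forall o x, f o x = \sum_i Z o i * u i x,
        forall o i, `|Z o i| <= c & (nnzf Z <= w)%N].

Lemma layer_pad (X : Type) c w w' (I H : finType) (u : I -> X -> R)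
    (z : H -> X -> R) :
  0 <= c -> layer c w u z -> (#|H| <= w')%N ->
  exists (z' : 'I_w' -> X -> R) (f : H -> 'I_w') (g : 'I_w' -> option H),
    [/\ pcancel f g, ocancel g f, layer c w u z' & forall h, z' (f h) = z h].
Proof.
move=> c0 [W [v [Wz Wc vc nW]]] /inj_ord [f [g [fK gK]]].
exists (extend (V := (X -> R)%type) g z), f, g; split=> //; last first.
  by move=> h; rewrite /extend fK.
exists (fun k i => extend g (fun h => W h i) k), (extend g v); split.
- move=> k x; rewrite /extend; case: (g k) => [h|]; first exact: Wz.
  by rewrite big1 ?subr0 ?/relu ?maxxx// => i _; rewrite mul0r.
- by move=> k i; rewrite /extend; case: (g k) => // *; rewrite normr0.
- by move=> k; rewrite /extend; case: (g k) => // *; rewrite normr0.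
- apply: leq_trans nW; rewrite /nnzf.
  rewrite -(@sum_extend nat _ _ f g (fun h => (\sum_j (W h j != 0%R))%N) fK gK).
  apply: leq_sum => k _; rewrite /extend; case: (g k) => // .
  by rewrite big1// => j _; rewrite eqxx.
Qed.

Section ColumnExtension.
Context (X : Type) (I J O : finType) (u : I -> X -> R) (u' : J -> X -> R)
  (f : I -> J) (g : J -> option I).
Context (fK : pcancel f g) (gK : ocancel g f)
  (uu' : forall i, u' (f i) = u i).

Lemma sum_col (a : I -> R) x :
  \sum_j extend g a j * u' j x = \sum_i a i * u i x.
Proof.
rewrite -(@sum_extend R _ _ f g (fun i => a i * u i x) fK gK).
apply: eq_bigr => j _; rewrite /extend; have := gK j.
by case: (g j) => /= [i <-|_]; rewrite ?uu' ?mul0r.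
Qed.

Lemma nnzf_col (W : O -> I -> R) :
  nnzf (fun o j => extend g (W o) j) = nnzf W.
Proof.
apply: eq_bigr => o _.
rewrite -(@sum_extend nat _ _ f g (fun i => (W o i != 0%R) : nat) fK gK).
apply: eq_bigr => j _; rewrite /extend; case: (g j) => //.
by rewrite eqxx.
Qed.

Lemma layer_col c w (z : O -> X -> R) :
  0 <= c -> layer c w u z -> layer c w u' z.
Proof.
move=> c0 [W [v [Wz Wc vc nW]]]; exists (fun o => extend g (W o)), v; split=> //.
- by move=> k x; rewrite Wz sum_col.
- by move=> k i; rewrite /extend; case: (g i) => // *; rewrite normr0.
- by rewrite nnzf_col.
Qed.

Lemma readout_col c w (z : O -> X -> R) :
  0 <= c -> readout c w u z -> readout c w u' z.
Proof.
move=> c0 [W [Wz Wc nW]]; exists (fun o => extend g (W o)); split=> //.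
- by move=> k x; rewrite Wz sum_col.
- by move=> k i; rewrite /extend; case: (g i) => // *; rewrite normr0.
- by rewrite nnzf_col.
Qed.

End ColumnExtension.

(** [h] counts the layers after the first. The first layer has weights at most [1] because its
    inputs, unlike hidden units, are not copied in [net_copies], and half of the budget because
    [net_comp] doubles its weight matrix. *)
Fixpoint hid (X : Type) (I : finType) (base : I -> X -> R) (b : R) (w h : nat)
    (u : 'I_w -> X -> R) : Prop :=
  if h is h'.+1 then exists u' : 'I_w -> X -> R, hid base b h' u' /\ layer b w u' u
  else layer 1 w./2 base u.

Definition hidf (X : Type) (I : finType) (base : I -> X -> R) (b : R)
    (w h : nat) (H : finType) (u : H -> X -> R) : Prop :=
  exists (u' : 'I_w -> X -> R) (f : H -> 'I_w) (g : 'I_w -> option H),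
    [/\ pcancel f g, ocancel g f, hid base b h u' & forall k, u' (f k) = u k].

Lemma hid_hidf (X : Type) (I : finType) (base : I -> X -> R) b w h
    (u : 'I_w -> X -> R) : hid base b h u -> hidf base b w h u.
Proof. by move=> hu; exists u, id, some; split. Qed.

Lemma hidf0 (X : Type) (I : finType) (base : I -> X -> R) b w (H : finType)
    (u : H -> X -> R) :
  layer 1 w./2 base u -> (#|H| <= w)%N -> hidf base b w 0 u.
Proof.
move=> hu Hw; have [z [f [g [fK gK lz zu]]]] := layer_pad ler01 hu Hw.
by exists z, f, g.
Qed.

Lemma hidfS (X : Type) (I : finType) (base : I -> X -> R) b w h
    (H H' : finType) (u : H -> X -> R) (z : H' -> X -> R) :
  0 <= b -> hidf base b w h u -> layer b w u z -> (#|H'| <= w)%N ->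
  hidf base b w h.+1 z.
Proof.
move=> b0 [u' [f [g [fK gK hu' uu']]]] uz H'w.
have uz' := layer_col fK gK uu' b0 uz.
have [z' [f' [g' [fK' gK' lz zu]]]] := layer_pad b0 uz' H'w.
by exists z', f', g'; split=> //; exists u'.
Qed.

(* [h.+1] hidden layers; the halves of the budget leave room for splitting an
   interface into positive and negative parts when two nets are composed. *)
Definition net (I O : finType) (b : R) (w h : nat) (F : O -> (I -> R) -> R) :
    Prop :=
  (#|O|.*2 <= w)%N /\ exists (H : finType) (u : H -> (I -> R) -> R),
    hidf (fun i (e : I -> R) => e i) b w h u /\ readout b w./2 u F.

Lemma net_hid (I O : finType) b w h (F : O -> (I -> R) -> R) :
  0 <= b -> net b w h F ->
  exists u, hid (fun i (e : I -> R) => e i) b h u /\ @readout _ b w./2 'I_w O u F.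
Proof.
move=> b0 [_ [H [u [[u' [f [g [fK gK hu uu']]]] rF]]]].
by exists u'; split=> //; apply: readout_col rF.
Qed.

Lemma layer_mono (X : Type) c c' w w' (I I' : finType) (u : I -> X -> R)
    (u' : I' -> X -> R) :
  c <= c' -> (w <= w')%N -> layer c w u u' -> layer c' w' u u'.
Proof.
move=> cc ww [W [v [Wz Wc vc nW]]]; exists W, v; split => //.
  by move=> k i; apply: le_trans cc.
exact: leq_trans ww.
Qed.

Lemma hid_mono (X : Type) (I : finType) (base : I -> X -> R) b b' w w' h
    (u : 'I_w -> X -> R) : 0 <= b -> b <= b' -> (w <= w')%N ->
  hid base b h u -> hidf base b' w' h u.
Proof.
move=> b0 bb ww; elim: h u => [|h IH] u /=.
  by move=> /(layer_mono (lexx 1) (half_leq ww)) hu; apply: hidf0; rewrite ?card_ord.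
case=> u' [/IH hu' /(layer_mono bb ww) uu'].
by apply: hidfS hu' uu' _; rewrite ?card_ord //; exact: le_trans bb.
Qed.

Lemma net_mono (I O : finType) b b' w w' h (F : O -> (I -> R) -> R) :
  0 <= b -> b <= b' -> (w <= w')%N -> net b w h F -> net b' w' h F.
Proof.
move=> b0 bb ww nF; have [u [hu [Z [ZF Zb nZ]]]] := net_hid b0 nF.
split; first exact: leq_trans nF.1 ww.
exists 'I_w, u; split; first exact: hid_mono hu.
exists Z; split => //; first by move=> o i; apply: le_trans bb.
by apply: leq_trans nZ _; apply: half_leq.
Qed.

Lemma net1 (I H O : finType) b w (A : H -> I -> R) (v : H -> R)
    (Z : O -> H -> R) :
  (forall k i, `|A k i| <= 1) -> (forall k, `|v k| <= 1) ->
  (forall o k, `|Z o k| <= b) ->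
  ((nnzf A).*2 <= w)%N -> ((nnzf Z).*2 <= w)%N -> (#|H| <= w)%N ->
  (#|O|.*2 <= w)%N ->
  net b w 0 (fun o e => \sum_k Z o k * relu (\sum_i A k i * e i - v k)).
Proof.
move=> A1 v1 Zb nA nZ Hw Ow; split=> //.
exists H, (fun k e => relu (\sum_i A k i * e i - v k)); split.
  apply: hidf0 => //; exists A, v; split=> //.
  by rewrite -(doubleK (nnzf A)) half_leq.
by exists Z; split=> //; rewrite -(doubleK (nnzf Z)) half_leq.
Qed.

(** The readout is absorbed into the weights of the new layer, so ReLUs of signed and shifted
    outputs cost a single layer. [T] lists the variants, with signs [sg], in which every output is
    used. *)
Lemma net_relu (I K O : finType) b w w' h (F : K -> (I -> R) -> R)
    (T : finType) (sg : T -> bool) (v : K * T -> R) (Z : O -> K * T -> R) :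
  0 <= b -> net b w h F ->
  (forall k, `|v k| <= 1) -> (forall o k, `|Z o k| <= b) ->
  (w <= w')%N -> (#|T| * w./2 <= w')%N -> (#|K| * #|T| <= w')%N ->
  ((nnzf Z).*2 <= w')%N -> (#|O|.*2 <= w')%N ->
  net b w' h.+1
    (fun o e => \sum_k Z o k * relu ((-1) ^+ sg k.2 * F k.1 e - v k)).
Proof.
move=> b0 nF v1 Zb ww Tw KTw nZ Ow; split=> //.
have [u [hu [Y [YF Yb nY]]]] := net_hid b0 nF.
exists [the finType of (K * T)%type], (fun k e => relu ((-1) ^+ sg k.2 * F k.1 e - v k)); split.
  apply: (hidfS b0 (hid_mono b0 (lexx b) ww hu)); last by rewrite card_prod.
  exists (fun k i => (-1) ^+ sg k.2 * Y k.1 i), v; split=> //.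
  - move=> k x; congr (relu (_ - _)); rewrite YF mulr_sumr.
    by apply: eq_bigr => i _; rewrite mulrA.
  - by move=> k i; rewrite normrM normr_sign mul1r.
  - apply: leq_trans Tw; rewrite /nnzf.
    rewrite -(pair_big xpredT xpredT (fun k t => \sum_i ((-1) ^+ sg t * Y k i != 0)%R)%N) /=.
    rewrite exchange_big /= -sum_nat_const.
    apply: leq_sum => t _; apply: leq_trans nY.
    apply: leq_sum => k _; apply: leq_sum => i _.
    by rewrite mulf_eq0 signr_eq0.
by exists Z; split=> //; rewrite -(doubleK (nnzf Z)) half_leq.
Qed.

(** Each output crosses the new layer as the pair [relu F], [relu (- F)], whose difference is
    [F]. *)
Lemma net_lincomb (I K O : finType) b w w' h (F : K -> (I -> R) -> R)
    (C : O -> K -> R) :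
  0 <= b -> net b w h F -> (forall o k, `|C o k| <= b) ->
  (w <= w')%N -> ((nnzf C) * 4 <= w')%N -> (#|K|.*2 <= w')%N ->
  (#|O|.*2 <= w')%N ->
  net b w' h.+1 (fun o e => \sum_k C o k * F k e).
Proof.
move=> b0 nF Cb ww nC Kw Ow.
have := @net_relu I K O b w w' h F bool id (fun=> 0)
  (fun o (k : K * bool) => (-1) ^+ k.2 * C o k.1) b0 nF.
have -> : (fun o e => \sum_(k : K * bool) (-1) ^+ k.2 * C o k.1 * relu ((-1) ^+ k.2 * F k.1 e - 0))
  = (fun o e => \sum_k C o k * F k e) :> (O -> (I -> R) -> R).
  apply/funext => o; apply/funext => e.
  rewrite -(pair_big xpredT xpredT (fun k (t : bool) => (-1) ^+ t * C o k * relu ((-1) ^+ t * F k e - 0))) /=.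
  apply: eq_bigr => k _; rewrite big_bool /= !subr0 expr0 expr1 !mul1r !mulN1r.
  by rewrite -[in RHS](reluD (F k e)); ring.
apply=> //.
- by move=> k; rewrite normr0.
- by move=> o k; rewrite normrM normr_sign mul1r.
- by rewrite card_bool; apply: leq_trans ww; rewrite mul2n -[leqRHS]odd_double_half leq_addl.
- by rewrite card_bool muln2.
- apply: leq_trans nC; rewrite -mul2n [leqRHS]mulnC -[4%N]/(2 * 2)%N -mulnA leq_mul2l /=.
  rewrite mul2n -addnn /nnzf -big_split /=; apply: leq_sum => o _.
  rewrite -(pair_big xpredT xpredT (fun k (t : bool) => ((-1) ^+ t * C o k != 0)%R : nat)) /=.
  rewrite -big_split /=; apply: leq_sum => k _.
  by rewrite big_bool /= !mulf_eq0 !signr_eq0.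
Qed.

Lemma hid_trans (X : Type) (I J : finType) (base : I -> X -> R)
    (base2 : J -> X -> R) b w h1 h2 (H : finType) (mid : H -> X -> R)
    (z : 'I_w -> X -> R) :
  0 <= b -> hidf base b w h1 mid ->
  (forall g : 'I_w -> X -> R, layer 1 w./2 base2 g -> layer b w mid g) ->
  hid base2 b h2 z -> hidf base b w (h1 + h2).+1 z.
Proof.
move=> b0 hm mg; elim: h2 z => [|h2 IH] z /=.
  by move=> /mg mz; rewrite addn0; apply: hidfS hm mz _; rewrite ?card_ord.
case=> z' [/IH hz' lz]; rewrite addnS.
by apply: hidfS hz' lz _; rewrite ?card_ord.
Qed.

Lemma layer_subst (X Y : Type) c w (I I' : finType) (u : I -> X -> R)
    (u' : I' -> X -> R) (s : Y -> X) :
  layer c w u u' -> layer c w (fun i y => u i (s y)) (fun i y => u' i (s y)).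
Proof.
by move=> [W [v [Wz Wc vc nW]]]; exists W, v; split.
Qed.

Lemma hid_subst (X Y : Type) (I : finType) (base : I -> X -> R) b w h
    (u : 'I_w -> X -> R) (s : Y -> X) :
  hid base b h u -> hid (fun i y => base i (s y)) b h (fun i y => u i (s y)).
Proof.
elim: h u => [|h IH] u /=; first exact: layer_subst.
by case=> u' [/IH hu' /(@layer_subst _ _ _ _ _ _ _ _ s) l]; exists (fun i y => u' i (s y)).
Qed.

(** Multiplying the readout of [F] with the first weight matrix of [G] would spoil the bounds on
    weights and sparsity. Instead an extra layer holds the positive and negative parts of the
    interface, and [G] reads their differences. Since index [h] means [h.+1] hidden layers, the
    total is [(h1 + h2).+2]. *)
Lemma net_comp (I M O : finType) b w h1 h2 (F : M -> (I -> R) -> R)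
    (G : O -> (M -> R) -> R) :
  1 <= b -> net b w h1 F -> net b w h2 G ->
  net b w (h1 + h2).+2 (fun o e => G o (fun m => F m e)).
Proof.
move=> b1 nF nG; have b0 : 0 <= b by exact: le_trans b1.
have [u [hu [Z [ZF Zb nZ]]]] := net_hid b0 nF.
have [z [hz [Y [YF Yb nY]]]] := net_hid b0 nG.
split; first exact: nG.1.
pose mid (k : M * bool) e := relu ((-1) ^+ k.2 * F k.1 e).
have hm : hidf (fun i (e : I -> R) => e i) b w h1.+1 mid.
  apply: (hidfS b0 (hid_hidf hu)); last by rewrite card_prod card_bool muln2 nF.1.
  exists (fun (k : M * bool) i => (-1) ^+ k.2 * Z k.1 i), (fun=> 0); split=> //.
  - move=> k x; rewrite /mid subr0 ZF mulr_sumr.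
    by congr relu; apply: eq_bigr => i _; rewrite mulrA.
  - by move=> k i; rewrite normrM normr_sign mul1r.
  - by move=> k; rewrite normr0.
  - rewrite /nnzf.
    rewrite -(pair_big xpredT xpredT (fun k (t : bool) => \sum_i ((-1) ^+ t * Z k i != 0)%R)%N) /=.
    rewrite exchange_big /= big_bool /=.
    rewrite -[leqRHS]odd_double_half -addnn; apply: leq_trans (leq_addl _ _).
    by apply: leq_add; apply: leq_trans nZ; apply: leq_nnzf => i j;
      rewrite mulf_eq0 signr_eq0.
exists 'I_w, (fun i e => z i (fun m => F m e)); split; last first.
  by exists Y; split=> // o x; rewrite YF.
have /hid_trans := hm; move=> /(_ M (fun m e => F m e) h2) H.
have -> : ((h1 + h2).+2 = (h1.+1 + h2).+1)%N by rewrite addSn.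
apply: H => //; last exact: (hid_subst (fun e m => F m e) hz).
move=> g [A [v [Ag A1 v1 nA]]].
exists (fun k (mt : M * bool) => (-1) ^+ mt.2 * A k mt.1), v; split=> //.
- move=> k x; rewrite Ag; congr (relu (_ - _)).
  rewrite -(pair_big xpredT xpredT (fun m (t : bool) => (-1) ^+ t * A k m * mid (m, t) x)) /=.
  apply: eq_bigr => m _; rewrite big_bool /mid /= expr0 expr1 !mul1r !mulN1r.
  by rewrite -[in LHS](reluD (F m x)); ring.
- by move=> k i; rewrite normrM normr_sign mul1r; apply: le_trans b1.
- rewrite -[leqRHS]odd_double_half -addnn; apply: leq_trans (leq_addl _ _).
  apply: (@leq_trans (nnzf A + nnzf A)); last by rewrite leq_add.
  rewrite /nnzf -big_split /=; apply: leq_sum => k _.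
  rewrite -(pair_big xpredT xpredT (fun m (t : bool) => ((-1) ^+ t * A k m != 0)%R : nat)) /=.
  rewrite -big_split /=; apply: leq_sum => m _.
  by rewrite big_bool /= !mulf_eq0 !signr_eq0.
Qed.

End Nets.

(** * Parallel nets, padding, copying of units, and a crude Lipschitz bound *)

Section NetOperations.
Context {R : realType}.

Lemma nnzf_pairl (K I J : finType) (W : K * I -> J -> R) :
  nnzf W = (\sum_k nnzf (fun i j => W (k, i) j))%N.
Proof.
by rewrite /nnzf [RHS]pair_big /=; apply: eq_bigr => -[k i].
Qed.

Lemma nnzf_pairr (K I J : finType) (W : I -> K * J -> R) :
  nnzf W = (\sum_k nnzf (fun i j => W i (k, j)))%N.
Proof.
rewrite /nnzf [RHS]exchange_big /=; apply: eq_bigr => i _.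
by rewrite [RHS]pair_big /=; apply: eq_bigr => -[k j].
Qed.

Lemma nnzf0 (I J : finType) : nnzf (fun (_ : I) (_ : J) => 0 : R) = 0%N.
Proof. by apply: big1 => i _; apply: big1 => j _; rewrite eqxx. Qed.

Lemma layer_par_base (X : Type) c w (I H K : finType) (u : I -> X -> R)
    (z : K -> H -> X -> R) :
  (forall k, layer c w u (z k)) ->
  layer c (#|K| * w) u (fun (kh : K * H) => z kh.1 kh.2).
Proof.
move=> /choice[W /choice[v P]].
exists (fun kh => W kh.1 kh.2), (fun kh => v kh.1 kh.2); split.
- by move=> kh x; have [-> _ _ _] := P kh.1.
- by move=> kh i; have [_ /(_ kh.2 i) + _ _] := P kh.1.
- by move=> kh; have [_ _ /(_ kh.2) + _] := P kh.1.
- rewrite nnzf_pairl -sum_nat_const; apply: leq_sum => k _ /=.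
  by have [_ _ _ +] := P k.
Qed.

(** With block diagonal weights the numbers of nonzero entries add up and the bound on the weights
    is kept. *)
Lemma layer_par (X : Type) c w (J H K : finType) (u : K -> J -> X -> R)
    (z : K -> H -> X -> R) : 0 <= c ->
  (forall k, layer c w (u k) (z k)) ->
  layer c (#|K| * w) (fun (kj : K * J) => u kj.1 kj.2)
    (fun (kh : K * H) => z kh.1 kh.2).
Proof.
move=> c0 /choice[W /choice[v P]].
exists (fun kh kj => if kh.1 == kj.1 then W kh.1 kh.2 kj.2 else 0),
  (fun kh => v kh.1 kh.2); split.
- move=> [k h] x /=; have [-> _ _ _] := P k; congr (relu (_ - _)).
  rewrite -(pair_big xpredT xpredT (fun l j => (if k == l then W k h j else 0) * u l j x)) /=.
  rewrite (bigD1 k) //= eqxx [X in _ + X]big1 ?addr0 // => l /negPf lk.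
  by rewrite big1 // => j _; rewrite eq_sym lk mul0r.
- move=> kh kj; case: eqP => _; last by rewrite normr0.
  by have [_ /(_ kh.2 kj.2) + _ _] := P kh.1.
- by move=> kh; have [_ _ /(_ kh.2) + _] := P kh.1.
- rewrite nnzf_pairl -sum_nat_const; apply: leq_sum => k _ /=.
  rewrite nnzf_pairr (bigD1 k) //= eqxx big1 ?addn0; first by have [_ _ _ +] := P k.
  by move=> l /negPf lk; rewrite eq_sym lk nnzf0.
Qed.

Lemma hid_par (X : Type) (I K : finType) (base : I -> X -> R) b w h
    (u : K -> 'I_w -> X -> R) : 0 <= b ->
  (forall k, hid base b h (u k)) ->
  hidf base b (#|K| * w) h (fun (kj : K * 'I_w) => u kj.1 kj.2).
Proof.
move=> b0; elim: h u => [|h IH] u /=.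
  move=> /layer_par_base l; apply: hidf0; last by rewrite card_prod card_ord.
  apply: layer_mono l => //.
  by rewrite geq_half_double doubleMr leq_mul2l -geq_half_double leqnn orbT.
move=> /choice[u' P].
have h' : forall k, hid base b h (u' k) by move=> k; have [] := P k.
have l k : layer b w (u' k) (u k) by have [] := P k.
apply: (hidfS b0 (IH _ h') (layer_par b0 l)).
by rewrite card_prod card_ord.
Qed.

Definition snet (I : finType) (b : R) (w h : nat) (f : (I -> R) -> R) : Prop :=
  net b w h (fun (_ : unit) e => f e).

Lemma net_par (I K : finType) b w h (f : K -> (I -> R) -> R) : 0 <= b ->
  (forall k, snet b w h (f k)) -> net b (#|K| * w) h f.
Proof.
move=> b0 nf; split.
  rewrite -muln2; have [->//|] := posnP #|K|.
  move=> /card_gt0P[k _]; rewrite leq_mul2l; apply/orP; right.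
  by have [] := nf k; rewrite card_unit.
have /choice[u /= /all_and2[hu /choice[Z P]]] := fun k => net_hid b0 (nf k).
exists [the finType of (K * 'I_w)%type], (fun kj => u kj.1 kj.2); split.
  exact: hid_par.
exists (fun k kj => if k == kj.1 then Z k tt kj.2 else 0); split.
- move=> k e; have [/(_ tt e) -> _ _] := P k.
  rewrite -(pair_big xpredT xpredT (fun l j => (if k == l then Z k tt j else 0) * u l j e)) /=.
  rewrite (bigD1 k) //= eqxx [X in _ + X]big1 ?addr0 // => l /negPf lk.
  by rewrite big1 // => j _; rewrite eq_sym lk mul0r.
- move=> k kj; case: eqP => _; last by rewrite normr0.
  by have [_ /(_ tt kj.2) + _] := P k.
- apply: (@leq_trans (#|K| * w./2)); last first.
    by rewrite geq_half_double doubleMr leq_mul2l -geq_half_double leqnn orbT.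
  rewrite -sum_nat_const; apply: leq_sum => k _.
  have [_ _ +] := P k; rewrite /nnzf (big_pred1 tt); last by case.
  apply: leq_trans.
  rewrite -(pair_big xpredT xpredT (fun l j => ((if k == l then Z k tt j else 0) != 0%R) : nat)) /=.
  rewrite (bigD1 k) //= eqxx [X in (_ + X)%N]big1 ?addn0 // => l /negPf lk.
  by rewrite big1 // => j _; rewrite [k == l]eq_sym lk eqxx.
Qed.

Lemma net_ext (I O : finType) (b : R) w h (F G : O -> (I -> R) -> R) :
  (forall o e, F o e = G o e) -> net b w h F -> net b w h G.
Proof. by move=> FG; rewrite (_ : F = G) //; apply/funext => o; apply/funext. Qed.

Lemma snet_ext (I : finType) (b : R) w h (f g : (I -> R) -> R) :
  f =1 g -> snet b w h f -> snet b w h g.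
Proof. by move=> fg; apply: net_ext => ? e. Qed.

(** Identity layers are linear combinations with the unit matrix. *)
Lemma net_pad (I O : finType) b w h h' (F : O -> (I -> R) -> R) :
  1 <= b -> (#|O| * 4 <= w)%N -> (h <= h')%N -> net b w h F -> net b w h' F.
Proof.
move=> b1 Ow; have b0 := le_trans ler01 b1.
move=> /subnK <-; elim: (h' - h)%N => // j IH /IH {}IH; rewrite addSn.
apply: net_ext (net_lincomb (C := fun o k => (o == k)%:R) b0 IH _ _ _ _ _) => //.
- move=> o e; rewrite (bigD1 o) //= eqxx mul1r big1 ?addr0 // => k /negPf.
  by rewrite eq_sym => ->; rewrite mul0r.
- by move=> o k; case: eqP; rewrite ?normr1 ?normr0.
- apply: leq_trans Ow; rewrite leq_mul2r /= /nnzf -sum1_card; apply: leq_sum => o _.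
  rewrite (bigD1 o) //= eqxx oner_eq0 big1 // => k /negPf.
  by rewrite eq_sym => ->; rewrite eqxx.
- by apply: leq_trans Ow; rewrite -muln2 leq_mul2l orbT.
- by apply: leq_trans Ow; rewrite -muln2 leq_mul2l orbT.
Qed.

Lemma snet_pad (I : finType) b w h h' (f : (I -> R) -> R) :
  1 <= b -> (4 <= w)%N -> (h <= h')%N -> snet b w h f -> snet b w h' f.
Proof. by move=> b1 w4; apply: net_pad; rewrite // card_unit mul1n. Qed.

Lemma snet_mono (I : finType) b b' w w' h (f : (I -> R) -> R) :
  0 <= b -> b <= b' -> (w <= w')%N -> snet b w h f -> snet b' w' h f.
Proof. exact: net_mono. Qed.

Lemma snet_lincomb (I K : finType) b w h (f : K -> (I -> R) -> R)
    (c : K -> R) :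
  0 <= b -> (4 <= w)%N -> (0 < #|K|)%N ->
  (forall k, snet b w h (f k)) -> (forall k, `|c k| <= b) ->
  snet b (#|K| * w) h.+1 (fun e => \sum_k c k * f k e).
Proof.
move=> b0 w4 K0 nf cb.
apply: (net_lincomb (C := fun (_ : unit) k => c k) b0 (net_par b0 nf)) => //.
- have := nnzf_card (fun (_ : unit) k => c k); rewrite card_unit mul1n => cK.
  exact: leq_mul.
- by rewrite -muln2 leq_mul2l (leq_trans _ w4) ?orbT.
- by rewrite card_unit -[(1.*2)%N]/(1 * 2)%N leq_mul // (leq_trans _ w4).
Qed.

Lemma snet_comp (I M : finType) b w h1 h2 (f : M -> (I -> R) -> R)
    (g : (M -> R) -> R) :
  1 <= b -> net b w h1 f -> snet b w h2 g ->
  snet b w (h1 + h2).+2 (fun e => g (fun m => f m e)).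
Proof. exact: net_comp. Qed.

(* Large weights are emulated by copying every hidden unit [r] times. *)
Lemma net_copies (I O : finType) b w h r (F : O -> (I -> R) -> R) :
  0 <= b -> (0 < r)%N -> b <= r%:R -> net b w h F -> net 1 (r * r * w) h F.
Proof.
move=> b0 r0 br nF; have [u [hu [Z [ZF Zb nZ]]]] := net_hid b0 nF.
have rR : 0 < r%:R :> R by rewrite ltr0n.
have w_le : (w <= r * r * w)%N by rewrite leq_pmull // muln_gt0 r0.
have halves n : (n <= w./2 -> r * n <= (r * r * w)./2)%N.
  rewrite geq_half_double => nw; rewrite geq_half_double doubleMr -mulnA leq_mul2l.
  by apply/orP; right; apply: leq_trans nw _; rewrite leq_pmull.
have le1 x : `|x| <= b -> `|x / r%:R| <= 1.
  by move=> xb; rewrite normrM normfV [`|r%:R|]gtr0_norm // ler_pdivrMr // mul1r (le_trans xb).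
have sumr (G : 'I_w -> R) (x : I -> R) : forall y : 'I_w -> (I -> R) -> R,
    \sum_(ka : 'I_w * 'I_r) G ka.1 / r%:R * y ka.1 x = \sum_k G k * y k x.
  move=> y; rewrite -(pair_big xpredT xpredT (fun k (a : 'I_r) => G k / r%:R * y k x)) /=.
  apply: eq_bigr => k _; rewrite sumr_const card_ord -mulr_natr.
  by field; rewrite gt_eqF.
have hc : forall u, hid (fun i (e : I -> R) => e i) b h u ->
    hidf (fun i (e : I -> R) => e i) 1 (r * r * w) h
      (fun (ka : 'I_w * 'I_r) => u ka.1).
  have cw : (#|{: 'I_w * 'I_r}| <= r * r * w)%N.
    by rewrite card_prod !card_ord mulnC -mulnA leq_mul2l leq_pmull ?orbT.
  elim: h {nF u hu ZF} => [|h IH] u /=.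
    move=> [W [v [Wz Wc vc nW]]]; apply: hidf0 => //.
    exists (fun ka => W ka.1), (fun ka => v ka.1); split=> //.
    apply: leq_trans (halves _ nW); rewrite /nnzf.
    rewrite -(pair_big xpredT xpredT (fun k (a : 'I_r) => \sum_j (W k j != 0%R))%N) /=.
    rewrite exchange_big /= sum_nat_const card_ord.
    by [].
  case=> u' [/IH hu' [W [v [Wz Wc vc nW]]]].
  apply: (hidfS ler01 hu') => //.
  (* Every copy of a source carries the weight divided by [r]; the sum over the [r] copies restores
     it, and one nonzero entry becomes [r * r]. *)
  exists (fun ka la => W ka.1 la.1 / r%:R), (fun ka => v ka.1); split=> //.
  - by move=> k x; rewrite Wz sumr.
  - by move=> k i; exact: le1.
  - apply: (@leq_trans (r * r * nnzf W)); last by rewrite leq_mul2l nW orbT.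
    rewrite /nnzf.
    rewrite -(pair_big xpredT xpredT (fun k (a : 'I_r) => \sum_(j : 'I_w * 'I_r) ((W k j.1 / r%:R)%R != 0%R))%N) /=.
    rewrite exchange_big /= sum_nat_const card_ord -mulnA leq_mul2l; apply/orP; right.
    rewrite big_distrr /=; apply: leq_sum => k _.
    rewrite -(pair_big xpredT xpredT (fun j (a : 'I_r) => ((W k j / r%:R)%R != 0%R) : nat)) /=.
    rewrite exchange_big /= sum_nat_const card_ord leq_mul2l; apply/orP; right.
    apply: leq_sum => j _; rewrite mulf_eq0 invr_eq0 (gt_eqF rR) orbF.
    by [].
split; first exact: leq_trans nF.1 w_le.
exists [the finType of ('I_w * 'I_r)%type], (fun ka => u ka.1); split; first exact: hc.
exists (fun o ka => Z o ka.1 / r%:R); split.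
- by move=> o x; rewrite ZF sumr.
- by move=> o i; exact: le1.
- apply: leq_trans (halves _ nZ); rewrite /nnzf big_distrr /=.
  apply: leq_sum => o _.
  rewrite -(pair_big xpredT xpredT (fun j (a : 'I_r) => ((Z o j / r%:R)%R != 0%R) : nat)) /=.
  rewrite exchange_big /= sum_nat_const card_ord leq_mul2l; apply/orP; right.
  by apply: leq_sum => j _; rewrite mulf_eq0 invr_eq0 (gt_eqF rR) orbF.
Qed.

Lemma relu_lip (x y : R) : `|relu x - relu y| <= `|x - y|.
Proof.
rewrite /relu; case: (lerP x 0) => ?; case: (lerP y 0) => ?;
  rewrite ?subrr ?normr0 ?subr0 ?sub0r ?normrN //.
- by rewrite gtr0_norm // ler0_norm ?subr_le0; lra.
- by rewrite gtr0_norm // gtr0_norm ?subr_gt0; lra.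
Qed.

(** Each layer expands differences at most by its width times the weight bound. Being exponential in
    the depth, the bound serves only nets of fixed depth. *)
Lemma net_lip (I O : finType) b w h (F : O -> (I -> R) -> R) :
  0 <= b -> net b w h F -> forall D e e', (forall i, `|e i - e' i| <= D) ->
  forall o, `|F o e - F o e'| <= #|I|%:R * (w%:R * b) ^+ h.+1 * D.
Proof.
move=> b0 nF D e e' ee'.
have [u [hu [Z [ZF Zb nZ]]]] := net_hid b0 nF.
have dif (J : finType) (c M : R) (A : J -> R) (y z : J -> R) : 0 <= c -> 
    (forall j, `|A j| <= c) -> (forall j, `|y j - z j| <= M) ->
    `|\sum_j A j * y j - \sum_j A j * z j| <= #|J|%:R * c * M.
  move=> c0 Ac yz; rewrite -sumrB; apply: le_trans (ler_norm_sum _ _ _) _.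
  rewrite -mulrA mulr_natl -sumr_const; apply: ler_sum => j _.
  by rewrite -mulrBr normrM ler_pM.
have hl : forall u : 'I_w -> (I -> R) -> R, hid (fun i (e : I -> R) => e i) b h u ->
    forall k, `|u k e - u k e'| <= #|I|%:R * (w%:R * b) ^+ h * D.
  elim: h {nF u hu ZF} => [|h IH] u /=.
    move=> [W [v [Wz Wc vc nW]]] k; rewrite !Wz.
    apply: le_trans (relu_lip _ _) _; rewrite opprB addrA subrK mulr1.
    by rewrite -[#|I|%:R]mulr1; apply: dif.
  case=> u' [/IH hu' [W [v [Wz Wc vc nW]]]] k; rewrite !Wz.
  apply: le_trans (relu_lip _ _) _; rewrite opprB addrA subrK.
  apply: le_trans (dif _ _ _ _ _ _ b0 (Wc k) hu') _.
  by rewrite card_ord exprS; rewrite le_eqVlt; apply/orP; left; apply/eqP; ring.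
move=> o; rewrite !ZF; apply: le_trans (dif _ _ _ _ _ _ b0 (Zb o) (hl _ hu)) _.
by rewrite card_ord exprS; rewrite le_eqVlt; apply/orP; left; apply/eqP; ring.
Qed.

End NetOperations.

(** * From nets to networks with a bottleneck *)

Section Assembly.
Context {R : realType}.

Lemma mx_norm_le (a b : nat) (A : 'M[R]_(a, b)) (c : R) : 0 <= c ->
  (`|A| <= c) <-> (forall i j, `|A i j| <= c).
Proof.
move=> c0; rewrite [`|A|]mx_normrE; split => [h i j|h].
  by apply: le_trans h; apply: (@le_bigmax _ _ _ 0 (fun ij => `|A ij.1 ij.2|) (i, j)).
by apply: bigmax_le => // -[i j] _; exact: h.
Qed.

Lemma nnz_nnzf (a b : nat) (A : 'M[R]_(a, b)) : nnz A = nnzf (fun i j => A i j).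
Proof.
rewrite /nnz /nnzf pair_big /= -sum1_card big_mkcond /=.
by apply: eq_bigr => ij _; rewrite inE; case: (_ != _).
Qed.

Section Reach.
Context (m o L : nat) (p : nat -> nat).

(** A partial construction is a full network of which only the first [i] layers matter; [s] bounds
    their nonzero weights and shifts. *)
Definition reach (i : nat) (H : finType) (u : H -> 'cV[R]_m -> R) (s : nat) :
    Prop :=
  exists (w : network R m o L p) (f : H -> 'I_(width m p i))
    (g : 'I_(width m p i) -> option H),
  [/\ pcancel f g, ocancel g f, forall k x, hidden w x i (f k) 0 = u k x,
      forall j, (j < i)%N -> `|weight w j| <= 1 /\ `|shift w j.+1| <= 1 &
      (\sum_(j < i) (nnz (weight w j) + nnz (shift w j.+1)) <= s)%N].

Lemma reach0 : reach 0 (fun i (x : 'cV[R]_m) => x i 0) 0.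
Proof.
exists (Network (fun i => 0) 0 (fun i => 0)), id, some; split=> //.
by rewrite big_ord0.
Qed.

Lemma reachS i (H H' : finType) (u : H -> 'cV[R]_m -> R)
    (z : H' -> 'cV[R]_m -> R) s c :
  reach i u s -> layer 1 c u z -> (#|H'| <= p i.+1)%N ->
  reach i.+1 z (s + (c + #|H'|)).
Proof.
move=> [w [f [g [fK gK hu wb ws]]]] [W [v [Wz Wc vc nW]]].
move=> /inj_ord [f' [g' [fK' gK']]].
pose A : 'M[R]_(width m p i.+1, width m p i) :=
  \matrix_(k, j) extend g' (fun h => extend g (W h) j) k.
pose b : 'cV[R]_(width m p i.+1) := \col_k extend g' v k.
pose wt := dfwith (weight w) i A; pose sh := dfwith (shift w) i.+1 b.
pose w' := Network wt (out_weight w) sh.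
have hid_old j x : (j <= i)%N -> hidden w' x j = hidden w x j.
  elim: j => //= j IH ji; rewrite IH ?(ltnW ji)//.
  have ij : i != j by rewrite gtn_eqF.
  have wE : wt j = weight w j by exact: dfwithout.
  have sE : sh j.+1 = shift w j.+1 by apply: dfwithout; rewrite eqSS.
  by rewrite wE sE.
have hid_new x : hidden w' x i.+1 = srelu b (A *m hidden w x i).
  have wE : wt i = A by exact: dfwithin.
  have sE : sh i.+1 = b by exact: dfwithin.
  by rewrite /= hid_old // wE sE.
have old j : (j < i)%N -> wt j = weight w j /\ sh j.+1 = shift w j.+1.
  move=> ji; have ij : i != j by rewrite gtn_eqF.
  by split; apply: dfwithout; rewrite ?eqSS.
exists w', f', g'; split=> //.
- move=> k x; rewrite hid_new !mxE Wz /relu /extend fK'.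
  congr (Num.max (_ - _) 0).
  rewrite -(sum_col (u' := fun j x => hidden w x i j 0) fK gK); last first.
    by move=> l; apply/funext => y.
  by apply: eq_bigr => j _; rewrite mxE /extend fK'.
- move=> j; rewrite ltnS leq_eqVlt => /orP[/eqP->|ji]; last first.
    by have [/= -> ->] := old j ji; exact: wb.
  rewrite /= /wt /sh !dfwithin; split; apply/mx_norm_le => // k l; rewrite mxE /extend.
    by case: (g' k) => [h|]; rewrite ?normr0 //; case: (g l) => [h'|]; rewrite ?normr0.
  by case: (g' k) => [h|]; rewrite ?normr0.
- rewrite big_ord_recr /=; apply: leq_add.
    by apply: leq_trans ws; apply: leq_sum => j _; have [-> ->] := old j (ltn_ord j).
  rewrite /wt /sh !dfwithin !nnz_nnzf; apply: leq_add.
    apply: leq_trans nW; rewrite /nnzf.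
    rewrite -(@sum_extend nat _ _ f' g' (fun h => \sum_j (W h j != 0%R))%N fK' gK').
    apply: leq_sum => k _; rewrite /extend; case E: (g' k) => [h|]; last first.
      by rewrite big1 // => j _; rewrite mxE /extend E eqxx.
    rewrite -(@sum_extend nat _ _ f g (fun i => (W h i != 0%R) : nat) fK gK).
    apply: leq_sum => j _; rewrite mxE /extend E; case: (g j) => //.
    by rewrite eqxx.
  rewrite -sum1_card /nnzf -(@sum_extend nat _ _ f' g' (fun h => 1%N) fK' gK').
  apply: leq_sum => k _; rewrite big_ord1 mxE /extend; case: (g' k) => [h|].
    by case: (_ != _).
  by rewrite eqxx.
Qed.

Lemma reach_mono i (H : finType) (u : H -> 'cV[R]_m -> R) s s' :
  (s <= s')%N -> reach i u s -> reach i u s'.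
Proof.
move=> ss [w [f [g [fK gK hu wb ws]]]]; exists w, f, g; split => //.
exact: leq_trans ss.
Qed.

Lemma reach_hid i (H : finType) (u : H -> 'cV[R]_m -> R) s w h
    (z : 'I_w -> (H -> R) -> R) :
  reach i u s -> hid (fun k (e : H -> R) => e k) 1 h z ->
  (forall j, (i < j <= i + h.+1)%N -> (w <= p j)%N) ->
  reach (i + h.+1) (fun k x => z k (fun l => u l x)) (s + h.+1 * w.*2).
Proof.
move=> ru; elim: h z => [|h IH] z /=.
  move=> /(@layer_subst _ _ _ _ _ _ _ _ _ (fun x l => u l x)) hz wp.
  rewrite addn1; apply: reach_mono (reachS ru hz _).
    rewrite leq_add2l mul1n card_ord -addnn leq_add2r.
    by rewrite -[leqRHS]odd_double_half -addnn addnA leq_addl.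
  by rewrite card_ord wp // addn1 ltnS leqnn.
case=> z' [hz' /(@layer_subst _ _ _ _ _ _ _ _ _ (fun x l => u l x)) lz] wp.
rewrite addnS; apply: reach_mono (reachS (IH _ hz' _) lz _).
- by rewrite card_ord addnn -addnA leq_add2l [leqRHS]mulSn addnC.
- by move=> j hj; apply: wp; lia.
- by rewrite card_ord; apply: wp; lia.
Qed.

(** ReLU fixes nonnegative values, so they survive any number of layers with unit weights. Each
    layer is charged [#|H|] weights and as many shifts. *)
Lemma reach_id i j (H : finType) (u : H -> 'cV[R]_m -> R) s :
  reach i u s -> (forall k x, 0 <= u k x) ->
  (forall k, (i < k <= i + j)%N -> (#|H| <= p k)%N) ->
  reach (i + j) u (s + j * (#|H|).*2).
Proof.
move=> ru u0; elim: j => [|j IH] wp; first by rewrite !addn0.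
have lu : layer 1 #|H| u u.
  exists (fun k l => (k == l)%:R), (fun=> 0); split.
  - move=> k x; rewrite (bigD1 k) //= eqxx mul1r big1 ?addr0 ?subr0.
      by rewrite /relu; apply/esym/max_l.
    by move=> l /negPf; rewrite eq_sym => ->; rewrite mul0r.
  - by move=> k l; case: eqP; rewrite ?normr1 ?normr0.
  - by move=> k; rewrite normr0.
  - rewrite /nnzf -sum1_card; apply: leq_sum => k _.
    rewrite (bigD1 k) //= eqxx oner_eq0 big1 // => l /negPf lk.
    by rewrite [k == l]eq_sym lk eqxx.
rewrite addnS; apply: reach_mono (reachS (IH _) lu _).
- by rewrite addnn -addnA leq_add2l [leqRHS]mulSn addnC.
- by move=> k hk; apply: wp; lia.
- by apply: wp; lia.
Qed.

Lemma reach_out (H : finType) (u : H -> 'cV[R]_m -> R) s c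
    (F : 'I_o -> 'cV[R]_m -> R) :
  reach L u s -> readout 1 c u F ->
  exists w : network R m o L p,
    [/\ forall x j, realize w x j 0 = F j x, bounded_by_one w &
        (sparsity w <= s + c)%N].
Proof.
move=> [w [f [g [fK gK hu wb ws]]]] [Z [FZ Zc nZ]].
pose A : 'M[R]_(o, width m p L) := \matrix_(k, j) extend g (Z k) j.
pose w' := Network (weight w) A (shift w).
have hE j x : hidden w' x j = hidden w x j.
  by elim: j => //= j ->.
exists w'; split.
- move=> x j; rewrite /realize hE mxE FZ.
  rewrite -(sum_col (u' := fun j x => hidden w x L j 0) fK gK); last first.
    by move=> l; apply/funext => y.
  by apply: eq_bigr => k _; rewrite mxE.
- split=> //.
  + by move=> j /wb[].
  + apply/mx_norm_le => // k l; rewrite mxE /extend.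
    by case: (g l) => [h|]; rewrite ?normr0.
  + by move=> [|j] //= /wb[].
- rewrite /sparsity /= addnAC; apply: leq_add.
    apply: leq_trans ws; rewrite big_add1 /= !big_mkord big_split /=.
    by [].
  rewrite nnz_nnzf; apply: leq_trans nZ.
  rewrite /nnzf; apply: leq_sum => k _.
  rewrite -(@sum_extend nat _ _ f g (fun i => (Z k i != 0%R) : nat) fK gK).
  apply: leq_sum => j _; rewrite mxE /extend; case: (g j) => //.
  by rewrite eqxx.
Qed.

End Reach.

(** The encoder outputs pass ReLU in layer [he.+2] and then travel through identity layers of width
    [dt] until [hd.+1] layers are left for the decoder. The bottleneck [L1] is one of these
    [dt]-wide layers, hence the exception for [L1] in the width condition and the term
    [L * dt.*2]. *)
Lemma network_of_nets (m o dt L L1 w he hd : nat) (p : nat -> nat)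
    (E : 'I_dt -> ('I_m -> R) -> R) (G : 'I_o -> ('I_dt -> R) -> R) :
  net 1 w he E -> net 1 w hd G -> (he.+1 < L1)%N -> (L1 + hd.+1 <= L)%N ->
  p L1 = dt -> (forall i, (1 <= i <= L)%N -> i <> L1 -> (w <= p i)%N) ->
  exists wn : network R m o L p,
    [/\ forall x j, realize wn x j 0 =
          G j (fun l => relu (E l (fun i => x i 0))),
        bounded_by_one wn &
        (sparsity wn <= (he + hd + 4) * w.*2 + L * dt.*2)%N].
Proof.
move=> nE nG heL hdL pL1 wp.
have [u [hu rE]] := net_hid ler01 nE; have [z [hz rG]] := net_hid ler01 nG.
have dtw : (dt.*2 <= w)%N by have [] := nE; rewrite card_ord.
have dtp i : (1 <= i <= L)%N -> (dt <= p i)%N.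
  move=> iL; have [->|/eqP iL1] := eqVneq i L1; first by rewrite pL1.
  by apply: leq_trans (wp i iL iL1); apply: leq_trans dtw; rewrite -addnn leq_addr.
pose y l (x : 'cV[R]_m) := relu (E l (fun i => x i 0)).
have r1 : reach o L p he.+1 (fun k x => u k (fun i : 'I_m => x i 0)) (he.+1 * w.*2).
  rewrite -[he.+1]add0n -[X in reach _ _ _ _ _ X]add0n.
  apply: reach_hid hu _; first exact: reach0.
  by move=> j hj; apply: wp; lia.
have r2 : reach o L p he.+2 y (he.+1 * w.*2 + (w + dt)).
  apply: reach_mono (reachS r1 (c := w) (z := y) _ _).
  - by rewrite card_ord.
  - have [Z [EZ Z1 nZ]] := rE.
    exists Z, (fun=> 0); split=> //.
    + by move=> k x; rewrite subr0 /y EZ.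
    + by move=> k; rewrite normr0.
    + by apply: leq_trans nZ _; rewrite -[leqRHS]odd_double_half -addnn addnA leq_addl.
  - by rewrite card_ord; apply: dtp; lia.
have r3 : reach o L p (L - hd.+1) y
    (he.+1 * w.*2 + (w + dt) + (L - hd.+1 - he.+2) * dt.*2).
  have LE : (L - hd.+1 = he.+2 + (L - hd.+1 - he.+2))%N by lia.
  rewrite [X in reach _ _ _ X]LE.
  have := @reach_id m o L p he.+2 (L - hd.+1 - he.+2)%N _ y _ r2.
  rewrite card_ord; apply; first by move=> k x; rewrite /y /relu le_max lexx orbT.
  by move=> k hk; apply: dtp; lia.
have r4 := reach_hid r3 hz; rewrite subnK in r4; last by lia.
have {}r4 := r4 (fun j hj => wp j ltac:(lia) ltac:(lia)).
have [|wn [wnE wb ws]] := @reach_out m o L p _ _ _ w./2 (fun j x => G j (fun l => y l x)) r4.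
  by have [Z [GZ Z1 nZ]] := rG; exists Z; split=> // j x; rewrite GZ.
exists wn; split=> //; apply: leq_trans ws _.
have : (w./2 <= w)%N by rewrite -[leqRHS]odd_double_half -addnn addnA leq_addl.
have : ((L - hd.+1 - he.+2) * dt.*2 <= L * dt.*2)%N by rewrite leq_mul2r; lia.
rewrite !mulnDl !mulSn; lia.
Qed.

End Assembly.

(** * Piecewise linear functions and multiplication *)

Section PiecewiseLinear.
Context {R : realType}.

Lemma relu_ge0 (x : R) : 0 <= x -> relu x = x.
Proof. by move=> x0; apply/max_l. Qed.

Lemma relu_le0 (x : R) : x <= 0 -> relu x = 0.
Proof. by move=> x0; apply/max_r. Qed.

Definition slope (B : nat) (y : nat -> R) (j : nat) : R :=
  if (j < B)%N then B%:R * (y j.+1 - y j) else 0.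

Definition kink (B : nat) (y : nat -> R) (j : nat) : R :=
  slope B y j - (if j is i.+1 then slope B y i else 0).

(** The interpolant of the values [y j] at the nodes [j / B], written as a sum of ReLUs over its
    kinks. As [slope] vanishes from [B] on, it is constant outside [[0, 1]]. *)
Definition pl (B : nat) (y : nat -> R) (x : R) : R :=
  y 0%N + \sum_(j < B.+1) kink B y j * relu (x - j%:R / B%:R).

Lemma kink_le (B : nat) (y : nat -> R) (j : nat) (M : R) :
  (forall i, `|y i.+1 - y i| <= M) -> `|kink B y j| <= 2 * B%:R * M.
Proof.
move=> yM.
have M0 : 0 <= M by apply: le_trans (yM 0%N); exact: normr_ge0.
have sl i : `|slope B y i| <= B%:R * M.
  rewrite /slope; case: ifP => _; last by rewrite normr0 mulr_ge0.
  by rewrite normrM ger0_norm // ler_wpM2l.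
rewrite /kink; apply: le_trans (ler_normB _ _) _.
rewrite -mulrA mulr_natl mulr2n lerD //; case: j => [|j]; last exact: sl.
by rewrite normr0 mulr_ge0.
Qed.

Lemma kink_sum (B : nat) (y : nat -> R) x k : (k <= B)%N ->
  y 0%N + \sum_(j < k.+1) kink B y j * (x - j%:R / B%:R)
    = y k + slope B y k * (x - k%:R / B%:R).
Proof.
elim: k => [|k IH] kB; first by rewrite big_ord1 /kink subr0.
rewrite big_ord_recr /= addrA IH ?(ltnW kB) // /kink {1}/slope kB.
rewrite [slope B y k]/slope kB.
have B0 : B%:R != 0 :> R by rewrite pnatr_eq0; case: (B) kB.
by rewrite -[k.+1%:R]natr1; field.
Qed.

Lemma pl_cut (B : nat) (y : nat -> R) x k : (k <= B)%N ->
  (k%:R / B%:R <= x \/ k = 0%N /\ x <= 0) ->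
  (k = B \/ x <= k.+1%:R / B%:R) ->
  pl B y x = y 0%N + \sum_(j < k.+1) kink B y j * relu (x - j%:R / B%:R).
Proof.
move=> kB _ hx; congr (_ + _).
rewrite -(big_mkord xpredT (fun j => kink B y j * relu (x - j%:R / B%:R))).
rewrite (@big_cat_nat _ _ _ k.+1) //= big_mkord.
rewrite [X in _ + X]big_nat_cond [X in _ + X]big1 ?addr0 // => j.
rewrite andbT => /andP[kj jB].
rewrite relu_le0 ?mulr0 // subr_le0; case: hx => [kE|hx]; first by lia.
apply: le_trans hx _; rewrite ler_pM2r ?ler_nat // invr_gt0 ltr0n.
by lia.
Qed.

Lemma pl_cell (B : nat) (y : nat -> R) x k : (k < B)%N ->
  k%:R / B%:R <= x <= k.+1%:R / B%:R ->
  pl B y x = (1 - (B%:R * x - k%:R)) * y k + (B%:R * x - k%:R) * y k.+1.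
Proof.
move=> kB /andP[kx xk].
have B0 : (0 : R) < B%:R by rewrite ltr0n; case: (B) kB.
rewrite (@pl_cut _ _ _ k) ?(ltnW kB) //; [|by left|by right].
rewrite (eq_bigr (fun j : 'I_k.+1 => kink B y j * (x - j%:R / B%:R))); last first.
  move=> j _; rewrite relu_ge0 // subr_ge0; apply: le_trans kx.
  by rewrite ler_pM2r ?invr_gt0 // ler_nat -ltnS ltn_ord.
rewrite kink_sum ?(ltnW kB) // /slope kB.
by field; rewrite gt_eqF.
Qed.

Lemma unit_cell (B : nat) (x : R) : (0 < B)%N -> 0 <= x <= 1 ->
  exists2 k, (k < B)%N & k%:R / B%:R <= x <= k.+1%:R / B%:R.
Proof.
move=> B0 /andP[x0 x1].
have BR : (0 : R) < B%:R by rewrite ltr0n.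
have [->|xn1] := eqVneq x 1.
  exists B.-1; first by rewrite prednK.
  by rewrite prednK // divff ?gt_eqF // lexx andbT ler_pdivrMr // mul1r ler_nat leq_pred.
have Bx0 : 0 <= x * B%:R by rewrite mulr_ge0 // ltW.
exists (Num.truncn (x * B%:R)).
  rewrite -(ltr_nat R); apply: le_lt_trans (_ : x * B%:R < _).
    by have /andP[] := truncn_itv Bx0.
  by rewrite gtr_pMl // lt_neqAle xn1.
have /andP[h1 h2] := truncn_itv Bx0.
by rewrite ler_pdivrMr // h1 ler_pdivlMr // ltW.
Qed.

Lemma cell_coord (B : nat) (x : R) k : (0 < B)%N ->
  k%:R / B%:R <= x <= k.+1%:R / B%:R ->
  0 <= B%:R * x - k%:R <= 1.
Proof.
move=> B0; rewrite -(ltr0n R) in B0.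
by rewrite ler_pdivrMr // ler_pdivlMr // -[k.+1%:R]natr1 => /andP[h1 h2]; lra.
Qed.

(** The cell and the weight depend on [x] only, so several interpolants can be evaluated in the same
    cell. Outside [[0, 1]] the nearest end node gets all the weight. *)
Lemma pl_convex (B : nat) (x : R) : (0 < B)%N ->
  exists k z, [/\ (k < B)%N, 0 <= z <= 1,
    forall y, pl B y x = (1 - z) * y k + z * y k.+1 &
    0 <= x <= 1 -> z = B%:R * x - k%:R].
Proof.
move=> B0; have BR : (0 : R) < B%:R by rewrite ltr0n.
have [x0|x0] := ltP x 0.
  exists 0%N, 0; split; [by []|by rewrite lexx ler01| |by move=> h; lra].
  move=> y; rewrite (@pl_cut _ _ _ 0) //.
  - by rewrite big_ord1 relu_le0; [ring|rewrite mul0r subr0 ltW].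
  - by right; rewrite ltW.
  - by right; apply: le_trans (ltW x0) _; rewrite divr_ge0.
have [x1|x1] := ltP 1 x.
  exists B.-1, 1; split; [by rewrite prednK|by rewrite lexx ler01| |by move=> h; lra].
  move=> y; rewrite prednK // (@pl_cut _ _ _ B) //; last by left.
    rewrite (eq_bigr (fun j : 'I_B.+1 => kink B y j * (x - j%:R / B%:R))).
      by rewrite kink_sum // /slope ltnn mul0r addr0 subrr mul0r add0r mul1r.
    move=> j _; rewrite relu_ge0 // subr_ge0; apply: le_trans (ltW x1).
    by rewrite ler_pdivrMr // mul1r ler_nat -ltnS.
  by left; rewrite divff ?ltW // gt_eqF.
have x01 : 0 <= x <= 1 by rewrite x0.
have [k kB hk] := unit_cell B0 x01.
exists k, (B%:R * x - k%:R); split=> //; first exact: cell_coord.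
by move=> y; exact: pl_cell.
Qed.

(** Between points of different cells, the nodes in between are inserted; the distances along the
    line add up. *)
Lemma lip_cells (u : R -> R) (J : nat) (M : R) : (0 < J)%N ->
  (forall j s t, (j < J)%N -> j%:R / J%:R <= s <= j.+1%:R / J%:R ->
     j%:R / J%:R <= t <= j.+1%:R / J%:R -> `|u s - u t| <= M * `|s - t|) ->
  forall s t, 0 <= s <= 1 -> 0 <= t <= 1 -> `|u s - u t| <= M * `|s - t|.
Proof.
move=> J0 uc; have JR : (0 : R) < J%:R by rewrite ltr0n.
have main k : (k <= J)%N -> forall s t, 0 <= s -> s <= t -> t <= k%:R / J%:R ->
    `|u s - u t| <= M * `|s - t|.
  elim: k => [|k IH] kJ s t s0 st tk.
    rewrite mul0r in tk; have -> : s = t by apply/eqP; rewrite eq_le st /=; lra.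
    by rewrite !subrr normr0 mulr0.
  have [tk'|tk'] := leP t (k%:R / J%:R); first exact: IH (ltnW kJ) s t s0 st tk'.
  have kk : k%:R / J%:R <= k.+1%:R / J%:R :> R.
    by rewrite ler_pM2r ?invr_gt0 // ler_nat.
  have [sk|sk] := leP (k%:R / J%:R) s.
    by apply: (uc k) => //; apply/andP; split => //; lra.
  have h1 := IH (ltnW kJ) s (k%:R / J%:R) s0 (ltW sk) (lexx _).
  have h2 : `|u (k%:R / J%:R) - u t| <= M * `|k%:R / J%:R - t|.
    by apply: (uc k) => //; apply/andP; split => //; lra.
  have -> : u s - u t = (u s - u (k%:R / J%:R)) + (u (k%:R / J%:R) - u t).
    by rewrite addrA subrK.
  apply: le_trans (ler_normD _ _) _.
  have -> : `|s - t| = `|s - k%:R / J%:R| + `|k%:R / J%:R - t|.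
    by rewrite !ler0_norm ?subr_le0 ?(ltW sk) ?(ltW tk') //; ring.
  by rewrite mulrDr lerD.
move=> s t /andP[s0 s1] /andP[t0 t1].
have JJ : J%:R / J%:R = 1 :> R by rewrite divff // gt_eqF.
have [st|/ltW st] := leP s t; first by apply: (main J) => //; rewrite JJ.
by rewrite distrC [`|s - t|]distrC; apply: (main J) => //; rewrite JJ.
Qed.

End PiecewiseLinear.

(** * Squares and products from the self-similar parabola *)

Section Squaring.
Context {R : realType} (B : nat).
Context (B2 : (1 < B)%N).

Let BR : (0 : R) < B%:R. Proof. by rewrite ltr0n ltnW. Qed.
Let B0 : (0 < B)%N. Proof. exact: ltnW. Qed.

Definition parabola (x : R) : R := x - x ^+ 2.
Definition zigzag (x : R) : R := pl B (fun j => (odd j)%:R) x.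
Definition parabola_pl (x : R) : R := pl B (fun j => parabola (j%:R / B%:R)) x.

(** The recursion [parabola_rec], cut off after [m] steps. *)
Fixpoint parabola_net (m : nat) (x : R) : R :=
  if m is m'.+1 then parabola_pl x + B%:R ^- 2 * parabola_net m' (zigzag x)
  else 0.

Lemma zigzag01 x : 0 <= zigzag x <= 1.
Proof.
rewrite /zigzag; have [k [z [_ z01 -> _]]] := pl_convex x B0.
by rewrite oddS; case: (odd k); rewrite /= ?mulr1 ?mulr0 ?addr0 ?add0r; lra.
Qed.

Lemma parabola_pl_ge0 x : 0 <= parabola_pl x.
Proof.
rewrite /parabola_pl; have [k [z [kB z01 -> _]]] := pl_convex x B0.
have q0 j : (j <= B)%N -> 0 <= parabola (j%:R / B%:R).
  move=> jB; have h0 : 0 <= j%:R / B%:R :> R by rewrite divr_ge0.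
  have h1 : j%:R / B%:R <= 1 :> R by rewrite ler_pdivrMr // mul1r ler_nat.
  by rewrite /parabola; nra.
have := q0 k (ltnW kB); have := q0 k.+1 kB => h1 h2.
by apply: addr_ge0; apply: mulr_ge0 => //; lra.
Qed.

(* On each cell of the mesh, the parabola exceeds its chord by a copy of itself
   shrunk by [B ^ 2]; by symmetry of the parabola the copies can be traversed
   alternately in both directions, which makes them continuous. *)
Lemma parabola_rec x : 0 <= x <= 1 ->
  parabola x = parabola_pl x + B%:R ^- 2 * parabola (zigzag x).
Proof.
move=> x01; rewrite /parabola_pl /zigzag.
have [k [z [_ z01 plE /(_ x01) zE]]] := pl_convex x B0; rewrite !plE.
have -> : x = (k%:R + z) / B%:R by rewrite zE; field; rewrite gt_eqF.
rewrite /parabola oddS -[k.+1%:R]natr1.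
by case: (odd k); rewrite /= ?mulr1 ?mulr0 ?addr0 ?add0r; field; rewrite gt_eqF.
Qed.

Lemma zigzag_lip x y : 0 <= x <= 1 -> 0 <= y <= 1 ->
  `|zigzag x - zigzag y| <= B%:R * `|x - y|.
Proof.
apply: lip_cells B0 _ _ _ => j s t jB hs ht.
rewrite /zigzag !(@pl_cell _ _ _ _ j) // oddS.
have -> : B%:R * `|s - t| = `|B%:R * (s - t)| by rewrite normrM [`|B%:R|]gtr0_norm.
case: (odd j); rewrite /= ?mulr1 ?mulr0 ?addr0 ?add0r.
  by rewrite distrC le_eqVlt; apply/orP; left; apply/eqP; congr `|_|; ring.
by rewrite le_eqVlt; apply/orP; left; apply/eqP; congr `|_|; ring.
Qed.

Lemma iter_zigzag01 m x : 0 <= x <= 1 -> 0 <= iter m zigzag x <= 1.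
Proof. by case: m => //= m _; exact: zigzag01. Qed.

Lemma iter_zigzag_lip m x y : 0 <= x <= 1 -> 0 <= y <= 1 ->
  `|iter m zigzag x - iter m zigzag y| <= B%:R ^+ m * `|x - y|.
Proof.
move=> x01 y01; elim: m => [|m IH] /=; first by rewrite mul1r.
apply: le_trans (zigzag_lip (iter_zigzag01 m x01) (iter_zigzag01 m y01)) _.
by rewrite exprS -mulrA ler_pM2l.
Qed.

(** The remainder is explicit. Its size is at most [B ^ (-2m)], and since the iterated zigzag has
    slope at most [B ^ m], its Lipschitz constant is at most [B ^ (-m)]. *)
Lemma parabola_netE m x : 0 <= x <= 1 ->
  parabola_net m x = parabola x - B%:R ^- 2 ^+ m * parabola (iter m zigzag x).
Proof.
elim: m x => [|m IH] x x01; first by rewrite expr0 mul1r subrr.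
rewrite [LHS]/= IH ?zigzag01 // (parabola_rec x01) -iterSr [_ ^+ m.+1]exprS.
by ring.
Qed.

Lemma parabola_net_ge0 m x : 0 <= parabola_net m x.
Proof.
by elim: m x => //= m IH x; rewrite addr_ge0 ?parabola_pl_ge0 // mulr_ge0.
Qed.

Definition square_net m (u : R) := u - parabola_net m u.

(** Polarization: [x * y] is the square of [(x + y) / 2] minus the square of [(x - y) / 2]. The
    absolute values bring the arguments into [[0, 1]], where the squares are approximated. *)
Definition mult_net m (x y : R) :=
  square_net m (`|x + y| / 2) - square_net m (`|x - y| / 2).

Definition mult_err m (x y : R) := mult_net m x y - x * y.

Let half01 (x y : R) : `|x| <= 1 -> `|y| <= 1 -> 0 <= `|x + y| / 2 <= 1.
Proof.
move=> x1 y1; have := ler_normD x y; have := normr_ge0 (x + y).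
by lra.
Qed.

Let half01N (x y : R) : `|x| <= 1 -> `|y| <= 1 -> 0 <= `|x - y| / 2 <= 1.
Proof. by move=> x1 y1; apply: half01; rewrite ?normrN. Qed.

Let eta_sq m : (B%:R : R) ^- 2 ^+ m = B%:R ^- m * B%:R ^- m.
Proof. by rewrite exprVn -exprM mulnC exprM expr2 invfM. Qed.

Let eta_le m : 0 <= (B%:R : R) ^- 2 ^+ m <= B%:R ^- m.
Proof.
have b0 : 0 < B%:R ^+ m :> R by rewrite exprn_gt0.
have bV : 0 < B%:R ^- m :> R by rewrite invr_gt0.
rewrite eta_sq mulr_ge0 ?(ltW bV) //= -[leRHS]mulr1 ler_pM2l // invf_le1 //.
by rewrite exprn_ege1 // ler1n.
Qed.

Lemma parabola01 x : 0 <= x <= 1 -> 0 <= parabola x <= 1.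
Proof. by rewrite /parabola => /andP[x0 x1]; apply/andP; split; nra. Qed.

Lemma mult_errE m x y : `|x| <= 1 -> `|y| <= 1 ->
  mult_err m x y = B%:R ^- 2 ^+ m *
    (parabola (iter m zigzag (`|x + y| / 2))
     - parabola (iter m zigzag (`|x - y| / 2))).
Proof.
move=> x1 y1; rewrite /mult_err /mult_net /square_net.
rewrite (parabola_netE m (half01 x1 y1)) (parabola_netE m (half01N x1 y1)).
move: (_ ^+ m) (parabola (iter _ _ _)) (parabola (iter _ _ _)) => c a1 a2.
rewrite /parabola !exprMn !real_normK ?num_real //.
by field.
Qed.

Lemma mult_err_le m x y : `|x| <= 1 -> `|y| <= 1 ->
  `|mult_err m x y| <= B%:R ^- m.
Proof.
move=> x1 y1; rewrite mult_errE // normrM.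
have /andP[e0 e1] := eta_le m; rewrite ger0_norm //.
apply: le_trans e1; rewrite -[leRHS]mulr1 ler_wpM2l //.
have := parabola01 (iter_zigzag01 m (half01 x1 y1)).
have := parabola01 (iter_zigzag01 m (half01N x1 y1)).
by move=> h1 h2; rewrite ler_norml; lra.
Qed.

Lemma mult_err_lip m x y x' y' :
  `|x| <= 1 -> `|y| <= 1 -> `|x'| <= 1 -> `|y'| <= 1 ->
  `|mult_err m x y - mult_err m x' y'| <= B%:R ^- m * (`|x - x'| + `|y - y'|).
Proof.
move=> x1 y1 x1' y1'; rewrite !mult_errE // -mulrBr normrM.
have par_lip a b : 0 <= a <= 1 -> 0 <= b <= 1 ->
    `|parabola a - parabola b| <= `|a - b|.
  move=> a01 b01; have -> : parabola a - parabola b = (1 - a - b) * (a - b).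
    by rewrite /parabola; ring.
  by rewrite normrM -[leRHS]mul1r ler_wpM2r // ler_norml; lra.
have step u v : 0 <= u <= 1 -> 0 <= v <= 1 ->
    `|parabola (iter m zigzag u) - parabola (iter m zigzag v)| <= B%:R ^+ m * `|u - v|.
  move=> u01 v01; apply: le_trans (iter_zigzag_lip m u01 v01).
  by apply: par_lip; exact: iter_zigzag01.
have h1 := step _ _ (half01 x1 y1) (half01 x1' y1').
have h2 := step _ _ (half01N x1 y1) (half01N x1' y1').
have Bm : 0 < B%:R ^+ m :> R by rewrite exprn_gt0.
have -> : `|B%:R ^- 2 ^+ m| = B%:R ^- m * B%:R ^- m :> R.
  by rewrite ger0_norm ?eta_sq //; have /andP[] := eta_le m.
rewrite -mulrA ler_pM2l ?invr_gt0 // [leLHS]mulrC ler_pdivrMr // [leRHS]mulrC.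
have tri (p q r t : R) : `|p - q - (r - t)| <= `|p - r| + `|q - t|.
  have -> : p - q - (r - t) = (p - r) - (q - t) by ring.
  exact: ler_normB.
apply: le_trans (tri _ _ _ _) _.
apply: le_trans (lerD h1 h2) _; rewrite -mulrDr ler_pM2l //.
have d1 : `| `|x + y| - `|x' + y'| | <= `|x - x'| + `|y - y'|.
  apply: le_trans (ler_dist_dist _ _) _.
  have -> : x + y - (x' + y') = (x - x') + (y - y') by ring.
  exact: ler_normD.
have d2 : `| `|x - y| - `|x' - y'| | <= `|x - x'| + `|y - y'|.
  apply: le_trans (ler_dist_dist _ _) _.
  have -> : x - y - (x' - y') = (x - x') - (y - y') by ring.
  exact: ler_normB.
by rewrite -!mulrBl !normrM [`|2^-1|]gtr0_norm ?invr_gt0 //; lra.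
Qed.

(** The approximate square lies between the true square and its argument, so it stays in [[0, 1]].
    Hence products can be iterated without clipping. *)
Lemma mult_net_le m x y : `|x| <= 1 -> `|y| <= 1 -> `|mult_net m x y| <= 1.
Proof.
move=> x1 y1; have sq u : 0 <= u <= 1 -> 0 <= square_net m u <= 1.
  move=> u01; apply/andP; split; last by have := parabola_net_ge0 m u; rewrite /square_net; lra.
  rewrite /square_net parabola_netE //.
  have /andP[h _] := parabola01 (iter_zigzag01 m u01); have /andP[e0 _] := eta_le m.
  have := mulr_ge0 e0 h; move: (_ * _) => c; rewrite /parabola.
  by have := sqr_ge0 u; lra.
have := sq _ (half01 x1 y1); have := sq _ (half01N x1 y1).
by rewrite /mult_net => h1 h2; rewrite ler_norml; lra.
Qed.

End Squaring.

(** * Nets for gains, hats, displacements and products *)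

Section BasicNets.
Context {R : realType}.

Lemma net1_card (I H O : finType) b w (A : H -> I -> R) (v : H -> R)
    (Z : O -> H -> R) :
  (forall k i, `|A k i| <= 1) -> (forall k, `|v k| <= 1) ->
  (forall o k, `|Z o k| <= b) -> (#|H|.+1 * (#|I| + #|O|).+1 * 2 <= w)%N ->
  net b w 0 (fun o e => \sum_k Z o k * relu (\sum_i A k i * e i - v k)).
Proof.
move=> A1 v1 Zb hw; have nA := nnzf_card A; have nZ := nnzf_card Z.
by apply: net1 => //; nia.
Qed.

Lemma sum_delta (I : finType) (i : I) (F : I -> R) :
  \sum_j (j == i)%:R * F j = F i.
Proof.
rewrite (bigD1 i) //= eqxx mul1r big1 ?addr0 // => j /negPf ->.
by rewrite mul0r.
Qed.

Lemma normr_delta_le1 (c : bool) : `|c%:R| <= 1 :> R.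
Proof. by case: c; rewrite ?normr1 ?normr0. Qed.

(** Factors beyond the weight bound are composed of [m] factors [b], at two layers each. *)
Lemma snet_gain b w m : 1 <= b -> (24 <= w)%N ->
  snet b w m.*2 (fun e : unit -> R => b ^+ m * e tt).
Proof.
move=> b1 w24; have b0 := le_trans ler01 b1.
have lin c : `|c| <= b -> snet b w 0 (fun e : unit -> R => c * e tt).
  move=> cb.
  have := @net1_card unit bool unit b w (fun k _ => (-1) ^+ k) (fun=> 0)
    (fun _ k => (-1) ^+ k * c).
  rewrite !card_unit card_bool => H; have {}H := H _ _ _ ltac:(lia).
  apply: net_ext (H _ _ _).
  - move=> o e; rewrite big_bool /= !(big_pred1 tt) /=; try by case.
    by rewrite !subr0 expr0 expr1 !mul1r !mulN1r -[in RHS](reluD (e tt)); ring.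
  - by move=> k _; rewrite normr_sign.
  - by move=> k; rewrite normr0.
  - by move=> _ k; rewrite normrM normr_sign mul1r.
elim: m => [|m IH]; first by apply: lin; rewrite normr1.
have := snet_comp b1 (lin b _) IH.
rewrite add0n => H; apply: snet_ext (H _); last by rewrite ger0_norm.
by move=> e; rewrite mulrA -exprSr.
Qed.

(** At the last node the third ReLU would need a shift above [1]; it is dropped there, where it
    would vanish on [[0, 1]] anyway. *)
Definition hat (J j : nat) (x : R) : R :=
  J%:R * (relu (x - (j%:R - 1) / J%:R) - 2 * relu (x - j%:R / J%:R)
          + (j < J)%:R * relu (x - (j%:R + 1) / J%:R)).

Lemma hat_cell (J c j : nat) (x : R) : (c < J)%N -> (j <= J)%N ->
  c%:R / J%:R <= x <= c.+1%:R / J%:R ->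
  hat J j x = (1 - (J%:R * x - c%:R)) * (j == c)%:R
              + (J%:R * x - c%:R) * (j == c.+1)%:R.
Proof.
move=> cJ jJ; have J0 : (0 : R) < J%:R by rewrite ltr0n; case: (J) cJ.
rewrite ler_pdivrMr // ler_pdivlMr // -[c.+1%:R]natr1 => /andP[h1 h2].
have r (t : R) : J%:R * relu (x - t / J%:R) = relu (J%:R * x - t).
  have -> : J%:R * x - t = J%:R * (x - t / J%:R) by field; rewrite gt_eqF.
  by rewrite /relu maxr_pMr ?mulr0 // ltW.
have -> : hat J j x = relu (J%:R * x - (j%:R - 1)) - 2 * relu (J%:R * x - j%:R)
          + (j < J)%:R * relu (J%:R * x - (j%:R + 1)).
  by rewrite -!r /hat; ring.
have [jc|jc|->] := ltngtP j c.
- rewrite (ltn_trans jc cJ) (ltn_eqF (ltn_trans jc (ltnSn c))) mul1r !mulr0 addr0.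
  have : j%:R + 1 <= c%:R :> R by rewrite natr1 ler_nat.
  by move=> ?; rewrite !relu_ge0; lra.
- have : c%:R + 1 <= j%:R :> R by rewrite natr1 ler_nat.
  move=> h; rewrite [relu (_ - j%:R)]relu_le0 ?[relu (_ - (j%:R + 1))]relu_le0; try lra.
  have [->|jn] := eqVneq j c.+1.
    by rewrite -[c.+1%:R]natr1 relu_ge0 ?mulr0 ?mulr1; lra.
  have : c%:R + 1 + 1 <= j%:R :> R.
    by rewrite !natr1 ler_nat ltn_neqAle eq_sym jn.
  by move=> ?; rewrite relu_le0 ?mulr0; lra.
- rewrite ltn_eqF // cJ [relu (_ - (_ - 1))]relu_ge0; last by lra.
  by rewrite relu_ge0 ?relu_le0 ?mulr0 ?mulr1; lra.
Qed.

(** Only the hats at the two ends of the cell survive, so weighting by hats is linear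
    interpolation. *)
Lemma hat_sum (J c : nat) (x : R) (F : nat -> R) : (c < J)%N ->
  c%:R / J%:R <= x <= c.+1%:R / J%:R ->
  \sum_(j < J.+1) hat J j x * F j =
    (1 - (J%:R * x - c%:R)) * F c + (J%:R * x - c%:R) * F c.+1.
Proof.
move=> cJ hx.
rewrite (eq_bigr (fun j : 'I_J.+1 => (1 - (J%:R * x - c%:R)) * ((j == c :> nat)%:R * F j)
    + (J%:R * x - c%:R) * ((j == c.+1 :> nat)%:R * F j))); last first.
  move=> j _; have jJ : (j <= J)%N by rewrite -ltnS.
  by rewrite (hat_cell cJ jJ hx); ring.
rewrite big_split /= -!mulr_sumr.
have c1 : (c.+1 < J.+1)%N by [].
have c0 : (c < J.+1)%N by exact: ltnW.
by rewrite (sum_delta (Ordinal c0) (fun j => F j)) (sum_delta (Ordinal c1) (fun j => F j)).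
Qed.

Lemma snet_hat (a : nat) (i : 'I_a) J j b w m : 2 <= b -> (0 < J)%N ->
  (j <= J)%N -> J%:R <= b ^+ m -> (8 * (a + 3) <= w)%N ->
  snet b w m.+1.*2 (fun e : 'I_a -> R => hat J j (e i)).
Proof.
move=> b2 J0 jJ Jbm wa; have b1 : 1 <= b by lra.
have JR : (0 : R) < J%:R by rewrite ltr0n.
have bm : 0 < b ^+ m by apply: lt_le_trans Jbm.
(* The hat divided by [b ^ m] has outer weights at most [2 <= b]; the factor [b ^ m] is restored by
   [snet_gain]. *)
pose g := J%:R / b ^+ m.
have g1 : 0 <= g <= 1.
  by rewrite /g ler_pdivrMr // mul1r Jbm andbT divr_ge0 // ltW.
pose v := [:: (j%:R - 1) / J%:R; j%:R / J%:R; if (j < J)%N then (j%:R + 1) / J%:R else 0 : R].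
pose z := [:: g; - (2 * g); (j < J)%:R * g].
have := @net1_card 'I_a 'I_3 unit b w (fun _ l => (l == i)%:R)
  (fun k => nth 0 v k) (fun _ k => nth 0 z k).
rewrite !card_ord card_unit => H0.
have nv (k : 'I_3) : `|nth 0 v k| <= 1.
  have jJR : j%:R <= J%:R :> R by rewrite ler_nat.
  have J1 : 1 <= J%:R :> R by rewrite ler1n.
  have j0 : 0 <= j%:R :> R by [].
  case: k => -[|[|[|//]]] _ /=; rewrite ?ler_norml.
  - by rewrite ler_pdivlMr // ler_pdivrMr //; lra.
  - by rewrite ler_pdivlMr // ler_pdivrMr //; lra.
  - rewrite /nth; case: ifP => [jJ'|_]; last by lra.
    have : j%:R + 1 <= J%:R :> R by rewrite natr1 ler_nat.
    by move=> ?; rewrite ler_pdivlMr // ler_pdivrMr //; lra.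
have nz (k : 'I_3) : `|nth 0 z k| <= b.
  case: k => -[|[|[|//]]] _ /=; rewrite ler_norml; try lra.
  by case: (j < J)%N; rewrite ?mul1r ?mul0r; lra.
have {H0}n0 := H0 (fun _ _ => normr_delta_le1 _) nv (fun _ => nz) ltac:(lia).
have w24 : (24 <= w)%N by lia.
have := snet_comp b1 (n0 : net b w 0 _) (snet_gain m b1 w24).
apply: snet_ext => e; rewrite big_ord_recl big_ord_recl big_ord1 /=.
rewrite (sum_delta i) /hat /g.
case: (j < J)%N; rewrite /= ?mul1r ?mul0r.
  by field; rewrite gt_eqF.
by field; rewrite gt_eqF.
Qed.

Lemma snet_shift (a : nat) (i : 'I_a) (c b : R) w : 1 <= b -> `|c| <= 1 ->
  (6 * (a + 2) <= w)%N -> snet b w 0 (fun e : 'I_a -> R => e i - c).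
Proof.
move=> b1 c1 wa.
have := @net1_card 'I_a bool unit b w (fun k l => (-1) ^+ k * (l == i)%:R)
  (fun k => (-1) ^+ k * c) (fun _ k => (-1) ^+ k).
rewrite !card_ord card_unit card_bool => H.
have {}H := H _ _ _ ltac:(lia); apply: net_ext (H _ _ _).
- move=> o e; rewrite big_bool /= expr0 expr1.
  have E (s : R) : \sum_l s * (l == i)%:R * e l = s * e i.
    by rewrite -(sum_delta i) mulr_sumr; apply: eq_bigr => l _; rewrite mulrA.
  by rewrite !E !mul1r !mulN1r -opprD -[in RHS](reluD (e i - c)); ring.
- by move=> k l; rewrite normrM normr_sign mul1r normr_delta_le1.
- by move=> k; rewrite normrM normr_sign mul1r.
- by move=> _ k; rewrite normr_sign.
Qed.

Lemma snet1 (I : finType) (b : R) w : 1 <= b -> (4 * (#|I| + 2) <= w)%N ->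
  snet b w 0 (fun _ : I -> R => 1).
Proof.
move=> b1 wI.
have := @net1_card I unit unit b w (fun _ _ => 0) (fun _ => -1) (fun _ _ => 1).
rewrite card_unit => H; have {}H := H _ _ _ ltac:(lia); apply: net_ext (H _ _ _).
- move=> o e; rewrite (big_pred1 tt); last by case.
  by rewrite big1 ?add0r ?opprK ?mul1r ?relu_ge0 // => l _; rewrite mul0r.
- by move=> *; rewrite normr0.
- by move=> *; rewrite normrN normr1.
- by move=> *; rewrite normr1.
Qed.

Section Products.
Context (B : nat).
Context (B2 : (1 < B)%N).

(* The running sum and the current zigzag coordinate are the two components of
   the state, [true] and [false]. *)
Lemma snet_parabola b w m (kappa : R) : (2 * B)%:R <= b -> `|kappa| <= 1 ->
  (10 * (B + 4) <= w)%N ->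
  snet b w m.*2 (fun e : bool -> R => e true + kappa * parabola_net B m (e false)).
Proof.
move=> bB k1 wB.
have b1 : 1 <= b by apply: le_trans bB; rewrite ler1n muln_gt0 /= ltnW.
have BR : (0 : R) < B%:R by rewrite ltr0n ltnW.
elim: m kappa k1 => [|m IH] kappa k1.
  have := @net1_card bool bool unit b w (fun k l => (-1) ^+ k * (l == true)%:R)
    (fun k => 0) (fun _ k => (-1) ^+ k).
  rewrite !card_bool card_unit => H; have {}H := H _ _ _ ltac:(lia).
  apply: net_ext (H _ _ _).
  - move=> o e; rewrite !big_bool /= expr0 expr1.
    rewrite -[in RHS](reluD (e true)) !subr0 !mulr0 !mul0r !addr0 !mulr1 !mul1r !mulN1r.
    by rewrite addrC.
  - by move=> k l; rewrite normrM normr_sign mul1r normr_delta_le1.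
  - by move=> k; rewrite normr0.
  - by move=> _ k; rewrite normr_sign.
have k'1 : `|kappa * B%:R ^- 2| <= 1.
  rewrite normrM -[leRHS]mulr1 ler_pM // normfV invf_le1 ?normr_gt0 ?gt_eqF ?exprn_gt0 //.
  by rewrite normrX ger0_norm // exprn_ege1 // ler1n ltnW.
have kT y k : (forall i, `|y i.+1 - y i| <= 1 :> R) -> `|kink B y k| <= b.
  by move=> hy; apply: le_trans bB; have := kink_le B k hy; rewrite mulr1 natrM.
pose y1 j : R := parabola (j%:R / B%:R); pose y2 j : R := (odd j)%:R.
(* [kink_le] asks for bounded increments everywhere, but [parabola (j / B)] is unbounded for
   [j > B]. The kinks up to [B] do not see those values, which are therefore set to [0]. *)
pose y1' j := if (j <= B)%N then y1 j else 0.
have kk k : (k <= B)%N -> kink B y1 k = kink B y1' k.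
  by move=> kB; rewrite /kink /slope /y1'; case: k kB => [|k] kB; repeat case: ifP => //; lia.
have hy1 i : `|y1' i.+1 - y1' i| <= 1.
  have p j : 0 <= y1' j <= 1.
    rewrite /y1'; case: ifP => [jB|_]; last by rewrite lexx ler01.
    by apply: parabola01; rewrite divr_ge0 //= ler_pdivrMr // mul1r ler_nat.
  by have := p i; have := p i.+1; rewrite ler_norml; lra.
have hy2 i : `|y2 i.+1 - y2 i| <= 1.
  by rewrite /y2 oddS; case: (odd i); rewrite /= ?subr0 ?sub0r ?normrN normr1.
pose A (k : bool + 'I_B.+1) (l : bool) : R :=
  match k with inl s => (-1) ^+ s * (l == true)%:R | inr _ => (l == false)%:R end.
pose v (k : bool + 'I_B.+1) : R := match k with inl s => 0 | inr j => j%:R / B%:R end.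
pose Z (o : bool) (k : bool + 'I_B.+1) : R :=
  if o then match k with inl s => (-1) ^+ s | inr j => kappa * kink B y1 j end
  else match k with inl s => 0 | inr j => kink B y2 j end.
have := @net1_card bool _ bool b w A v Z.
rewrite !card_bool card_sum card_bool card_ord => H.
have {}H : net b w 0 (fun (o : bool) (e : bool -> R) => if o then
    e true + kappa * parabola_pl B (e false) else zigzag B (e false)).
  apply: net_ext (H _ _ _ _).
  - move=> o e; rewrite big_sumType /= !big_bool /= /A /Z /=.
    rewrite [0 * e true]mul0r [1 * e false]mul1r add0r.
    case: o; rewrite /= ?expr0 ?expr1.
      rewrite /parabola_pl /pl mul0r [parabola 0]/parabola expr0n subrr add0r.
      rewrite -[e true in RHS](reluD (e true)) !subr0 !mulr0 !mul0r !addr0 !mulr1 !mul1r !mulN1r.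
      rewrite [X in X + _]addrC; congr (_ + _).
      by rewrite mulr_sumr; apply: eq_bigr => j _; rewrite mulrA.
    by rewrite /zigzag /pl !mul0r !add0r.
  - by move=> [s|j] l; rewrite /A ?normrM ?normr_sign ?mul1r normr_delta_le1.
  - move=> [s|j]; rewrite /v ?normr0 // ger0_norm ?divr_ge0 // ler_pdivrMr // mul1r.
    by rewrite ler_nat -ltnS.
  - move=> [] [s|j]; rewrite /Z ?normr_sign ?normr0 //; try lra; last exact: kT.
    have jB : (j <= B)%N by rewrite -ltnS.
    by rewrite normrM -[leRHS]mul1r ler_pM // kk //; exact: kT.
  - by lia.
have := snet_comp b1 H (IH _ k'1); rewrite add0n; apply: snet_ext => e /=.
by ring.
Qed.

Lemma snet_mult_base b w m : (2 * B)%:R <= b -> (10 * (B + 4) <= w)%N ->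
  snet b (2 * w) (m.*2 + 3)
    (fun e : bool -> R => mult_net B m (e true) (e false)).
Proof.
move=> bB wB.
have b2 : 2 <= b by apply: le_trans bB; rewrite ler_nat leq_pmulr // ltnW.
have b1 : 1 <= b by lra.
have sq (s : bool) : snet b w m.*2.+2 (fun e : bool -> R =>
    square_net B m (`|e true + (-1) ^+ s * e false| / 2)).
  have := @net1_card bool bool bool b w
    (fun k l => if l then (-1) ^+ k / 2 else (-1) ^+ k * (-1) ^+ s / 2)
    (fun k => 0) (fun _ k => 1).
  rewrite !card_bool => H; have {}H := H _ _ _ ltac:(lia).
  have half (c : R) : `|c| = 1 -> `|c / 2| <= 1.
    by clear; move=> h; rewrite normrM h normfV ger0_norm //; lra.
  have abs_half (x y z : R) : y = - (x / 2) -> z = x / 2 ->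
      relu y + relu z = `|x| / 2.
    clear=> -> ->; have [x0|x0] := ger0P x; first by rewrite relu_le0 ?relu_ge0; lra.
    by rewrite relu_ge0 ?relu_le0; lra.
  have {}H : net b w 0 (fun (_ : bool) e => `|e true + (-1) ^+ s * e false| / 2).
    apply: net_ext (H _ _ _).
    - move=> o e; rewrite !big_bool /= expr0 expr1 !mul1r !subr0.
      by apply: abs_half; field.
    - by move=> k []; apply: half; rewrite ?normrM ?normr_sign // mulr1.
    - by move=> k; rewrite normr0.
    - by move=> *; rewrite normr1.
  have := snet_comp b1 H (@snet_parabola b w m (-1) bB ltac:(by rewrite normrN normr1) wB).
  rewrite add0n; apply: snet_ext => e; rewrite /square_net; ring.
have := @snet_lincomb _ _ bool b w m.*2.+2
  (fun s e => square_net B m (`|e true + (-1) ^+ s * e false| / 2))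
  (fun s => (-1) ^+ s) (le_trans ler01 b1) ltac:(lia).
rewrite card_bool -addn3 => H; apply: snet_ext (H _ _ _) => //.
- by move=> e; rewrite big_bool /= expr0 expr1 mul1r !mulN1r /mult_net mul1r addrC.
- by move=> k; rewrite normr_sign.
Qed.

Lemma snet_mult (I : finType) b w m h1 h2 (f g : (I -> R) -> R) :
  (2 * B)%:R <= b -> (10 * (B + 4) <= w)%N -> 
  snet b w h1 f -> snet b w h2 g ->
  snet b (2 * w) (maxn h1 h2 + (m.*2 + 5)) (fun e => mult_net B m (f e) (g e)).
Proof.
move=> bB wB nf ng.
have b2 : 2 <= b by apply: le_trans bB; rewrite ler_nat leq_pmulr // ltnW.
have b1 : 1 <= b by lra.
have w4 : (4 <= w)%N by lia.
have H : net b (2 * w) (maxn h1 h2) (fun (o : bool) e => if o then f e else g e).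
  rewrite -card_bool; apply: (net_par (f := fun (o : bool) e => if o then f e else g e)).
    exact: le_trans b1.
  by move=> []; [apply: snet_pad nf|apply: snet_pad ng]; rewrite ?leq_maxl ?leq_maxr.
have := snet_comp b1 H (snet_mult_base m bB wB).
by rewrite -addnS -addnS -[(m.*2 + 3).+2]addn2 -addnA.
Qed.

Definition prod_net (m : nat) (s : seq R) : R := foldr (mult_net B m) 1 s.

(** Each multiplication runs a factor and the remaining product side by side, which doubles the
    width, and adds [m.*2 + 5] to the depth. Shorter lists are padded to the depth for [q]
    factors. *)
Lemma snet_prod (I : finType) b w m h q (T : Type) (fac : T -> (I -> R) -> R) :
  (2 * B)%:R <= b -> (10 * (B + 4) <= w)%N -> (4 * (#|I| + 2) <= w)%N ->
  (forall t, snet b w h (fac t)) -> forall s : seq T, (size s <= q)%N ->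
  snet b (2 ^ q * w) (h + q * (m.*2 + 5)) (fun e => prod_net m [seq fac t e | t <- s]).
Proof.
move=> bB wB wI nfac.
have b2 : 2 <= b by apply: le_trans bB; rewrite ler_nat leq_pmulr // ltnW.
have b1 : 1 <= b by lra.
have b0 : 0 <= b by lra.
have w_le k : (w <= 2 ^ k * w)%N by rewrite leq_pmull // expn_gt0.
elim: q => [|q IH] [|t s] //= sq.
- rewrite mul0n addn0 expn0 mul1n /prod_net /=.
  by apply: snet_pad (snet1 b1 wI) => //; lia.
- apply: snet_pad (snet_mono b0 (lexx b) (w_le q.+1) (snet1 b1 wI)) => //.
  by apply: leq_trans (w_le _); lia.
have := @snet_mult I b (2 ^ q * w) m (h + q * (m.*2 + 5)) _ _ _ bB _
  (snet_pad b1 _ (leq_addr _ _) (snet_mono b0 (lexx b) (w_le q) (nfac t))) (IH s sq).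
rewrite maxnn mulnA -expnS -addnA -mulSnr; apply; first exact: leq_trans (w_le q).
by apply: leq_trans (w_le q); lia.
Qed.

End Products.
End BasicNets.

(** * Taylor approximation on a mesh *)

Section OneVariableTaylor.
Context {R : realType}.

Definition unit_deriv (u u' : R -> R) : Prop := forall s, 0 <= s <= 1 ->
  (fun h : R => (u (s + h) - u s) / h)
    @ within [set h | 0 <= s + h <= 1] (0 : R)^' --> u' s.

Lemma unit_deriv_is_derive (u u' : R -> R) (s : R) : unit_deriv u u' -> 0 < s < 1 ->
  is_derive s 1 u (u' s).
Proof.
move=> du /andP[s0 s1].
have h : (fun h : R => h^-1 *: (u (h *: (1 : R) + s) - u s)) @ (0 : R)^' --> u' s.
  apply/cvgrPdist_le => e e0.
  have s01 : 0 <= s <= 1 by rewrite !ltW.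
  have /cvgrPdist_le/(_ e e0) := du s s01.
  rewrite /prop_near1 /within /= => dq.
  change (\forall h \near (0 : R)^', 0 <= s + h <= 1 -> `|u' s - (u (s + h) - u s) / h| <= e) in dq.
  have near01 : \forall h \near (0 : R)^', 0 <= s + h <= 1.
    apply/nbhs_ballP; exists (Num.min s (1 - s)); first by rewrite /= lt_min s0 subr_gt0.
    move=> h /=; rewrite /ball /= sub0r normrN lt_min => /andP[hs hs1] _.
    by move: hs hs1; rewrite !ltr_norml; lra.
  apply: filterS2 near01 dq => h hs E.
  rewrite /= [_ *: (1 : R)]mulr1 [h + s]addrC.
  have -> : h^-1 *: (u (s + h) - u s) = (u (s + h) - u s) / h by rewrite mulrC.
  exact: E.
apply: DeriveDef; first by apply/cvg_ex; exists (u' s).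
exact: (cvg_lim _ h).
Qed.

Lemma unit_deriv_continuous (u u' : R -> R) (a b : R) : unit_deriv u u' ->
  0 <= a -> b <= 1 -> {within `[a, b], continuous u}.
Proof.
move=> du a0 b1; apply/subspace_continuousP => x; rewrite /= in_itv /= => /andP[ax xb].
have x01 : 0 <= x <= 1 by apply/andP; split; lra.
apply/cvgrPdist_le => e e0.
have /cvgrPdist_le/(_ 1 ltr01) := du x x01.
rewrite /prop_near1 /within /= => /nbhs_ballP[d /= d0 hd].
apply/nbhs_ballP; pose M := `|u' x| + 1.
have M0 : 0 < M by rewrite ltr_wpDl.
exists (Num.min d (e / M)) => [|y /=]; first by rewrite /= lt_min d0 divr_gt0.
rewrite /ball /= lt_min => /andP[yd ye]; rewrite in_itv /= => /andP[ay yb].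
have [->|xy] := eqVneq y x; first by rewrite subrr normr0 ltW.
have hy0 : y - x != 0 by rewrite subr_eq0.
have := hd (y - x); rewrite /ball /= sub0r normrN distrC => /(_ yd hy0).
rewrite addrC subrK => /(_ ltac:(apply/andP; split; lra)) q.
have : `|(u y - u x) / (y - x)| <= M.
  have -> : (u y - u x) / (y - x) = u' x - (u' x - (u y - u x) / (y - x)) by ring.
  by apply: le_trans (ler_normB _ _) _; rewrite lerD2l.
rewrite normrM normfV ler_pdivrMr ?normr_gt0 // => h.
rewrite distrC; apply: le_trans h _; rewrite mulrC -ler_pdivlMr // distrC.
exact: ltW.
Qed.

Lemma unit_deriv_mvt (u u' : R -> R) (p : {poly R}) (a b : R) : unit_deriv u u' ->
  0 <= a -> a <= b -> b <= 1 ->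
  exists2 c, a <= c <= b &
    (u b - p.[b]) - (u a - p.[a]) = (u' c - p^`().[c]) * (b - a).
Proof.
move=> du a0 ab b1.
have [||c] := @MVT_segment R (fun x => u x - p.[x]) (fun x => u' x - p^`().[x]) a b ab.
- move=> x; rewrite in_itv /= => /andP[ax xb].
  apply: is_deriveB; first by apply: unit_deriv_is_derive du _; apply/andP; split; lra.
- have cu := unit_deriv_continuous du a0 b1.
  move=> x; apply: cvgB; first exact: cu.
  by apply: continuous_subspaceT => y; exact: continuous_horner.
- by rewrite in_itv /= => cab E; exists c.
Qed.

Definition taylor_poly (n : nat) (g : nat -> R -> R) (s0 : R) : {poly R} :=
  \sum_(j < n.+1) (g j s0 / (j`!)%:R) *: ('X - s0%:P) ^+ j.

Lemma deriv_taylor_poly n g s0 :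
  (taylor_poly n.+1 g s0)^`() = taylor_poly n (fun j => g j.+1) s0.
Proof.
rewrite /taylor_poly big_ord_recl derivD.
rewrite expr0 derivZ derivC scaler0 add0r raddf_sum /=.
apply: eq_bigr => j _; rewrite derivZ deriv_exp derivXsubC mul1r /=.
rewrite -[X in _ *: X = _]scaler_nat scalerA; congr (_ *: _).
rewrite [in LHS]/bump /= factS natrM; field.
by rewrite ?nat1r ?natr1 !pnatr_eq0 /= -lt0n fact_gt0.
Qed.

Lemma taylor_poly_center n g s0 : (taylor_poly n g s0).[s0] = g 0%N s0.
Proof.
rewrite /taylor_poly horner_sum big_ord_recl big1 ?addr0 => [|j _].
  by rewrite expr0 hornerZ hornerC mulr1 fact0 divr1.
by rewrite hornerZ horner_exp !hornerE subrr expr0n /= mulr0.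
Qed.

(** Induction on the order: the remainder vanishes at [s0] and its derivative is the remainder of
    [g 1], so the mean value theorem turns the bound for the derivative into the bound with one more
    power of the distance. *)
Lemma taylor_holder n (g : nat -> R -> R) (K e : R) : 0 <= K -> 0 < e ->
  (forall j, (j < n)%N -> unit_deriv (g j) (g j.+1)) ->
  (forall s t, 0 <= s <= 1 -> 0 <= t <= 1 ->
     `|g n s - g n t| <= K * `|s - t| `^ e) ->
  forall s0 s, 0 <= s0 <= 1 -> 0 <= s <= 1 ->
    `|g 0%N s - (taylor_poly n g s0).[s]| <= K * `|s - s0| `^ (n%:R + e).
Proof.
move=> K0 e0; elim: n g => [|n IH] g dg hg s0 s s01 s1.
  rewrite /taylor_poly big_ord1 expr0 hornerZ hornerC mulr1 fact0 divr1 add0r.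
  exact: hg.
have dg' j : (j < n)%N -> unit_deriv (g j.+1) (g j.+2) by move=> jn; exact: dg.
have hc c : 0 <= c <= 1 -> _ := IH (fun j => g j.+1) dg' hg s0 c s01.
have key a b : 0 <= a -> a <= b -> b <= 1 -> a = s0 \/ b = s0 ->
    `|(g 0%N b - (taylor_poly n.+1 g s0).[b]) - (g 0%N a - (taylor_poly n.+1 g s0).[a])|
      <= K * `|b - a| `^ (n.+1%:R + e).
  move=> a0 ab b1 abs.
  have [c cab ->] := unit_deriv_mvt (taylor_poly n.+1 g s0) (dg 0%N (ltn0Sn n)) a0 ab b1.
  rewrite deriv_taylor_poly normrM.
  have c01 : 0 <= c <= 1 by move/andP: cab => [? ?]; apply/andP; split; lra.
  apply: le_trans (ler_wpM2r (normr_ge0 _) (hc c c01)) _.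
  rewrite -mulrA ler_wpM2l //.
  have -> : n.+1%:R + e = n%:R + e + 1 by rewrite -natr1 addrAC.
  have ne : 0 < n%:R + e by rewrite ltr_wpDl.
  have -> : `|b - a| `^ (n%:R + e + 1) = `|b - a| `^ (n%:R + e) * `|b - a|.
    by rewrite powRD ?powRr1 // gt_eqF // addr_gt0.
  rewrite ler_wpM2r // ge0_ler_powR ?nnegrE ?(ltW ne) //.
  move/andP: cab => [ac cb]; rewrite [`|b - a|]ger0_norm ?subr_ge0 // ler_norml.
  by case: abs => <-; lra.
move/andP: s01 => [s00 s01]; move/andP: s1 => [s0' s1'].
have [ss|ss] := leP s0 s.
  have := key s0 s s00 ss s1' (or_introl erefl).
  by rewrite taylor_poly_center subrr subr0.
have := key s s0 s0' (ltW ss) s01 (or_intror erefl).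
by rewrite taylor_poly_center subrr sub0r normrN [`|s0 - s|]distrC.
Qed.

End OneVariableTaylor.

(** * Pointwise consequences of membership in a Hoelder ball *)

Section HolderBall.
Context {R : realType}.

Lemma sfloor_bounds (b : R) : 0 < b -> (sfloor b)%:R < b <= (sfloor b).+1%:R.
Proof.
move=> b0; apply/andP; split.
  rewrite /sfloor; elim/big_ind: _ => // m n mb nb.
  by rewrite /maxn; case: ifP.
rewrite leNgt; apply/negP => kb.
have kt : ((sfloor b).+1 < (Num.truncn b).+1)%N.
  by rewrite ltnS truncn_ge_nat ?ltW // ltW.
have := @leq_bigmax_cond _ (fun k : 'I_(Num.truncn b).+1 => ((k : nat)%:R < b)%R)
  (fun k => k) (Ordinal kt) kb.
by rewrite /= -/(sfloor b) ltnn.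
Qed.

Lemma convex_le (z p q M : R) : 0 <= z <= 1 -> `|p| <= M -> `|q| <= M ->
  `|(1 - z) * p + z * q| <= M.
Proof.
move=> /andP[z0 z1] pM qM; rewrite -subr_ge0 in z1.
apply: le_trans (ler_normD _ _) _; rewrite !normrM (ger0_norm z0) (ger0_norm z1).
have -> : M = (1 - z) * M + z * M by ring.
by apply: lerD; apply: ler_wpM2l.
Qed.

Lemma supnorm_ge (T : Type) (V : normedZmodType R) (P : set T) (f : T -> V) x :
  P x -> (`|f x|%:E <= supnorm P f)%E.
Proof. by move=> Px; apply: ereal_sup_ubound; exists x. Qed.

Context (a : nat).
Local Notation vec := 'cV[R]_a.
Local Notation cube := (@unit_cube R a).

Definition mshift (al : {ffun 'I_a -> nat}) (i : 'I_a) (n : nat) :=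
  iter n (fun be => mincr be i) al.

Lemma mdeg_mincr (al : {ffun 'I_a -> nat}) i : mdeg (mincr al i) = (mdeg al).+1.
Proof.
rewrite /mdeg; under eq_bigr do rewrite ffunE.
rewrite big_split /= [X in (_ + X)%N](bigD1 i) //= eqxx.
rewrite [X in (_ + (_ + X))%N]big1 ?addn0 ?addn1 //.
by move=> j /negPf ->.
Qed.

Lemma mdeg_mshift (al : {ffun 'I_a -> nat}) i n : mdeg (mshift al i n) = (mdeg al + n)%N.
Proof. by elim: n => [|n IH]; rewrite ?addn0 //= mdeg_mincr IH addnS. Qed.

Definition holder_data (b K : R) (D : {ffun 'I_a -> nat} -> vec -> R) : Prop :=
  [/\ forall al i x, (mdeg al < sfloor b)%N -> cube x ->
        is_partial cube i (D al) x (D (mincr al i) x),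
      forall al x, (mdeg al <= sfloor b)%N -> cube x -> `|D al x| <= K &
      forall al x y, mdeg al = sfloor b -> cube x -> cube y ->
        `|D al x - D al y| <= K * `|x - y| `^ (b - (sfloor b)%:R)].

Lemma holder_ball_data (b K : R) (f : vec -> R) : (0 < a)%N -> 0 < b ->
  holder_ball cube b K f ->
  exists2 D, (forall x, cube x -> D [ffun=> 0%N] x = f x) & holder_data b K D.
Proof.
move=> a0 b0 [D [D0 Dp] Dle]; exists D => //.
have /andP[kb bk] := sfloor_bounds b0.
set k := sfloor b in kb bk Dp Dle *.
(* Two distinct points of the cube make all suprema nonnegative, since none is the supremum of the
   empty set. So each summand is bounded by the whole sum. *)
pose x0 : vec := 0; pose x1 : vec := const_mx 1.
have c0 : cube x0 by move=> i; rewrite mxE lexx ler01.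
have c1 : cube x1 by move=> i; rewrite mxE lexx ler01.
have x01 : x0 <> x1.
  move=> /(congr1 (fun z : vec => z (Ordinal a0) 0)); rewrite !mxE => /eqP.
  by rewrite eq_sym oner_eq0.
have sup_ge0 al : (0 <= supnorm cube (D al))%E.
  by apply: le_trans (supnorm_ge (D al) c0); rewrite lee_fin.
have hs_ge0 al : (0 <= holder_seminorm cube (b - k%:R) (D al))%E.
  apply: le_trans (_ : ((`|D al x0 - D al x1| / `|x0 - x1| `^ (b - k%:R))%:E <= _)%E).
    by rewrite lee_fin divr_ge0 // powR_ge0.
  by apply: ereal_sup_ubound; exists x0, x1.
have ofidx al : (mdeg al <= k)%N ->
    exists be : {ffun 'I_a -> 'I_k.+1}, mindex be = al.
  move=> alk; exists [ffun i => inord (al i)]; apply/ffunP => i.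
  rewrite !ffunE inordK // ltnS; apply: leq_trans alk.
  by rewrite /mdeg (bigD1 i) //= leq_addr.
split=> //.
- move=> al x alk Px; have [be beE] := ofidx al alk.
  rewrite -lee_fin; apply: le_trans (supnorm_ge (D al) Px) _.
  apply: le_trans Dle; rewrite (bigD1 be) /=; last first.
    by rewrite beE; apply: le_lt_trans kb; rewrite ler_nat.
  rewrite beE -addeA leeDl // adde_ge0 // sume_ge0 // => *.
- move=> al x y alk Px Py; have [be beE] := ofidx al (eq_leq alk).
  have [->|/eqP xy] := eqVneq x y.
    rewrite !subrr !normr0 mulr_ge0 ?powR_ge0 //.
    rewrite -lee_fin; apply: le_trans Dle.
    by rewrite adde_ge0 // sume_ge0.
  have n0 : 0 < `|x - y| `^ (b - k%:R).
    by rewrite powR_gt0 // normr_gt0 subr_eq0; apply/eqP.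
  rewrite -ler_pdivrMr // -lee_fin; apply: le_trans Dle.
  apply: le_trans (_ : (holder_seminorm cube (b - k%:R) (D al) <= _)%E).
    by apply: ereal_sup_ubound; exists x, y.
  rewrite [X in (_ <= _ + X)%E](bigD1 be) /=; last by rewrite beE alk.
  by rewrite beE addeCA leeDl // adde_ge0 // sume_ge0.
Qed.

Definition upd (x : vec) (i : 'I_a) (s : R) : vec :=
  \col_j (if j == i then s else x j 0).

Lemma upd_cube x i s : cube x -> 0 <= s <= 1 -> cube (upd x i s).
Proof. by move=> cx s01 j; rewrite mxE; case: ifP. Qed.

Lemma upd_dist (x : vec) i s t : `|upd x i s - upd x i t| <= `|s - t|.
Proof.
apply/mx_norm_le => // j l; rewrite !mxE.
by case: ifP => _ //; rewrite subrr normr0.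
Qed.

Lemma unit_deriv_slice (g g' : vec -> R) i (x : vec) : cube x ->
  (forall z, cube z -> is_partial cube i g z (g' z)) ->
  unit_deriv (fun s => g (upd x i s)) (fun s => g' (upd x i s)).
Proof.
move=> cx gp s s01.
have := gp _ (upd_cube i cx s01); rewrite /is_partial.
have E h : upd x i s + h *: delta_mx i 0 = upd x i (s + h).
  apply/colP => j; rewrite !mxE eqxx andbT.
  by case: eqP => _; rewrite ?mulr1 // mulr0 addr0.
have -> : [set h | cube (upd x i s + h *: delta_mx i 0)] = [set h | 0 <= s + h <= 1].
  apply/seteqP; split => h /=; rewrite E; last exact: upd_cube.
  by move=> /(_ i); rewrite mxE eqxx.
rewrite (_ : (fun h => _) = (fun h : R => (g (upd x i (s + h)) - g (upd x i s)) / h)) //.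
by apply/funext => h; rewrite E.
Qed.

(** * Local Taylor polynomials glued by hats *)

Section LocalPolynomials.
Context (b K : R) (D : {ffun 'I_a -> nat} -> vec -> R).
Context (b1 : 1 <= b) (K0 : 0 <= K) (hD : holder_data b K D).

Local Notation k := (sfloor b).

Lemma slice_taylor al i x s t : (mdeg al <= k)%N -> cube x ->
  0 <= s <= 1 -> 0 <= t <= 1 ->
  `|\sum_(n < (k - mdeg al).+1)
      (s - t) ^+ n / (n`!)%:R * D (mshift al i n) (upd x i t) - D al (upd x i s)|
    <= K * `|s - t| `^ (b - (mdeg al)%:R).
Proof.
move=> alk cx s01 t01; have [Dp Db Dh] := hD.
have /andP[kb _] := sfloor_bounds (lt_le_trans ltr01 b1).
pose g n (u : R) := D (mshift al i n) (upd x i u).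
have e0 : 0 < b - k%:R by rewrite subr_gt0.
have := @taylor_holder R (k - mdeg al) g K (b - k%:R) K0 e0.
have -> : (k - mdeg al)%:R + (b - k%:R) = b - (mdeg al)%:R.
  by rewrite natrB //; ring.
move=> T; rewrite distrC; apply: le_trans (T _ _ t s t01 s01) => //.
- rewrite le_eqVlt; apply/orP; left; apply/eqP; congr `|_ - _|.
  rewrite /taylor_poly horner_sum; apply: eq_bigr => n _.
  by rewrite hornerZ horner_exp hornerXsubC /g; ring.
- move=> j jk; apply: unit_deriv_slice => // z cz; apply: Dp => //.
  by rewrite mdeg_mshift; lia.
- move=> u v u01 v01.
  apply: le_trans (Dh _ _ _ _ (upd_cube i cx u01) (upd_cube i cx v01)) _.
    by rewrite mdeg_mshift subnKC.
  rewrite ler_wpM2l // ge0_ler_powR ?nnegrE ?(ltW e0) //.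
  exact: upd_dist.
Qed.

Context (J : nat).
Context (J0 : (0 < J)%N).

Local Notation h := (J%:R^-1 : R).

(* The expansion proceeds one coordinate at a time, so that Taylor's formula is
   needed in one variable only: [y] collects the mesh nodes of the coordinates
   already expanded, and the coordinates in [l] are still read off [x]. *)
Fixpoint local_taylor (l : seq 'I_a) (al : {ffun 'I_a -> nat}) (y x : vec) : R :=
  if l is i :: l' then
    \sum_(j < J.+1) hat J j (x i 0) *
      \sum_(n < (k - mdeg al).+1) (x i 0 - j%:R / J%:R) ^+ n / (n`!)%:R *
        local_taylor l' (mshift al i n) (upd y i (j%:R / J%:R)) x
  else D al y.

(** The point at which [local_taylor l al y x] approximates [D al]. *)
Definition mix (l : seq 'I_a) (x y : vec) : vec :=
  \col_i (if i \in l then x i 0 else y i 0).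

Lemma mix_cube l x y : cube x -> cube y -> cube (mix l x y).
Proof. by move=> cx cy i; rewrite mxE; case: ifP. Qed.

Lemma mix_upd l x y i s : i \notin l -> mix l x (upd y i s) = upd (mix l x y) i s.
Proof.
move=> il; apply/colP => j; rewrite !mxE; case: eqP => [->|//].
by rewrite (negPf il).
Qed.

Lemma mix_cons i l x y : upd (mix l x y) i (x i 0) = mix (i :: l) x y.
Proof. by apply/colP => j; rewrite !mxE inE; case: eqP => [->|//]. Qed.

Let JR : (0 : R) < J%:R. Proof. by rewrite ltr0n. Qed.

Lemma node01 j : (j <= J)%N -> 0 <= (j%:R / J%:R : R) <= 1.
Proof. by move=> jJ; rewrite divr_ge0 //= ler_pdivrMr // mul1r ler_nat. Qed.

Let h01 : 0 <= h <= 1.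
Proof. by rewrite invr_ge0 ler0n /= invf_le1 // ler1n. Qed.

(** The coefficient of one hat in [local_taylor], with the expanded coordinate [s] decoupled from
    [x], so that it can be varied separately from the remaining coordinates. *)
Definition node_poly (l : seq 'I_a) al i y j (s : R) (x : vec) : R :=
  \sum_(n < (k - mdeg al).+1) (s - j%:R / J%:R) ^+ n / (n`!)%:R *
    local_taylor l (mshift al i n) (upd y i (j%:R / J%:R)) x.

(** One more coordinate multiplies the constant by [k.+1], for the errors of the inner expansions,
    and adds [K], for its own Taylor remainder; together at most a factor [k.+2]. *)
Definition err_const (n : nat) : R := (k.+2)%:R ^+ n * K.

Let err_ge0 n : 0 <= err_const n.
Proof. by rewrite mulr_ge0 // exprn_ge0. Qed.

Let fact_le (u : R) n : 0 <= u -> u / (n`!)%:R <= u.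
Proof.
move=> u0; rewrite ler_pdivrMr ?ltr0n ?fact_gt0 //.
by rewrite ler_peMr // ler1n fact_gt0.
Qed.

Let hpow (al : {ffun 'I_a -> nat}) n : (n < (k - mdeg al).+1)%N ->
  h ^+ n * h `^ (b - (mdeg al + n)%:R) = h `^ (b - (mdeg al)%:R).
Proof.
move=> nk; rewrite -powR_mulrn ?invr_ge0 // -powRD; last first.
  by rewrite (gt_eqF (_ : 0 < h)) ?implybT // invr_gt0.
by congr (_ `^ _); rewrite natrD; ring.
Qed.

Let sum_n_le (al : {ffun 'I_a -> nat}) (F : 'I_(k - mdeg al).+1 -> R)
    (c : R) : 0 <= c -> (forall n, F n <= c) ->
  \sum_(n < (k - mdeg al).+1) F n <= k.+1%:R * c.
Proof.
move=> c0 Fc; apply: le_trans (_ : \sum_(n < (k - mdeg al).+1) c <= _).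
  by apply: ler_sum => n _; exact: Fc.
rewrite sumr_const card_ord -[leLHS]mulr_natl ler_wpM2r // ler_nat ltnS.
exact: leq_subr.
Qed.

(** Besides the Taylor remainder in coordinate [i], the inner expansions err. Each derivative in
    direction [i] loses a power of [h] in the inner error, and the power of the displacement in
    front of it gives it back. *)
Lemma node_poly_err l al i y j s x : i \notin l -> (mdeg al <= k)%N ->
  cube x -> cube y -> (j <= J)%N -> 0 <= s <= 1 -> `|s - j%:R / J%:R| <= h ->
  (forall be z, (mdeg be <= k)%N -> cube z ->
     `|local_taylor l be z x - D be (mix l x z)|
       <= err_const (size l) * h `^ (b - (mdeg be)%:R)) ->
  `|node_poly l al i y j s x - D al (upd (mix l x y) i s)|
    <= err_const (size l).+1 * h `^ (b - (mdeg al)%:R).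
Proof.
move=> il alk cx cy jJ s01 sj IH.
have /andP[kb _] := sfloor_bounds (lt_le_trans ltr01 b1).
have := slice_taylor i alk (mix_cube l cx cy) s01 (node01 jJ).
set T := \sum_(n < _) _; move=> hT.
have -> : node_poly l al i y j s x - D al (upd (mix l x y) i s)
    = (node_poly l al i y j s x - T) + (T - D al (upd (mix l x y) i s)).
  by rewrite addrA subrK.
apply: le_trans (ler_normD _ _) _.
have hp : `|s - j%:R / J%:R| `^ (b - (mdeg al)%:R) <= h `^ (b - (mdeg al)%:R).
  apply: ge0_ler_powR; rewrite ?nnegrE ?invr_ge0 //.
  rewrite subr_ge0; apply: le_trans (ltW kb).
  by rewrite ler_nat.
have h1 : `|T - D al (upd (mix l x y) i s)| <= K * h `^ (b - (mdeg al)%:R).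
  by apply: le_trans hT _; rewrite ler_wpM2l.
have h2 : `|node_poly l al i y j s x - T|
    <= k.+1%:R * (err_const (size l) * h `^ (b - (mdeg al)%:R)).
  rewrite /node_poly /T -sumrB; apply: le_trans (ler_norm_sum _ _ _) _.
  apply: sum_n_le => [|n]; first by rewrite mulr_ge0 ?powR_ge0.
  have nk := ltn_ord n.
  rewrite -mulrBr normrM.
  have nk' : (mdeg (mshift al i n) <= k)%N by rewrite mdeg_mshift -leq_subRL.
  have := IH _ _ nk' (upd_cube i cy (node01 jJ)).
  rewrite mix_upd // mdeg_mshift => hI.
  rewrite normrM normrX normfV [`|(n`!)%:R|]ger0_norm //.
  rewrite -(hpow nk) [leRHS]mulrCA.
  apply: ler_pM => //.
  apply: le_trans (fact_le _ _) _; first by rewrite exprn_ge0.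
  by rewrite lerXn2r ?nnegrE ?invr_ge0.
apply: le_trans (lerD h2 h1) _.
rewrite mulrA -mulrDl ler_wpM2r ?powR_ge0 //.
have Ke : K <= err_const (size l).
  rewrite /err_const ler_peMl // exprn_ege1 // ler1n //.
rewrite {2}/err_const exprS -mulrA -/(err_const _) -[k.+2%:R]natr1 mulrDl mul1r.
by rewrite lerD2l.
Qed.

Lemma cell_node c s : (c < J)%N -> c%:R / J%:R <= s <= c.+1%:R / J%:R ->
  `|s - c%:R / J%:R| <= h /\ `|s - c.+1%:R / J%:R| <= h.
Proof.
move=> cJ; have -> : c.+1%:R / J%:R = c%:R / J%:R + h :> R.
  by rewrite -[c.+1%:R]natr1 mulrDl div1r.
by move=> /andP[h1 h2]; rewrite !ler_norml; split; apply/andP; split; lra.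
Qed.

(** Both node polynomials active in a cell approximate the same value, hence so does their convex
    combination. *)
Lemma local_taylor_err l al y x : uniq l -> (mdeg al <= k)%N ->
  cube x -> cube y ->
  `|local_taylor l al y x - D al (mix l x y)|
    <= err_const (size l) * h `^ (b - (mdeg al)%:R).
Proof.
move=> ul alk cx cy; elim: l ul al y alk cy => [|i l IH] ul al y alk cy.
  rewrite /=; have -> : mix [::] x y = y by apply/colP => i; rewrite mxE.
  by rewrite subrr normr0 mulr_ge0 ?powR_ge0.
move: ul; rewrite cons_uniq => /andP[il ul].
have xi := cx i; have [c cJ hc] := unit_cell J0 xi.
have z01 := cell_coord J0 hc.
have E : local_taylor (i :: l) al y x = (1 - (J%:R * x i 0 - c%:R)) * node_poly l al i y c (x i 0) x
    + (J%:R * x i 0 - c%:R) * node_poly l al i y c.+1 (x i 0) x.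
  exact: (hat_sum (fun j => node_poly l al i y j (x i 0) x) cJ hc).
rewrite E -mix_cons.
have [n1 n2] := cell_node cJ hc.
have IH' be z : (mdeg be <= k)%N -> cube z -> _ := IH ul be z.
have e1 := node_poly_err il alk cx cy (ltnW cJ) xi n1 IH'.
have e2 := node_poly_err il alk cx cy cJ xi n2 IH'.
move: e1 e2; set p1 := node_poly _ _ _ _ _ _ _; set p2 := node_poly _ _ _ _ _ _ _.
set d := D al _; set z := _ - c%:R in z01 *; set err := _ * _ => e1 e2.
have -> : (1 - z) * p1 + z * p2 - d = (1 - z) * (p1 - d) + z * (p2 - d) by ring.
exact: convex_le.
Qed.

(** The three summands come from a change of the remaining coordinates, from the node polynomials in
    their own coordinate, and from the hats, whose slope multiplies the difference of neighbouring
    node polynomials. *)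
Fixpoint lip_const (n : nat) : R :=
  if n is m.+1 then k.+1%:R * lip_const m + k.+1%:R * (K + err_const m)
                    + 2 * err_const m.+1
  else 0.

Let lip_ge0 n : 0 <= lip_const n.
Proof.
elim: n => //= n IH; rewrite !addr_ge0 // mulr_ge0 // addr_ge0 //.
Qed.

Lemma expr_fact_lip (u v : R) n : `|u| <= 1 -> `|v| <= 1 ->
  `|u ^+ n / (n`!)%:R - v ^+ n / (n`!)%:R| <= `|u - v|.
Proof.
move=> u1 v1.
have e m : `|u ^+ m - v ^+ m| <= m%:R * `|u - v|.
  elim: m => [|m IH]; first by rewrite !expr0 subrr normr0 mul0r.
  have -> : u ^+ m.+1 - v ^+ m.+1 = u * (u ^+ m - v ^+ m) + (u - v) * v ^+ m.
    by rewrite !exprS; ring.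
  apply: le_trans (ler_normD _ _) _; rewrite !normrM -[m.+1%:R]natr1 mulrDl mul1r.
  apply: lerD.
    by apply: le_trans IH; rewrite -[leRHS]mul1r ler_wpM2r.
  by rewrite -[leRHS]mulr1 ler_wpM2l // normrX exprn_ile1.
rewrite -mulrBl normrM [`|_^-1|]ger0_norm ?invr_ge0 //.
have f0 : (0 : R) < (n`!)%:R by rewrite ltr0n fact_gt0.
rewrite ler_pdivrMr // mulrC; apply: le_trans (e n) _.
rewrite ler_wpM2r // ler_nat; case: n {e f0} => // n.
by rewrite factS leq_pmulr // fact_gt0.
Qed.

(** The growth of the Lipschitz constant with the order of the derivative: a factor [h ^ n] from the
    displacements reduces the scale of the [n]-fold shifted multi-index to that of [al]. At order
    zero it is at most [2], as [b >= 1]. *)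
Definition mesh_scale (al : {ffun 'I_a -> nat}) : R := 1 + J%:R * h `^ (b - (mdeg al)%:R).

Let mesh_scale_ge1 al : 1 <= mesh_scale al.
Proof. by rewrite /mesh_scale lerDl mulr_ge0 // powR_ge0. Qed.

(** The step from [x] to [x'] changes first the coordinates after [i], then coordinate [i]. In the
    latter a hat has slope [J], but neighbouring node polynomials differ only by the approximation
    error, so the product is of order [J * h ^ (b - |al|)]. *)
Lemma local_taylor_lip l al y x x' : uniq l -> (mdeg al <= k)%N ->
  cube x -> cube x' -> cube y ->
  `|local_taylor l al y x - local_taylor l al y x'|
    <= lip_const (size l) * mesh_scale al * `|x - x'|.
Proof.
move=> ul alk cx cx' cy; elim: l ul al y alk cy => [|i l IH] ul al y alk cy.
  by rewrite /= subrr normr0 !mul0r.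
move: ul; rewrite cons_uniq => /andP[il ul].
have /andP[kb _] := sfloor_bounds (lt_le_trans ltr01 b1).
pose F s z := \sum_(j < J.+1) hat J j s * node_poly l al i y j s z.
have FE z : local_taylor (i :: l) al y z = F (z i 0) z by [].
have F_cell c s z : (c < J)%N -> c%:R / J%:R <= s <= c.+1%:R / J%:R ->
    F s z = (1 - (J%:R * s - c%:R)) * node_poly l al i y c s z
      + (J%:R * s - c%:R) * node_poly l al i y c.+1 s z.
  by move=> cJ hc; exact: (hat_sum (fun j => node_poly l al i y j s z) cJ hc).
have bound_le be z : (mdeg be <= k)%N -> cube z ->
    `|local_taylor l be z x'| <= K + err_const (size l).
  move=> bek cz; have := local_taylor_err ul bek cx' cz.
  have [_ /(_ be _ bek (mix_cube l cx' cz)) hK _] := hD.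
  have hp1 : h `^ (b - (mdeg be)%:R) <= 1.
    apply: (@le_trans _ _ (1 `^ (b - (mdeg be)%:R))); last by rewrite powR1.
    have /andP[h0 h1] := h01.
    apply: ge0_ler_powR; rewrite ?nnegrE //.
    by rewrite subr_ge0; apply: le_trans (ltW kb); rewrite ler_nat.
  have := ler_wpM2l (err_ge0 (size l)) hp1; rewrite mulr1 => h1 h2.
  rewrite -[local_taylor _ _ _ _](subrK (D be (mix l x' z))).
  apply: le_trans (ler_normD _ _) _; rewrite addrC lerD //.
  exact: le_trans h2 h1.
have in_other c s : (c < J)%N -> c%:R / J%:R <= s <= c.+1%:R / J%:R ->
    `|F s x - F s x'| <= k.+1%:R * lip_const (size l) * mesh_scale al * `|x - x'|.
  move=> cJ hc; rewrite !(F_cell c s) //.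
  have z01 := cell_coord J0 hc; set z := _ - c%:R in z01 *.
  have [n1 n2] := cell_node cJ hc.
  have np j : (j <= J)%N -> `|s - j%:R / J%:R| <= h ->
      `|node_poly l al i y j s x - node_poly l al i y j s x'|
        <= k.+1%:R * lip_const (size l) * mesh_scale al * `|x - x'|.
    move=> jJ sj; rewrite /node_poly -sumrB; apply: le_trans (ler_norm_sum _ _ _) _.
    rewrite -!mulrA; apply: (@sum_n_le al).
      by rewrite !mulr_ge0 // (le_trans ler01).
    move=> n; have nk : (n < (k - mdeg al).+1)%N := ltn_ord n.
    have nk' : (mdeg (mshift al i n) <= k)%N by rewrite mdeg_mshift -leq_subRL.
    have := IH ul _ _ nk' (upd_cube i cy (node01 jJ)) => hI.
    rewrite -mulrBr normrM.
    have hn : `|(s - j%:R / J%:R) ^+ n / (n`!)%:R| <= h ^+ n.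
      rewrite normrM normrX normfV [`|(n`!)%:R|]ger0_norm //.
      apply: le_trans (fact_le _ _) _; first by rewrite exprn_ge0.
      by rewrite lerXn2r ?nnegrE ?invr_ge0.
    apply: le_trans (ler_pM _ _ hn hI) _ => //.
    have -> : h ^+ n * (lip_const (size l) * mesh_scale (mshift al i n) * `|x - x'|)
        = lip_const (size l) * (h ^+ n * mesh_scale (mshift al i n) * `|x - x'|) by ring.
    rewrite ler_wpM2l // ler_wpM2r // /mesh_scale mdeg_mshift mulrDr mulr1 mulrCA (hpow nk).
    by rewrite lerD2r exprn_ile1 //; case/andP: h01.
  have := np _ (ltnW cJ) n1; have := np _ cJ n2.
  set p1 := node_poly _ _ _ _ _ _ x; set p1' := node_poly _ _ _ _ _ _ x'.
  set p2 := node_poly _ _ _ _ _ _ x; set p2' := node_poly _ _ _ _ _ _ x'.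
  set M := _ * `|x - x'| => q1 q2.
  have -> : (1 - z) * p2 + z * p1 - ((1 - z) * p2' + z * p1')
    = (1 - z) * (p2 - p2') + z * (p1 - p1') by ring.
  exact: convex_le.
pose M2 := (k.+1%:R * (K + err_const (size l)) + 2 * err_const (size l).+1) * mesh_scale al.
have in_coord s t : 0 <= s <= 1 -> 0 <= t <= 1 -> `|F s x' - F t x'| <= M2 * `|s - t|.
  move: s t; apply: (@lip_cells R (fun s => F s x') J M2 J0) => c s t cJ hs ht /=.
  rewrite (F_cell c s) // (F_cell c t) //.
  have np j : (j <= J)%N -> 
      `|node_poly l al i y j s x' - node_poly l al i y j t x'|
        <= k.+1%:R * (K + err_const (size l)) * `|s - t|.
    move=> jJ; rewrite /node_poly -sumrB; apply: le_trans (ler_norm_sum _ _ _) _.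
    rewrite -mulrA; apply: (@sum_n_le al).
      by rewrite !mulr_ge0 // addr_ge0.
    move=> n; have nk : (n < (k - mdeg al).+1)%N := ltn_ord n.
    have nk' : (mdeg (mshift al i n) <= k)%N by rewrite mdeg_mshift -leq_subRL.
    rewrite -mulrBl normrM mulrC.
    apply: ler_pM => //; first exact: bound_le nk' (upd_cube i cy (node01 jJ)).
    have {}hs : 0 <= s <= 1.
      have := node01 (ltnW cJ); have := node01 cJ; move/andP: hs => [? ?].
      by move=> /andP[? ?] /andP[? ?]; apply/andP; split; lra.
    have {}ht : 0 <= t <= 1.
      have := node01 (ltnW cJ); have := node01 cJ; move/andP: ht => [? ?].
      by move=> /andP[? ?] /andP[? ?]; apply/andP; split; lra.
    have := node01 jJ => hj.
    have -> : s - t = (s - j%:R / J%:R) - (t - j%:R / J%:R) by ring.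
    by apply: expr_fact_lip; rewrite ler_norml; lra.
  have IH' be z : (mdeg be <= k)%N -> cube z -> _ := fun h1 h2 => local_taylor_err ul h1 cx' h2.
  have t01 : 0 <= t <= 1.
    have := node01 (ltnW cJ); have := node01 cJ; move/andP: ht => [? ?].
    by move=> /andP[? ?] /andP[? ?]; apply/andP; split; lra.
  have [n1 n2] := cell_node cJ ht.
  have e1 := node_poly_err il alk cx' cy (ltnW cJ) t01 n1 IH'.
  have e2 := node_poly_err il alk cx' cy cJ t01 n2 IH'.
  have d1 := np c (ltnW cJ); have d2 := np c.+1 cJ.
  have z01 := cell_coord J0 hs.
  have zd : (J%:R * t - c%:R) - (J%:R * s - c%:R) = - (J%:R * (s - t)) by ring.
  move: e1 e2 d1 d2 z01 zd; set p1 := node_poly _ _ _ _ _ s _; set p1' := node_poly _ _ _ _ _ t _.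
  set p2 := node_poly _ _ _ _ _ s _; set p2' := node_poly _ _ _ _ _ t _.
  set z := J%:R * s - _; set z' := J%:R * t - _; set dd := D al _.
  move=> e1 e2 d1 d2 z01 zd.
  (* A discrete product rule: the polynomials change with fixed weights, then the weights with fixed
     polynomials. The difference [p1' - p2'] is estimated through the common value [dd]. *)
  have -> : (1 - z) * p1 + z * p2 - ((1 - z') * p1' + z' * p2')
    = ((1 - z) * (p1 - p1') + z * (p2 - p2')) + (z' - z) * (p1' - p2') by ring.
  apply: le_trans (ler_normD _ _) _.
  have h1 : `|(1 - z) * (p1 - p1') + z * (p2 - p2')| <= k.+1%:R * (K + err_const (size l)) * `|s - t|.
    exact: convex_le.
  have h2 : `|(z' - z) * (p1' - p2')| <= 2 * err_const (size l).+1 * (J%:R * h `^ (b - (mdeg al)%:R)) * `|s - t|.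
    rewrite zd normrM normrN normrM [`|J%:R|]ger0_norm //.
    have : `|p1' - p2'| <= 2 * (err_const (size l).+1 * h `^ (b - (mdeg al)%:R)).
      have -> : p1' - p2' = (p1' - dd) - (p2' - dd) by ring.
      by apply: le_trans (ler_normB _ _) _; rewrite mulr_natl mulr2n lerD.
    move=> hp.
    have -> : 2 * err_const (size l).+1 * (J%:R * h `^ (b - (mdeg al)%:R)) * `|s - t|
      = J%:R * `|s - t| * (2 * (err_const (size l).+1 * h `^ (b - (mdeg al)%:R))) by ring.
    by rewrite ler_wpM2l // mulr_ge0.
  apply: le_trans (lerD h1 h2) _; rewrite -mulrDl ler_wpM2r //.
  rewrite /M2 [leRHS]mulrDl; apply: lerD.
    by rewrite ler_peMr // mulr_ge0 // addr_ge0.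
  by rewrite ler_wpM2l ?mulr_ge0 // /mesh_scale lerDr.
rewrite !FE.
have -> : F (x i 0) x - F (x' i 0) x' = (F (x i 0) x - F (x i 0) x') + (F (x i 0) x' - F (x' i 0) x').
  by ring.
apply: le_trans (ler_normD _ _) _.
have [c cJ hc] := unit_cell J0 (cx i).
have h1 := in_other c _ cJ hc; have h2 := in_coord _ _ (cx i) (cx' i).
have xi : `|x i 0 - x' i 0| <= `|x - x'|.
  have /(_ i 0) := (mx_norm_le (x - x') (normr_ge0 _)).1 (lexx _).
  by rewrite !mxE.
apply: le_trans (lerD h1 (le_trans h2 (ler_wpM2l _ xi))) _.
  by rewrite /M2 mulr_ge0 ?addr_ge0 ?mulr_ge0 ?addr_ge0 // (le_trans ler01).
by rewrite -mulrDl ler_wpM2r // /M2 -mulrDl ler_wpM2r ?(le_trans ler01) //= addrA.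
Qed.

End LocalPolynomials.
End HolderBall.

(** * The approximating nets *)

Section ProductError.
Context {R : realType} (B : nat) (m : nat) (T : Type).
Context (B2 : (1 < B)%N).
Local Notation eta := (B%:R ^- m : R).

Let pn (f : T -> R) (s : seq T) := prod_net B m [seq f u | u <- s].

Let eta01 : 0 <= eta <= 1.
Proof.
have Bm : 0 < B%:R ^+ m :> R by rewrite exprn_gt0 // ltr0n ltnW.
by rewrite invr_ge0 ltW //= invf_le1 // exprn_ege1 // ler1n ltnW.
Qed.

Let mulE (x y : R) : mult_net B m x y = x * y + mult_err B m x y.
Proof. by rewrite /mult_err addrCA subrr addr0. Qed.

Lemma prod_net_err (f : T -> R) s : (forall u, `|f u| <= 1) ->
  `|pn f s| <= 1 /\ `|pn f s - \prod_(u <- s) f u| <= 4 ^+ size s * eta.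
Proof.
move=> f1; have /andP[eta0 eta1] := eta01.
elim: s => [|u s [IH1 IH2]] /=.
  by rewrite /pn big_nil subrr normr0 normr1 mul1r.
split; first exact: mult_net_le.
rewrite big_cons /pn /= -/(pn f s) mulE.
have -> : f u * pn f s + mult_err B m (f u) (pn f s) - f u * \prod_(j <- s) f j
  = f u * (pn f s - \prod_(j <- s) f j) + mult_err B m (f u) (pn f s) by ring.
apply: le_trans (ler_normD _ _) _; rewrite normrM.
have e1 := mult_err_le B2 m (f1 u) IH1.
have e2 : `|f u| * `|pn f s - \prod_(j <- s) f j| <= 4 ^+ size s * eta.
  by rewrite -[leRHS]mul1r ler_pM.
apply: le_trans (lerD e2 e1) _; rewrite exprS -mulrA.
have : 1 * eta <= 4 ^+ size s * eta by rewrite ler_wpM2r // exprn_ege1 // ler1n.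
by move: (4 ^+ _ * eta) => c; lra.
Qed.

(** Both claims are needed in the induction: the error of one multiplication is Lipschitz with
    factor [eta] in its two arguments, one of which is the remaining approximate product. The factor
    [eta] in the second claim later outweighs the slope [J] and the number of terms. *)
Lemma prod_net_lip (f f' : T -> R) (M : R) s : 0 <= M ->
  (forall u, `|f u| <= 1) -> (forall u, `|f' u| <= 1) ->
  (forall u, `|f u - f' u| <= M) ->
  `|pn f s - pn f' s| <= 4 ^+ size s * M /\
  `|(pn f s - \prod_(u <- s) f u) - (pn f' s - \prod_(u <- s) f' u)|
     <= 4 ^+ size s * (eta * M).
Proof.
move=> M0 f1 f1' ff; have /andP[eta0 eta1] := eta01.
elim: s => [|u s [IH1 IH2]] /=.
  by rewrite /pn !big_nil !subrr normr0 !mul1r mulr_ge0.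
have [p1 pe] := prod_net_err s f1; have [p1' pe'] := prod_net_err s f1'.
rewrite !big_cons /pn /= -/(pn f s) -/(pn f' s) !mulE.
have dm := mult_err_lip B2 m (f1 u) p1 (f1' u) p1'.
have := ff u; move: IH1 IH2 dm pe.
set q := pn f s in p1 *; set q' := pn f' s in p1' pe' *.
set P := \prod_(_ <- _) f _; set P' := \prod_(_ <- _) f' _ in pe' *.
set e := mult_err _ _ _ _; set e' := mult_err _ _ _ _.
set c := 4 ^+ size s => IH1 IH2 dm pe fu.
have c1 : 1 <= c by rewrite exprn_ege1 // ler1n.
have MM : M <= c * M by rewrite ler_peMl.
have dm' : `|e - e'| <= eta * (M + c * M).
  by apply: le_trans dm _; rewrite ler_wpM2l // lerD.
have em : eta * M <= M by rewrite ler_piMl.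
have ecm : eta * (c * M) <= c * M by rewrite ler_piMl // mulr_ge0 // (le_trans ler01).
have emm : eta * M <= eta * (c * M) by rewrite ler_wpM2l.
rewrite !exprS; split.
  have -> : f u * q + e - (f' u * q' + e') = (f u - f' u) * q + f' u * (q - q') + (e - e') by ring.
  have h1 : `|(f u - f' u) * q| <= M * 1 by rewrite normrM ler_pM.
  have h2 : `|f' u * (q - q')| <= 1 * (c * M) by rewrite normrM ler_pM.
  apply: le_trans (ler_normD _ _) _; apply: le_trans (lerD (ler_normD _ _) dm') _.
  by rewrite -/c; lra.
have -> : f u * q + e - f u * P - (f' u * q' + e' - f' u * P')
  = (e - e') + ((f u - f' u) * (q - P) + f' u * (q - P - (q' - P'))) by ring.
have h1 : `|(f u - f' u) * (q - P)| <= M * (c * eta) by rewrite normrM ler_pM.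
have h2 : `|f' u * (q - P - (q' - P'))| <= 1 * (c * (eta * M)) by rewrite normrM ler_pM.
apply: le_trans (ler_normD _ _) _; apply: le_trans (lerD dm' (ler_normD _ _)) _.
by rewrite -/c; lra.
Qed.

End ProductError.

(** * Local Taylor approximants as sums of products of bounded factors *)

Section Terms.
Context {R : realType} (a : nat) (b K : R) (D : {ffun 'I_a -> nat} -> 'cV[R]_a -> R).
Context (b1 : 1 <= b) (K0 : 0 <= K) (hD : holder_data b K D).
Context (J : nat).
Context (J0 : (0 < J)%N).
Local Notation k := (sfloor b).
Local Notation cube := (@unit_cube R a).

(* [(i, j, true)] is the hat at the node [j / J] in the coordinate [i], and
   [(i, j, false)] the displacement from that node. *)
Definition factor (u : 'I_a * 'I_J.+1 * bool) (e : 'I_a -> R) : R :=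
  if u.2 then hat J u.1.2 (e u.1.1) else e u.1.1 - u.1.2%:R / J%:R.

Let JR : (0 : R) < J%:R. Proof. by rewrite ltr0n. Qed.

Lemma hat01 (j : nat) (s : R) : (j <= J)%N -> 0 <= s <= 1 -> 0 <= hat J j s <= 1.
Proof.
move=> jJ s01; have [c cJ hc] := unit_cell J0 s01.
have := cell_coord J0 hc; rewrite (hat_cell cJ jJ hc).
move: (_ - c%:R) => z z01; have [->|jc] := eqVneq j c.
  by rewrite ltn_eqF // mulr1 mulr0; lra.
by case: eqP => _; rewrite ?mulr1 ?mulr0; lra.
Qed.

Lemma hat_lip (j : nat) (s t : R) : (j <= J)%N -> 0 <= s <= 1 -> 0 <= t <= 1 ->
  `|hat J j s - hat J j t| <= J%:R * `|s - t|.
Proof.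
move=> jJ; move: s t; apply: (@lip_cells R (hat J j) J) => // c s t cJ hs ht.
rewrite (hat_cell cJ jJ hs) (hat_cell cJ jJ ht).
have -> : J%:R * `|s - t| = `|J%:R * (s - t)| by rewrite normrM [`|J%:R|]gtr0_norm.
have [->|jc] := eqVneq j c.
  rewrite ltn_eqF // !mulr1 !mulr0 -normrN.
  by rewrite le_eqVlt; apply/orP; left; apply/eqP; congr `|_|; ring.
case: eqP => _; rewrite ?mulr1 ?mulr0.
  by rewrite le_eqVlt; apply/orP; left; apply/eqP; congr `|_|; ring.
by rewrite subrr normr0.
Qed.

Lemma factor_le1 u (x : 'cV[R]_a) : cube x -> `|factor u (fun i => x i 0)| <= 1.
Proof.
move=> cx; have xi := cx u.1.1; have uJ : (u.1.2 <= J)%N by rewrite -ltnS.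
rewrite /factor; case: ifP => _.
  by have := hat01 uJ xi; rewrite ler_norml; lra.
have := node01 (R := R) J0 uJ; rewrite ler_norml; lra.
Qed.

Lemma factor_lip u (x x' : 'cV[R]_a) : cube x -> cube x' ->
  `|factor u (fun i => x i 0) - factor u (fun i => x' i 0)| <= J%:R * `|x - x'|.
Proof.
move=> cx cx'; have xi := cx u.1.1; have xi' := cx' u.1.1.
have uJ : (u.1.2 <= J)%N by rewrite -ltnS.
have dx : `|x u.1.1 0 - x' u.1.1 0| <= `|x - x'|.
  have /(_ u.1.1 0) := (mx_norm_le (x - x') (normr_ge0 _)).1 (lexx _).
  by rewrite !mxE.
rewrite /factor; case: ifP => _.
  by apply: le_trans (hat_lip uJ xi xi') _; rewrite ler_pM2l.
rewrite opprB addrA subrK; apply: le_trans dx _.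
by rewrite ler_peMl // ler1n.
Qed.

(** Multiplying out gives, per coordinate, a choice of node and order. A term then has one hat and
    at most [k] displacements per coordinate, hence [k.+1] factors. *)
Lemma local_taylor_terms l al y : (mdeg al <= k)%N -> cube y ->
  exists s : seq (R * seq ('I_a * 'I_J.+1 * bool)),
    [/\ (size s <= (J.+1 * k.+1) ^ size l)%N,
        forall t, t \in s -> `|t.1| <= K /\ (size t.2 <= k.+1 * size l)%N &
        forall x : 'cV[R]_a, local_taylor b D J l al y x =
          \sum_(t <- s) t.1 * \prod_(u <- t.2) factor u (fun i => x i 0)].
Proof.
elim: l al y => [|i l IH] al y alk cy.
  exists [:: (D al y, [::])]; split=> //.
    by move=> t; rewrite inE => /eqP -> /=; have [_ h _] := hD; split=> //; exact: h.
  by move=> x; rewrite big_seq1 big_nil mulr1.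
have /choice[s hs] : forall jn : 'I_J.+1 * 'I_(k - mdeg al).+1,
  exists s : seq (R * seq ('I_a * 'I_J.+1 * bool)),
    [/\ (size s <= (J.+1 * k.+1) ^ size l)%N,
        forall t, t \in s -> `|t.1| <= K /\ (size t.2 <= k.+1 * size l)%N &
        forall x : 'cV[R]_a, local_taylor b D J l (mshift al i jn.2) (upd y i (jn.1%:R / J%:R)) x =
          \sum_(t <- s) t.1 * \prod_(u <- t.2) factor u (fun i => x i 0)].
  move=> [j n]; apply: IH.
    by rewrite mdeg_mshift -leq_subRL // -ltnS.
  by apply: upd_cube cy _; apply: node01; rewrite // -ltnS.
pose ext (jn : 'I_J.+1 * 'I_(k - mdeg al).+1) (c : R * seq ('I_a * 'I_J.+1 * bool)) :=
  (c.1 / (jn.2`!)%:R, (i, jn.1, true) :: nseq jn.2 (i, jn.1, false) ++ c.2).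
exists (flatten [seq [seq ext jn c | c <- s jn] | jn <- enum [the finType of ('I_J.+1 * 'I_(k - mdeg al).+1)%type]]).
split.
- rewrite -sum1_size big_flatten /= big_map big_enum /=.
  apply: (@leq_trans (\sum_(jn : 'I_J.+1 * 'I_(k - mdeg al).+1) (J.+1 * k.+1) ^ size l)).
    by apply: leq_sum => jn _; rewrite sum1_size size_map; have [] := hs jn.
  rewrite sum_nat_const card_prod !card_ord expnS leq_mul2r; apply/orP; right.
  by rewrite leq_mul2l ltnS leq_subr orbT.
- move=> t /flattenP[r /mapP[jn _ ->]] /mapP[c cs ->] /=.
  have [_ /(_ c cs)[c1 c2] _] := hs jn; split.
    rewrite normrM normfV [`|_%:R|]ger0_norm // ler_pdivrMr ?ltr0n ?fact_gt0 //.
    by apply: le_trans c1 _; rewrite ler_peMr // ler1n fact_gt0.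
  rewrite size_cat size_nseq mulnS -addSn leq_add //.
  by rewrite ltnS -ltnS (leq_trans (ltn_ord jn.2)) // ltnS leq_subr.
- move=> x; rewrite big_flatten /= big_map big_enum /=.
  under eq_bigr do rewrite mulr_sumr.
  rewrite pair_big /=; apply: eq_bigr => -[j n] _ /=.
  have [_ _ ->] := hs (j, n); rewrite big_map mulr_sumr mulr_sumr.
  apply: eq_bigr => c _ /=; rewrite big_cons big_cat /= /factor /= -/factor.
  set P := \prod_(_ <- c.2) _.
  have -> : \prod_(u <- nseq n (i, j, false)) factor u (fun i => x i 0) = (x i 0 - j%:R / J%:R) ^+ n.
    by elim: (n : nat) => [|q IHq]; rewrite ?big_nil ?expr0 //= big_cons IHq exprS.
  by ring.
Qed.

End Terms.

(** * A net for the local Taylor approximant *)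

Section TaylorNet.
Context {R : realType}.

Lemma sum_seq_ord (T : Type) (d : T) (s : seq T) (n : nat) (F : T -> R) :
  (size s <= n)%N -> F d = 0 -> \sum_(t <- s) F t = \sum_(i < n) F (nth d s i).
Proof.
move=> sn Fd; rewrite (big_nth d) big_mkord.
rewrite (big_ord_widen n (fun i => F (nth d s i)) sn) big_mkcond /=.
by apply: eq_bigr => i _; case: ltnP => // /(nth_default d) ->.
Qed.

Lemma taylor_net (a : nat) (b K r : R) (D : {ffun 'I_a -> nat} -> 'cV[R]_a -> R)
    (l : seq 'I_a) (t J B m : nat) :
  1 <= b -> 0 <= K -> holder_data b K D -> (size l <= t)%N -> (0 < J)%N ->
  (1 < B)%N -> (2 * B)%:R <= r -> J%:R <= r ^+ m -> K <= r ->
  let q := ((sfloor b).+1 * t)%N in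
  let cnt := ((J.+1 * (sfloor b).+1) ^ t).+1 in
  exists g : ('I_a -> R) -> R,
    [/\ snet r (cnt * (2 ^ q * (10 * (B + 4) + 8 * (a + 3))))
          (m.+1.*2 + q * (m.*2 + 5)).+1 g,
        forall x, @unit_cube R a x ->
          `|g (fun i => x i 0) - local_taylor b D J l [ffun=> 0%N] 0 x|
             <= cnt%:R * (K * (4 ^+ q * B%:R ^- m)) &
        forall x x', @unit_cube R a x -> @unit_cube R a x' ->
          `|(g (fun i => x i 0) - local_taylor b D J l [ffun=> 0%N] 0 x)
            - (g (fun i => x' i 0) - local_taylor b D J l [ffun=> 0%N] 0 x')|
             <= cnt%:R * (K * (4 ^+ q * B%:R ^- m)) * J%:R * `|x - x'|].
Proof.
move=> b1 K0 hD lt_ J0 B2 Br Jr Kr q cnt.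
have r2 : 2 <= r by apply: le_trans Br; rewrite ler_nat leq_pmulr // ltnW.
have r1 : 1 <= r by lra.
have r0 : 0 <= r by lra.
set k := sfloor b in q cnt *.
pose al0 : {ffun 'I_a -> nat} := [ffun=> 0%N].
have al0k : (mdeg al0 <= k)%N by rewrite /mdeg big1 // => i _; rewrite ffunE.
have c0 : @unit_cube R a 0 by move=> i; rewrite mxE lexx ler01.
have [s [ss sb sE]] := local_taylor_terms K0 hD J0 l al0k c0.
pose w0 := (10 * (B + 4) + 8 * (a + 3))%N.
have [w0_4 w0_shift w0_one] : [/\ 4 <= w0, 6 * (a + 2) <= w0 & 4 * (a + 2) <= w0]%N.
  by rewrite /w0; clear; split; lia.
pose T := ('I_a * 'I_J.+1 * bool)%type.
(* The default term has coefficient [0], so the list is padded to [cnt] terms without changing the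
   sum. *)
pose c i := (nth (0, [::]) s i).1; pose fs i := (nth (0, [::] : seq T) s i).2.
have ss' : (size s <= cnt)%N.
  apply: leq_trans ss _; rewrite /cnt; apply: leq_trans (leqnSn _).
  by rewrite leq_pexp2l // muln_gt0.
have cfs i : `|c i| <= K /\ (size (fs i) <= q)%N.
  rewrite /c /fs; have [si|si] := ltnP i (size s); last first.
    by rewrite nth_default //= normr0.
  have [h1 h2] := sb _ (mem_nth (0, [::]) si); split=> //.
  by apply: leq_trans h2 _; rewrite leq_mul2l lt_ orbT.
have nfac (u : T) : snet r w0 m.+1.*2 (factor u).
  case: u => [[i j] [|]]; rewrite /factor /=; have jJ : (j <= J)%N by rewrite -ltnS.
    by apply: snet_hat => //; rewrite /w0 leq_addl.
  have j01 : `|j%:R / J%:R| <= 1 :> R.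
    by have := node01 (R := R) J0 jJ; rewrite ler_norml; lra.
  by apply: snet_pad (snet_shift _ r1 j01 _).
have nprod i : snet r (2 ^ q * w0) (m.+1.*2 + q * (m.*2 + 5))
    (fun e => prod_net B m [seq factor u e | u <- fs i]).
  apply: snet_prod => //; first by rewrite /w0 leq_addr.
    by rewrite card_ord.
  by have [] := cfs i.
exists (fun e => \sum_(i < cnt) c i * prod_net B m [seq factor u e | u <- fs i]).
pose e i (x : 'cV[R]_a) := prod_net B m [seq factor u (fun i => x i 0) | u <- fs i]
   - \prod_(u <- fs i) factor u (fun i => x i 0).
have dE (x : 'cV[R]_a) : \sum_(i < cnt) c i * prod_net B m [seq factor u (fun i => x i 0) | u <- fs i]
    - local_taylor b D J l al0 0 x = \sum_(i < cnt) c i * e i x.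
  rewrite sE (sum_seq_ord (d := (0, [::])) (n := cnt)) //; last by rewrite mul0r.
  by rewrite -sumrB; apply: eq_bigr => i _; rewrite -mulrBr.
have sum_le (F : 'I_cnt -> R) M : (forall i, `|F i| <= M) ->
    `|\sum_(i < cnt) c i * F i| <= cnt%:R * (K * M).
  move=> FM; apply: le_trans (ler_norm_sum _ _ _) _.
  rewrite -[cnt in leRHS]card_ord mulr_natl -sumr_const; apply: ler_sum => i _.
  by rewrite normrM ler_pM //; have [] := cfs i.
have eta0 : 0 <= B%:R ^- m :> R by rewrite invr_ge0 exprn_ge0.
have p4 i : 4 ^+ size (fs i) <= 4 ^+ q :> R.
  by rewrite ler_weXn2l ?ler1n //; have [] := cfs i.
split.
- have := @snet_lincomb R _ 'I_cnt r (2 ^ q * w0) _ _ (fun i => c i) r0 _ _ nprod.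
  rewrite card_ord; apply=> //.
    by apply: leq_trans w0_4 _; rewrite leq_pmull // expn_gt0.
  by move=> i; apply: le_trans Kr; have [] := cfs i.
- move=> x cx; rewrite dE; apply: sum_le => i.
  have [_ h] := prod_net_err m B2 (fs i) (fun u => factor_le1 J0 u cx).
  by apply: le_trans h _; rewrite ler_wpM2r.
- move=> x x' cx cx'; rewrite !dE -sumrB.
  under eq_bigr do rewrite -mulrBr.
  have -> : cnt%:R * (K * (4 ^+ q * B%:R ^- m)) * J%:R * `|x - x'|
    = cnt%:R * (K * (4 ^+ q * (B%:R ^- m * (J%:R * `|x - x'|)))) by ring.
  apply: sum_le => i.
  have M0 : 0 <= J%:R * `|x - x'| by rewrite mulr_ge0.
  have [_ h] := prod_net_lip m B2 (fs i) M0 (fun u => factor_le1 J0 u cx)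
    (fun u => factor_le1 J0 u cx') (fun u => factor_lip J0 u cx cx').
  by apply: le_trans h _; rewrite ler_wpM2r // mulr_ge0.
Qed.

End TaylorNet.

(** * Approximation of a Hoelder function and choice of the mesh *)

Section Stage.
Context {R : realType}.

Lemma err_const_mono (b K : R) m n : 0 <= K -> (m <= n)%N ->
  err_const b K m <= err_const b K n.
Proof. by move=> K0 mn; rewrite /err_const ler_wpM2r // ler_weXn2l // ler1n. Qed.

Lemma err_const_ge0 (b K : R) n : 0 <= K -> 0 <= err_const b K n.
Proof. by move=> K0; rewrite mulr_ge0 // exprn_ge0. Qed.

Lemma lip_const_mono (b K : R) m n : 0 <= K -> (m <= n)%N ->
  0 <= lip_const b K m <= lip_const b K n.
Proof.
move=> K0; have l0 j : 0 <= lip_const b K j.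
  elim: j => //= j IH; have e0 := err_const_ge0 b j K0; have e1 := err_const_ge0 b j.+1 K0.
  by rewrite !addr_ge0 // mulr_ge0 // addr_ge0.
move=> mn; rewrite l0 /=; rewrite -(subnK mn); elim: (n - m)%N => [|j IH] //.
apply: le_trans IH _; rewrite addSn /= -addrA.
apply: (@le_trans _ _ ((sfloor b).+1%:R * lip_const b K (j + m))).
  by rewrite ler_peMl // ler1n.
have e0 := err_const_ge0 b (j + m) K0; have e1 := err_const_ge0 b (j + m).+1 K0.
by rewrite lerDl addr_ge0 // mulr_ge0 // addr_ge0.
Qed.

Lemma powR_le_base (x b : R) : 0 < x <= 1 -> 1 <= b -> x `^ b <= x.
Proof.
move=> /andP[x0 x1] b1; apply: (@le_trans _ _ (x `^ 1)); last by rewrite powRr1 // ltW.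
by rewrite /powR gt_eqF // ler_expR ler_wnM2r // ln_le0.
Qed.

Lemma holder_local_taylor (a t : nat) (b K : R) (f : 'cV[R]_a -> R)
    (S : {set 'I_a}) : (0 < a)%N -> 1 <= b -> 0 <= K ->
  holder_ball (@unit_cube R a) b K f -> (#|S| <= t)%N ->
  (forall x y : 'cV[R]_a, (forall i, i \in S -> x i 0 = y i 0) -> f x = f y) ->
  exists (D : {ffun 'I_a -> nat} -> 'cV[R]_a -> R) (l : seq 'I_a),
    [/\ holder_data b K D, (size l <= t)%N,
        forall J x, (0 < J)%N -> @unit_cube R a x ->
          `|local_taylor b D J l [ffun=> 0%N] 0 x - f x|
            <= err_const b K t * (J%:R^-1 : R) `^ b &
        forall J x x', (0 < J)%N -> @unit_cube R a x -> @unit_cube R a x' ->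
          `|local_taylor b D J l [ffun=> 0%N] 0 x - local_taylor b D J l [ffun=> 0%N] 0 x'|
            <= 2 * lip_const b K t * `|x - x'|].
Proof.
move=> a0 b1 K0 hf St fS.
have b0 : 0 < b by exact: lt_le_trans b1.
have [D D0 hD] := holder_ball_data a0 b0 hf.
have c0 : @unit_cube R a 0 by move=> i; rewrite mxE lexx ler01.
have m0 : mdeg ([ffun=> 0%N] : {ffun 'I_a -> nat}) = 0%N.
  by rewrite /mdeg big1 // => i _; rewrite ffunE.
have m0k : (mdeg ([ffun=> 0%N] : {ffun 'I_a -> nat}) <= sfloor b)%N by rewrite m0.
have sl : (size (enum S) <= t)%N by rewrite -cardE.
(* Only the arguments in [S] are expanded; [f] does not change when the others are set to [0]. This
   makes the number of nodes a power with exponent [t] rather than [a]. *)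
exists D, (enum S); split=> // [J x J0 cx|J x x' J0 cx cx'].
  have := local_taylor_err b1 K0 hD J0 (enum_uniq S) m0k cx c0.
  rewrite m0 subr0 D0; last exact: mix_cube.
  rewrite (fS x (mix (enum S) x 0)); last by move=> i iS; rewrite mxE mem_enum iS.
  move=> h; apply: le_trans h _; rewrite ler_wpM2r ?powR_ge0 //.
  exact: err_const_mono.
apply: le_trans (local_taylor_lip b1 K0 hD J0 (enum_uniq S) m0k cx cx' c0) _.
rewrite ler_wpM2r // mulrC.
have /andP[l0 lt_] := lip_const_mono b K0 sl.
apply: ler_pM => //; first by rewrite /mesh_scale addr_ge0 ?mulr_ge0 ?powR_ge0.
rewrite /mesh_scale m0 subr0 -[2]/(1 + 1) lerD2l.
have JR : (0 : R) < J%:R by rewrite ltr0n.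
rewrite mulrC -ler_pdivlMr // mul1r.
by apply: powR_le_base; rewrite // invr_gt0 JR /= invf_le1 // ler1n.
Qed.

(** The local Taylor approximants are uniformly Lipschitz. With mesh width at most the distance of
    [x] and [x'], their error is at most a multiple of that distance because [b >= 1]. *)
Lemma holder_lipschitz (a : nat) (b K : R) (f : 'cV[R]_a -> R) :
  (0 < a)%N -> 1 <= b -> 0 <= K -> holder_ball (@unit_cube R a) b K f ->
  forall x x', @unit_cube R a x -> @unit_cube R a x' ->
    `|f x - f x'| <= 2 * (err_const b K a + lip_const b K a) * `|x - x'|.
Proof.
move=> a0 b1 K0 hf x x' cx cx'.
have [->|xx] := eqVneq x x'; first by rewrite !subrr !normr0 mulr0.
have [||D [l [hD sl e1 e2]]] := @holder_local_taylor a a b K f [set: 'I_a] a0 b1 K0 hf.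
- by rewrite cardsT card_ord.
- move=> y z yz; congr f; apply/colP => i; exact: yz.
have d0 : 0 < `|x - x'| by rewrite normr_gt0 subr_eq0.
pose J := (Num.truncn (`|x - x'|^-1)).+1.
have J0 : (0 < J)%N by [].
have JR : (0 : R) < J%:R by rewrite ltr0n.
have hJ : (J%:R^-1 : R) `^ b <= `|x - x'|.
  apply: (@le_trans _ _ (J%:R^-1)).
    by apply: powR_le_base; rewrite // invr_gt0 JR /= invf_le1 // ler1n.
  rewrite -[leRHS]invrK lef_pV2 ?posrE ?invr_gt0 //.
  have := @truncn_itv R (`|x - x'|^-1); rewrite invr_ge0 ltW // => /(_ isT) /andP[_ h].
  exact: ltW.
pose P := local_taylor b D J l [ffun=> 0%N] 0.
have -> : f x - f x' = (P x - P x') - (P x - f x) + (P x' - f x') by ring.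
have E0 := err_const_ge0 b a K0.
have t1 := ler_wpM2l E0 hJ.
apply: le_trans (ler_normD _ _) _; apply: le_trans (lerD (ler_normB _ _) (lexx _)) _.
have h1 := e1 J x J0 cx; have h2 := e1 J x' J0 cx'; have h3 := e2 J x x' J0 cx cx'.
apply: le_trans (lerD (lerD h3 (le_trans h1 t1)) (le_trans h2 t1)) _.
by rewrite le_eqVlt; apply/orP; left; apply/eqP; ring.
Qed.

Lemma pow2_above (x : R) : exists2 p, (0 < p)%N & x <= 2 ^+ p.
Proof.
exists (Num.truncn `|x|).+1 => //.
have /andP[_ h] := truncn_itv (normr_ge0 x).
apply: le_trans (ler_norm x) _; apply: le_trans (ltW h) _.
by rewrite -natrX ler_nat ltnW // ltn_expl.
Qed.

Lemma mesh_size (t : nat) (b A3 : R) (N : nat) : (0 < t)%N -> 1 <= b -> 1 <= A3 ->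
  (0 < N)%N ->
  exists2 J, (0 < J)%N &
    [/\ J.+1%:R ^+ t <= (3 * A3) ^+ t * N%:R :> R, J%:R <= 2 * A3 * N%:R &
        (J%:R^-1 : R) `^ b <= A3^-1 * N%:R `^ (- (b / t%:R))].
Proof.
move=> t0 b1 A31 N0.
have tR : (0 : R) < t%:R by rewrite ltr0n.
have NR : (1 : R) <= N%:R by rewrite ler1n.
pose y : R := N%:R `^ (t%:R^-1).
have y1 : 1 <= y.
  apply: (@le_trans _ _ (expR 0)); first by rewrite expR0.
  rewrite /y /powR gt_eqF ?(lt_le_trans ltr01) // ler_expR mulr_ge0 ?invr_ge0 //.
  exact: ln_ge0.
have yt : y ^+ t = N%:R.
  by rewrite -powR_mulrn ?powR_ge0 // -powRrM mulVf ?gt_eqF // powRr1.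
have yN : y <= N%:R.
  by rewrite -yt -[leLHS]expr1 ler_weXn2l.
have Ay1 : 1 <= A3 * y by rewrite -[1]mulr1 ler_pM.
have A30 : 0 < A3 by exact: lt_le_trans A31.
have y0 : 0 < y by exact: lt_le_trans y1.
(* As [A3 * y >= 1], rounding costs only the factors [2] for [J] and [3] for [J.+1]. *)
pose J := (Num.truncn (A3 * y)).+1; exists J => //.
have /andP[h1 h2] : (Num.truncn (A3 * y))%:R <= A3 * y < J%:R.
  by apply: truncn_itv; exact: le_trans Ay1.
have J2 : J%:R <= 2 * A3 * y.
  by rewrite /J -[X in X <= _]natr1 -mulrA mulr_natl mulr2n lerD.
have JR : (0 : R) < J%:R by rewrite ltr0n.
split.
- rewrite -yt -exprMn lerXn2r ?nnegrE ?mulr_ge0 // ?(ltW A30) ?(ltW y0) //.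
  by rewrite -[X in X <= _]natr1; lra.
- by apply: le_trans J2 _; rewrite ler_wpM2l // mulr_ge0 // ltW.
- have e : N%:R `^ (- (b / t%:R)) = y `^ (- b).
    by rewrite /y -powRrM; congr (_ `^ _); field; rewrite gt_eqF.
  rewrite e.
  apply: (@le_trans _ _ ((A3 * y) `^ (- b))).
    rewrite -powR_inv1 ?(ltW JR) // -powRrM mulN1r.
    by rewrite /powR !gt_eqF ?mulr_gt0 // ler_expR !mulNr lerN2 ler_wpM2l
      ?(le_trans ler01) // ler_ln ?posrE ?mulr_gt0 // ltW.
  rewrite powRM ?(ltW A30) ?(ltW y0) // ler_wpM2r ?powR_ge0 //.
  rewrite -powR_inv1 ?(ltW A30) // /powR gt_eqF // ler_expR ler_wpM2r ?ln_ge0 //.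
  by rewrite lerN2.
Qed.

End Stage.

(** * A net for one Hoelder function *)

Section StageNet.
Context {R : realType}.

Lemma nat_above (x : R) : exists2 p, (0 < p)%N & x <= p%:R.
Proof.
have [p p0 xp] := pow2_above x; exists (2 ^ p)%N; first by rewrite expn_gt0.
by rewrite natrX.
Qed.

(** The order of the quantifiers matters. The depth factor [Q0] depends on [t] and [b] only, and [A]
    is fixed before [delta]; so [Q] can later be built from the depth factors of all stages and
    [delta] from their Lipschitz constants. Only [r] and [W] depend on [delta] and [Q]. *)
Lemma holder_net (t : nat) (b : R) : (0 < t)%N -> 1 <= b ->
  exists Q0 : nat, forall (a : nat) (K : R), (0 < a)%N -> 1 <= K ->
  exists2 A : R, 0 <= A & forall (delta : R) (Q : nat), 0 < delta ->
  exists r W : nat, forall (f : 'cV[R]_a -> R) (S : {set 'I_a}) (n N m : nat),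
    holder_ball (@unit_cube R a) b K f -> (#|S| <= t)%N ->
    (forall x y : 'cV[R]_a, (forall i, i \in S -> x i 0 = y i 0) -> f x = f y) ->
    (1 <= N <= n)%N -> (0 < m)%N -> (n <= 2 ^ (2 * Q * m))%N ->
    exists g : ('I_a -> R) -> R,
      [/\ snet r%:R (W * N) (Q0 * m.+1) g,
          forall x, @unit_cube R a x ->
            `|g (fun i => x i 0) - f x|
              <= delta * (N%:R `^ (- (b / t%:R)) + n%:R^-1) &
          forall x x', @unit_cube R a x -> @unit_cube R a x' ->
            `|g (fun i => x i 0) - g (fun i => x' i 0)| <= A * `|x - x'|].
Proof.
move=> t0 b1; pose k := sfloor b; pose q := (k.+1 * t)%N.
exists (5 * q + 3)%N => a K a0 K1; have K0 : 0 <= K by exact: le_trans K1.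
exists (2 * lip_const b K t + 1).
  by rewrite addr_ge0 // mulr_ge0 //; have /andP[] := lip_const_mono b K0 (leqnn t).
move=> delta Q d0.
pose A1 := err_const b K t; have A1_0 : 0 <= A1 := err_const_ge0 b t K0.
(* This refinement of the mesh reduces the approximation constant [A1] to [A1 / A3 <= delta]. *)
pose A3 := 1 + A1 / delta.
have A31 : 1 <= A3 by rewrite lerDl divr_ge0 // ltW.
have A30 : 0 < A3 by exact: lt_le_trans A31.
pose A5 := (3 * A3) ^+ t * k.+1%:R ^+ t + 1.
have A50 : 0 <= A5 by rewrite addr_ge0 // mulr_ge0 // exprn_ge0 // mulr_ge0 // ltW.
pose A6 := A5 * K * 4 ^+ q * (2 * A3).
have A60 : 0 <= A6 by rewrite !mulr_ge0 // ?exprn_ge0 // ltW.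
have [p p0 hp] := pow2_above (A6 * (1 + delta^-1)).
have [p2 p20 hp2] := nat_above (2 * A3 + K).
have [w5 w50 hw5] := nat_above A5.
pose B := (2 ^ (6 * Q + p))%N; pose r := (2 * B * p2)%N.
pose w0 := (2 ^ q * (10 * (B + 4) + 8 * (a + 3)))%N.
have B2 : (1 < B)%N by rewrite /B -(expn0 2) ltn_exp2l // addn_gt0 p0 orbT.
exists r, (w5 * w0)%N => f S n N m hf St fS /andP[N1 Nn] m0 nm.
have [D [l [hD sl e1 e2]]] := holder_local_taylor a0 b1 K0 hf St fS.
have [J J0 [J1 J2 J3]] := mesh_size t0 b1 A31 N1.
have n0 : (0 : R) < n%:R by rewrite ltr0n (leq_trans N1).
have NR : (0 : R) < N%:R by rewrite ltr0n.
have NnR : N%:R <= n%:R :> R by rewrite ler_nat.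
have nmR : n%:R <= (2 ^+ (2 * Q)) ^+ m :> R by rewrite -exprM -natrX ler_nat.
have pR : 2 * A3 + K <= p2%:R by [].
have r1 : 1 <= r%:R :> R by rewrite ler1n /r !muln_gt0 /= p20 (ltnW B2).
have Br : (2 * B)%:R <= r%:R :> R by rewrite ler_nat /r leq_pmulr.
have Kr : K <= r%:R.
  apply: le_trans (_ : p2%:R <= _); last first.
    by rewrite ler_nat /r leq_pmull // muln_gt0 /= ltnW.
  by apply: le_trans pR; rewrite lerDr mulr_ge0 // ltW.
have Jr : J%:R <= r%:R ^+ m :> R.
  apply: le_trans J2 _; rewrite /r natrM exprMn mulrC.
  apply: ler_pM => //; first by rewrite mulr_ge0 // ltW.
    apply: le_trans NnR (le_trans nmR _).
    rewrite lerXn2r ?nnegrE ?exprn_ge0 // -natrX ler_nat /B -[in leqRHS]expnS.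
    by rewrite leq_exp2l //; clear; lia.
  have p21 : 1 <= p2%:R :> R by rewrite ler1n.
  apply: le_trans (_ : p2%:R <= _); first by apply: le_trans pR; rewrite lerDl.
  by rewrite -[leLHS]expr1 ler_weXn2l.
have [g [ng g1 g2]] := taylor_net b1 K0 hD sl J0 B2 Br Jr Kr.
move: ng g1 g2; set cnt := (_ ^ t).+1; set E := cnt%:R * _ => ng g1 g2.
have cntN : cnt%:R <= A5 * N%:R.
  rewrite /cnt -[_.+1%:R]natr1 natrX natrM exprMn -/k /A5 mulrDl mul1r.
  apply: lerD; last by rewrite ler1n.
  by rewrite mulrAC ler_wpM2r // exprn_ge0.
(* [E * J] is the Lipschitz constant of the product error. The bound [delta / n] serves the
   accuracy, the bound [1 / n <= 1] the summand [1] in the final Lipschitz constant. *)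
have EJ : E * J%:R <= Num.min delta 1 / n%:R.
  have Bm : B%:R ^- m <= ((n%:R ^+ 3) * 2 ^+ p)^-1 :> R.
    rewrite lef_pV2 ?posrE ?mulr_gt0 ?exprn_gt0 // ?ltr0n ?(ltnW B2) //.
    rewrite /B natrX exprD exprMn; apply: ler_pM; [by rewrite exprn_ge0 // ltW|by rewrite exprn_ge0| |].
      have -> : 2 ^+ (6 * Q) ^+ m = ((2 ^+ (2 * Q)) ^+ m) ^+ 3 :> R.
        by rewrite -!exprM; congr (_ ^+ _); clear; lia.
      by rewrite lerXn2r ?nnegrE ?exprn_ge0 // ltW.
    by rewrite -exprM ler_weXn2l ?ler1n // leq_pmulr.
  have eta0 : 0 <= B%:R ^- m :> R by rewrite invr_ge0 exprn_ge0.
  apply: (@le_trans _ _ (A5 * n%:R * (K * (4 ^+ q * ((n%:R ^+ 3) * 2 ^+ p)^-1)) * (2 * A3 * n%:R))).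
    apply: ler_pM => //; first by rewrite /E !mulr_ge0 // exprn_ge0.
      apply: ler_pM => //; first by rewrite !mulr_ge0 // exprn_ge0.
        by apply: le_trans cntN _; rewrite ler_wpM2l.
      by rewrite ler_wpM2l // ler_wpM2l // exprn_ge0.
    by apply: le_trans J2 _; rewrite ler_wpM2l // mulr_ge0 // ltW.
  have p2_0 : 0 < 2 ^+ p :> R by rewrite exprn_gt0.
  have -> : A5 * n%:R * (K * (4 ^+ q * ((n%:R ^+ 3) * 2 ^+ p)^-1)) * (2 * A3 * n%:R)
    = A6 / 2 ^+ p / n%:R.
    by rewrite /A6; field; rewrite !gt_eqF.
  rewrite ler_wpM2r ?invr_ge0 ?(ltW n0) // ler_pdivrMr //.
  have hp' : A6 + A6 / delta <= 2 ^+ p by move: hp; rewrite mulrDr mulr1.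
  have A6d : 0 <= A6 / delta by rewrite divr_ge0 // ltW.
  move: hp' A6d A60 p2_0 d0; clear=> hp' A6d A60 p2_0 d0.
  rewrite /Num.min; case: ifP => _; last by lra.
  by rewrite mulrC -ler_pdivrMr //; lra.
have E0 : 0 <= E.
  by rewrite /E !mulr_ge0 // ?exprn_ge0 // invr_ge0 exprn_ge0.
have EJ1 : E <= E * J%:R by rewrite ler_peMr // ler1n.
have min_d : Num.min delta 1 / n%:R <= delta / n%:R.
  by rewrite ler_wpM2r ?invr_ge0 ?(ltW n0) // ge_min lexx.
have min_1 : Num.min delta 1 / n%:R <= 1.
  rewrite ler_pdivrMr // mul1r; apply: (@le_trans _ _ 1); first by rewrite ge_min lexx orbT.
  by rewrite ler1n (leq_trans N1).
exists g; split.
- have : snet r%:R (w5 * w0 * N) (m.+1.*2 + q * (m.*2 + 5)).+1 g.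
    apply: snet_mono ng => //.
    rewrite -/k -/q -/w0 mulnAC leq_mul2r; apply/orP; right.
    by rewrite -(ler_nat R) natrM; apply: le_trans cntN _; rewrite ler_wpM2r.
  apply: snet_pad => //.
    have w04 : (4 <= w0)%N.
      rewrite /w0; apply: (@leq_trans (10 * (B + 4) + 8 * (a + 3))); first by clear; lia.
      by rewrite leq_pmull // expn_gt0.
    by apply: leq_trans w04 _; rewrite mulnAC leq_pmull // muln_gt0 w50.
  suff aux q' : ((m.+1.*2 + q' * (m.*2 + 5)).+1 <= (5 * q' + 3) * m.+1)%N by exact: aux.
  clear; nia.
- move=> x cx.
  have -> : g (fun i => x i 0) - f x = (g (fun i => x i 0) - local_taylor b D J l [ffun=> 0%N] 0 x)
     + (local_taylor b D J l [ffun=> 0%N] 0 x - f x) by rewrite addrA subrK.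
  apply: le_trans (ler_normD _ _) _; apply: le_trans (lerD (g1 x cx) (e1 J x J0 cx)) _.
  rewrite addrC mulrDr lerD //; last first.
    exact: le_trans EJ1 (le_trans EJ min_d).
  apply: le_trans (ler_wpM2l A1_0 J3) _.
  rewrite mulrA ler_wpM2r ?powR_ge0 // ler_pdivrMr // /A3 mulrDr mulr1 mulrCA divff ?gt_eqF //.
  by rewrite mulr1 lerDr ltW.
- move=> x x' cx cx'.
  set G := g _; set G' := g _; set P := local_taylor b D J l [ffun=> 0%N] 0.
  have -> : G - G' = (G - P x - (G' - P x')) + (P x - P x') by ring.
  apply: le_trans (ler_normD _ _) _.
  apply: le_trans (lerD (g2 x x' cx cx') (e2 J x x' J0 cx cx')) _.
  rewrite [leLHS]addrC [leRHS]mulrDl lerD // mul1r ler_piMl //.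
  exact: le_trans EJ min_1.
Qed.

End StageNet.

(** * Two hidden layers *)

Section Staircase.
Context {R : realType} (M P : nat).
Context (M0 : (0 < M)%N) (P0 : (0 < P)%N).
Local Notation mesh := (M * P)%N.

(* The staircase number [s] climbs from the level [l] to [l + 1] on the single
   cell [l * P + s] of the fine mesh, so that staircases with different numbers
   never climb on the same cell. *)
Definition level (s i : nat) : nat := ((i + (P - s.+1)) %/ P)%N.

Lemma levelS s i : (s < P)%N -> level s i.+1 = ((s == i %% P) + level s i)%N.
Proof.
move=> sP; rewrite /level addSn divnS //; congr (_ + _)%N; congr nat_of_bool.
have -> : ((i + (P - s.+1)).+1 = i + (P - s))%N by rewrite -addnS subnSK.
have iP : (i %% P < P)%N by rewrite ltn_mod.
rewrite /dvdn -modnDml; apply/eqP/eqP => [|->]; last by rewrite subnKC ?modnn // ltnW.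
have [h|h] := ltnP (i %% P) s.
  rewrite modn_small; first by move=> /eqP; rewrite addn_eq0 subn_eq0 [(P <= s)%N]leqNgt sP andbF.
  by rewrite addnBA ?(ltnW sP) // ltn_subLR ?ltn_add2r // (leq_trans (ltnW sP)) // leq_addl.
rewrite addnBA ?(ltnW sP) // addnC -addnBA // addnC modnDr modn_small.
  by move=> /eqP; rewrite subn_eq0 => h'; apply/eqP; rewrite eqn_leq h h'.
by apply: leq_ltn_trans iP; apply: leq_subr.
Qed.

Lemma level_le s i : (s < P)%N -> (i <= mesh)%N -> (level s i <= M)%N.
Proof.
move=> sP iM; rewrite /level -ltnS ltn_divLR // mulSn.
by rewrite addnC; apply: (@leq_trans (P - s.+1 + mesh).+1);
  rewrite ?ltnS ?leq_add2l // -addSn leq_add2r subnSK // leq_subr.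
Qed.

Lemma level_bounds s i : (s < P)%N ->
  (level s i * P <= i + P.-1)%N /\ (i.+1 <= (level s i).+1 * P)%N.
Proof.
move=> sP; rewrite /level; split.
  apply: leq_trans (leq_trunc_div _ _) _; rewrite leq_add2l.
  by rewrite -subn1 leq_sub2l.
apply: leq_trans (ltn_ceil (i + (P - s.+1)) P0).
by rewrite ltnS leq_addr.
Qed.

Definition level_dist (s c i : nat) : R := `|(level s i)%:R - c%:R|.

Lemma level_distS s c i : (s < P)%N ->
  `|level_dist s c i.+1 - level_dist s c i| <= 1.
Proof.
move=> sP; apply: le_trans (ler_dist_dist _ _) _.
rewrite levelS // natrD opprB addrA subrK addrK.
exact: normr_delta_le1.
Qed.

Lemma relu_natdist (l c : nat) : relu (1 - `|l%:R - c%:R|) = (l == c)%:R :> R.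
Proof.
have [->|lc] := eqVneq l c; first by rewrite subrr normr0 subr0 relu_ge0.
rewrite relu_le0 // subr_le0.
have [h|h] : (l + 1 <= c)%N \/ (c + 1 <= l)%N by lia.
  have : l%:R + 1%:R <= c%:R :> R by rewrite -natrD ler_nat.
  by move=> ?; rewrite ler0_norm; lra.
have : c%:R + 1%:R <= l%:R :> R by rewrite -natrD ler_nat.
by move=> ?; rewrite ger0_norm; lra.
Qed.

(** ReLU commutes with the interpolation: at the ends of a cell, [1] minus the distance takes
    integer values that differ by at most [1], hence never have strictly opposite signs. *)
Lemma relu_level_dist s c k (z : R) : (s < P)%N -> 0 <= z <= 1 ->
  relu (1 - ((1 - z) * level_dist s c k + z * level_dist s c k.+1)) =
  (1 - z) * (level s k == c)%:R + z * (level s k.+1 == c)%:R.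
Proof.
move=> sP z01; rewrite /level_dist levelS //.
set l := level s k; case: (s == _); last first.
  have -> : (1 - z) * `|l%:R - c%:R| + z * `|(0 + l)%:R - c%:R| = `|l%:R - c%:R| :> R.
    by rewrite add0n; ring.
  by rewrite relu_natdist add0n; ring.
rewrite add1n -[l.+1%:R]natr1.
have [->|lc] := eqVneq l c.
  rewrite eq_sym ltn_eqF // subrr normr0 addrAC subrr add0r normr1.
  by rewrite relu_ge0; rewrite ?mulr0 ?mulr1 ?add0r ?addr0 //; lra.
have [<-|lc1] := eqVneq l.+1 c.
  have -> : l.+1%:R = l%:R + 1 :> R by rewrite natr1.
  have -> : l%:R + 1 - (l%:R + 1) = 0 :> R by ring.
  have -> : l%:R - (l%:R + 1) = -1 :> R by ring.
  rewrite normrN normr1 normr0.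
  by rewrite relu_ge0; rewrite ?mulr0 ?mulr1 ?add0r ?addr0 //; lra.
rewrite relu_le0 ?mulr0 ?addr0 // subr_le0.
have [h|h] : (l + 2 <= c)%N \/ (c + 1 <= l)%N by lia.
  have : l%:R + 2%:R <= c%:R :> R by rewrite -natrD ler_nat.
  by move=> ?; rewrite !ler0_norm; lra.
have : c%:R + 1 <= l%:R :> R by rewrite natr1 -addn1 ler_nat.
by move=> ?; rewrite !ger0_norm; nra.
Qed.

Context (a : nat).

(** A soft indicator that staircase [s] shows level [c i] in every coordinate [i]. Adding the
    distances instead of multiplying indicators keeps it within two hidden layers. *)
Definition bump (s : nat) (c : {ffun 'I_a -> 'I_M.+1}) (e : 'I_a -> R) : R :=
  relu (1 - \sum_i pl mesh (level_dist s (c i)) (e i)).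

Lemma bump_ge0 s c e : 0 <= bump s c e.
Proof. by rewrite /bump /relu le_max lexx orbT. Qed.

Lemma sum_bump01 s e (lo hi : R) (v : {ffun 'I_a -> 'I_M.+1} -> R) :
  lo <= 0 -> 0 <= hi -> (forall c, lo <= v c <= hi) -> \sum_c bump s c e <= 1 ->
  lo <= \sum_c v c * bump s c e <= hi.
Proof.
move=> lo0 hi0 hv b1.
have b0 : 0 <= \sum_c bump s c e by apply: sumr_ge0 => c _; exact: bump_ge0.
apply/andP; split.
  apply: (@le_trans _ _ (\sum_c lo * bump s c e)).
    by rewrite -mulr_sumr; nra.
  apply: ler_sum => c _; rewrite ler_wpM2r ?bump_ge0 //.
  by have /andP[] := hv c.
apply: (@le_trans _ _ (\sum_c hi * bump s c e)).
  apply: ler_sum => c _; rewrite ler_wpM2r ?bump_ge0 //.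
  by have /andP[] := hv c.
by rewrite -mulr_sumr; nra.
Qed.

(** A bump is majorized by a product over the coordinates, so that the sum over all [c]
    factorizes. *)
Lemma relu_sum_prod (I : finType) (u : I -> R) : (forall i, 0 <= u i) ->
  relu (1 - \sum_i u i) <= \prod_i relu (1 - u i).
Proof.
move=> u0; have r0 (x : R) : 0 <= relu x by rewrite /relu le_max lexx orbT.
have step (x y : R) : 0 <= x -> 0 <= y -> relu (1 - (x + y)) <= relu (1 - x) * relu (1 - y).
  move=> x0 y0; have [xy|xy] := leP 1 (x + y); first by rewrite relu_le0 ?mulr_ge0 //; lra.
  by rewrite !relu_ge0; [nra|lra..].
suff [] : relu (1 - \sum_i u i) <= \prod_i relu (1 - u i) /\ 0 <= \sum_i u i by [].
apply: (big_rec2 (fun p q => relu (1 - q) <= p /\ 0 <= q)) => [|i p q _ [IH q0]].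
  by rewrite subr0 relu_ge0.
split; last by rewrite addr_ge0.
by apply: le_trans (step _ _ (u0 i) q0) _; rewrite ler_wpM2l.
Qed.

Lemma pl_level_dist (s : nat) (x : R) : (s < P)%N ->
  exists k z, [/\ (k < mesh)%N, 0 <= z <= 1,
    forall c, pl mesh (level_dist s c) x
      = (1 - z) * level_dist s c k + z * level_dist s c k.+1 &
    0 <= x <= 1 -> z = mesh%:R * x - k%:R].
Proof.
move=> sP; have G0 : (0 < mesh)%N by rewrite muln_gt0 M0.
by have [k [z [kM z01 plE zE]]] := pl_convex x G0; exists k, z; split.
Qed.

(** This holds at every point, also outside the cube and where staircases climb, and so keeps the
    lookup between [lo] and [hi] globally. *)
Lemma sum_bump_le1 s e : (s < P)%N -> \sum_c bump s c e <= 1.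
Proof.
move=> sP.
have pl0 i (c : nat) : 0 <= pl mesh (level_dist s c) (e i).
  have [k [z [_ z01 -> _]]] := pl_level_dist (e i) sP.
  by rewrite /level_dist addr_ge0 // mulr_ge0 //; lra.
apply: (@le_trans _ _ (\sum_(c : {ffun 'I_a -> 'I_M.+1}) \prod_i relu (1 - pl mesh (level_dist s (c i)) (e i)))).
  by apply: ler_sum => c _; exact: relu_sum_prod.
rewrite -(bigA_distr_bigA (fun i (c : 'I_M.+1) => relu (1 - pl mesh (level_dist s c) (e i)))).
apply: prodr_ile1 => i _; apply/andP; split.
  by apply: sumr_ge0 => c _; rewrite /relu le_max lexx orbT.
have [k [z [_ z01 plE _]]] := pl_level_dist (e i) sP.
under eq_bigr do rewrite plE relu_level_dist //.
rewrite big_split /= -!mulr_sumr.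
have le1 l : \sum_(c < M.+1) (l == c :> nat)%:R <= 1 :> R.
  have [lM|lM] := ltnP l M.+1.
    rewrite (bigD1 (Ordinal lM)) //= eqxx big1 ?addr0 // => c /eqP cl.
    by case: eqP => // lc; case: cl; apply: val_inj.
  rewrite big1 // => c _; case: eqP => // lc.
  by move: lM; rewrite lc leqNgt ltn_ord.
have := le1 (level s k); have := le1 (level s k.+1).
move: (\sum_c _) (\sum_c _) => u v; nra.
Qed.

Lemma bump_flat s (e : 'I_a -> R) (k : 'I_a -> nat) (z : 'I_a -> R) c :
  (s < P)%N -> (forall i, (k i < mesh)%N) ->
  (forall i y, pl mesh y (e i) = (1 - z i) * y (k i) + z i * y (k i).+1) ->
  (forall i, s != k i %% P)%N ->
  bump s c e = (c == [ffun i => inord (level s (k i))])%:R.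
Proof.
move=> sP kM plE good.
have flat i : level s (k i).+1 = level s (k i).
  by rewrite levelS // (negPf (good i)).
have lM i : (level s (k i) < M.+1)%N by rewrite ltnS level_le // ltnW.
rewrite /bump.
have -> : \sum_i pl mesh (level_dist s (c i)) (e i)
    = \sum_i `|(level s (k i))%:R - (c i)%:R|.
  by apply: eq_bigr => i _; rewrite plE /level_dist flat; ring.
have [->|/eqP cn] := eqVneq c _.
  rewrite big1 ?subr0 ?relu_ge0 // => i _.
  by rewrite ffunE inordK // subrr normr0.
rewrite relu_le0 // subr_le0.
have [i ci] : exists i, level s (k i) != c i :> nat.
  apply: contrapT => h; apply: cn; apply/ffunP => i; rewrite ffunE.
  apply: val_inj; rewrite /= inordK //; apply/esym/eqP/negPn/negP => ci.
  by apply: h; exists i.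
rewrite (bigD1 i) //=; apply: (@le_trans _ _ (`|(level s (k i))%:R - (c i)%:R|)).
  have := relu_natdist (level s (k i)) (c i); rewrite (negPf ci) /relu => h.
  have : 1 - `|(level s (k i))%:R - (c i)%:R| <= (0 : R) by rewrite -[leRHS]h le_max lexx.
  by rewrite subr_le0.
by rewrite lerDl sumr_ge0.
Qed.

End Staircase.

(** * Uniform approximation with two hidden layers *)

Section ShallowNet.
Context {R : realType}.

Let near_level (L p m x k : R) : 0 < p -> 0 <= m * p * x - k <= 1 ->
  L * p + 1 <= k + p -> k + 1 <= L * p + p -> `|L - m * x| <= 1.
Proof.
move=> p0 z01 l1 l2; rewrite ler_norml; apply/andP.
by split; rewrite -(ler_pM2r p0); nra.
Qed.

Lemma shallow_net (a o : nat) (lo hi Lg delta : R) :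
  lo <= 0 -> 0 <= hi -> 0 <= Lg -> 0 < delta ->
  exists r W : nat, forall G : 'cV[R]_a -> 'cV[R]_o,
    (forall x j, @unit_cube R a x -> lo <= G x j 0 <= hi) ->
    (forall x x' j, @unit_cube R a x -> @unit_cube R a x' ->
       `|G x j 0 - G x' j 0| <= Lg * `|x - x'|) ->
    exists g : 'I_o -> ('I_a -> R) -> R,
      [/\ net r%:R W 1 g, forall e j, lo <= g j e <= hi &
          forall x j, @unit_cube R a x ->
            `|g j (fun i => x i 0) - G x j 0| <= delta].
Proof.
move=> lo0 hi0 Lg0 d0.
(* Where no staircase climbs, rounding moves the argument by at most [1 / M], which costs
   [Lg / M <= delta / 2]. *)
have [M M0 hM] := nat_above (2 * Lg / delta).
(* At most [a] of the [P] staircases fail at a given point, each by at most [hi - lo]; their share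
   in the average is at most [delta / 2]. *)
have [P P0 hP] := nat_above (2 * a%:R * (hi - lo) / delta).
have MR : (0 : R) < M%:R by rewrite ltr0n.
have PR : (0 : R) < P%:R by rewrite ltr0n.
pose mesh := (M * P)%N.
have G0 : (0 < mesh)%N by rewrite muln_gt0 M0.
have GR : (0 : R) < mesh%:R by rewrite ltr0n.
pose O := [the finType of ('I_P * {ffun 'I_a -> 'I_M.+1})%type].
(* The unit [None] has no inputs and shift [-1]; it outputs the constant [1] that carries the
   constant terms of [F]. *)
pose H := [the finType of option ('I_a * 'I_mesh.+1)%type].
have [r r0 hr] := nat_above (1 + a%:R * M%:R + 2 * mesh%:R + (hi - lo)).
have aM0 : 0 <= a%:R * M%:R :> R by rewrite mulr_ge0.
have mesh0 : 0 <= mesh%:R :> R by [].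
have hlr : hi - lo <= r%:R by move: hr aM0 mesh0 lo0 hi0; clear=> *; lra.
have hlo0 : 0 <= hi - lo by rewrite subr_ge0 (le_trans lo0).
have abs_hl u : lo <= u <= hi -> `|u| <= hi - lo.
  by move: lo0 hi0; clear=> *; rewrite ler_norml; lra.
have abs_dhl u v : lo <= u <= hi -> lo <= v <= hi -> `|u - v| <= hi - lo.
  by move: lo0 hi0; clear=> *; rewrite ler_norml; lra.
pose w1 := (#|H|.+1 * (a + #|O|).+1 * 2)%N.
exists r, (w1 + #|O| + (o * #|O|).*2 + o.*2)%N => G Gb GL.
pose pt (c : {ffun 'I_a -> 'I_M.+1}) : 'cV[R]_a := \col_i ((c i)%:R / M%:R).
have pt01 c : @unit_cube R a (pt c).
  by move=> i; rewrite mxE divr_ge0 //= ler_pdivrMr // mul1r ler_nat -ltnS.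
pose F (sc : O) (e : 'I_a -> R) := 1 - \sum_i pl mesh (level_dist P sc.1 (sc.2 i)) (e i).
have nF : net r%:R w1 0 F.
  have := @net1_card R 'I_a H O r%:R w1
    (fun k l => if k is Some ij then (l == ij.1)%:R else 0)
    (fun k => if k is Some ij then ij.2%:R / mesh%:R else -1)
    (fun sc k => if k is Some ij then - kink mesh (level_dist P sc.1 (sc.2 ij.1)) ij.2
                 else 1 - \sum_i level_dist P sc.1 (sc.2 i) 0).
  rewrite card_ord => /(_ _ _ _ (leqnn _)) N; apply: net_ext (N _ _ _).
  - move=> sc e; rewrite (bigD1 None) //= [X in relu (X - -1)]big1 => [|l _]; last by rewrite mul0r.
    rewrite add0r opprK.
    rewrite [relu 1]relu_ge0 // mulr1 /F -addrA; congr (_ + _).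
    rewrite /pl big_split /= opprD; congr (_ + _).
    rewrite (reindex_omap (@Some _) id) /=; last by case.
    rewrite -sumrN.
    under [RHS]eq_bigr do rewrite -sumrN.
    rewrite pair_big /=; apply: eq_big => [[i j]|[i j] _] /=; first by rewrite eqxx.
    by rewrite (sum_delta i) mulNr.
  - move=> [ij|] l; last by rewrite normr0.
    exact: normr_delta_le1.
  - move=> [[i j]|]; last by rewrite normrN normr1.
    by rewrite ger0_norm ?divr_ge0 //= ler_pdivrMr // mul1r ler_nat -ltnS.
  - move=> [s c] [[i j]|] /=; last first.
      apply: le_trans (ler_normB _ _) _; rewrite normr1.
      have : `|\sum_i level_dist P s (c i) 0| <= a%:R * M%:R :> R.
        apply: le_trans (ler_norm_sum _ _ _) _.
        rewrite -[a in leRHS]card_ord mulr_natl -sumr_const; apply: ler_sum => i _.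
        have cM : (c i)%:R <= M%:R :> R by rewrite ler_nat -ltnS.
        have lM : (level P s 0)%:R <= M%:R :> R by rewrite ler_nat level_le.
        have l0 : 0 <= (level P s 0)%:R :> R by [].
        have c0 : 0 <= (c i)%:R :> R by [].
        by rewrite /level_dist normr_id ler_norml; lra.
      by lra.
    rewrite normrN; apply: (@le_trans _ _ (2 * mesh%:R * 1)); last by lra.
    by apply: kink_le => n; exact: level_distS.
pose Z (j : 'I_o) (k : O * unit) := P%:R^-1 * G (pt k.1.2) j 0.
have nZ : (nnzf Z <= o * #|O|)%N.
  by have := nnzf_card Z; rewrite card_prod card_unit muln1 card_ord.
have rR : (0 : R) <= r%:R by [].
have := @net_relu R _ O _ r%:R w1 (w1 + #|O| + (o * #|O|).*2 + o.*2) 0 F unit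
  (fun=> false) (fun=> 0) Z rR nF.
rewrite !card_unit mul1n muln1 card_ord => N.
exists (fun j e => P%:R^-1 * \sum_(s < P) \sum_c G (pt c) j 0 * bump P s c e).
have s01 (e : 'I_a -> R) j (s : 'I_P) : lo <= \sum_c G (pt c) j 0 * bump P s c e <= hi.
  by apply: sum_bump01 lo0 hi0 (fun c => Gb _ j (pt01 c)) (sum_bump_le1 M0 P0 e (ltn_ord s)).
have P1 : P%:R^-1 <= 1 :> R by rewrite invf_le1 // ler1n.
split.
- apply: net_ext (N _ _ _ _ _ _ _).
  + move=> j e; rewrite (reindex (fun k : O => (k, tt))) /=; last first.
      by exists fst => // -[k []].
    rewrite pair_big /= mulr_sumr; apply: eq_bigr => -[s c] _ /=.
    by rewrite /Z /= expr0 mul1r subr0 /bump /F mulrA.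
  + by move=> k; rewrite normr0.
  + move=> j k; rewrite /Z normrM.
    apply: (@le_trans _ _ (1 * (hi - lo))); last by rewrite mul1r.
    apply: ler_pM => //; first by rewrite ger0_norm ?invr_ge0.
    exact: abs_hl (Gb _ j (pt01 k.1.2)).
  + by rewrite -!addnA leq_addr.
  + by rewrite -!addnA (leq_trans _ (leq_addr _ _)) // -[leqRHS]odd_double_half -addnn addnA leq_addl.
  + by rewrite -!addnA addnCA leq_addr.
  + by apply: (@leq_trans (o * #|O|).*2); [rewrite leq_double|rewrite addnAC leq_addl].
  + by rewrite leq_addl.
- move=> e j.
  rewrite mulrC ler_pdivrMr // ler_pdivlMr //; apply/andP; split.
    have -> : lo * P%:R = \sum_(s < P) lo by rewrite sumr_const card_ord mulr_natr.
    by apply: ler_sum => s _; have /andP[] := s01 e j s.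
  have -> : hi * P%:R = \sum_(s < P) hi by rewrite sumr_const card_ord mulr_natr.
  by apply: ler_sum => s _; have /andP[] := s01 e j s.
- move=> x j cx; set e : 'I_a -> R := fun i => x i 0.
  have /choice[k /choice[z kz]] : forall i, exists k z, [/\ (k < mesh)%N, 0 <= z <= 1,
      forall y, pl mesh y (e i) = (1 - z) * y k + z * y k.+1 & z = mesh%:R * e i - k%:R].
    move=> i; have [k [z [h1 h2 h3 h4]]] := pl_convex (e i) G0.
    by exists k, z; split=> //; apply: h4; exact: cx.
  pose good (s : 'I_P) := [forall i, (s != k i %% P :> nat)%N].
  have goodP (s : 'I_P) : good s ->
      `|\sum_c G (pt c) j 0 * bump P s c e - G x j 0| <= Lg / M%:R.
    move=> /forallP gs.
    have kM i : (k i < mesh)%N by have [] := kz i.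
    have plE i y : pl mesh y (e i) = (1 - z i) * y (k i) + z i * y (k i).+1.
      by have [_ _ ->] := kz i.
    pose c0 : {ffun 'I_a -> 'I_M.+1} := [ffun i => inord (level P s (k i))].
    have -> : \sum_c G (pt c) j 0 * bump P s c e = G (pt c0) j 0.
      rewrite (bigD1 c0) //= (bump_flat M0 P0 c0 (ltn_ord s) kM plE gs) eqxx mulr1.
      rewrite big1 ?addr0 // => c /negPf cc.
      by rewrite (bump_flat M0 P0 c (ltn_ord s) kM plE gs) cc mulr0.
    apply: le_trans (GL _ _ j (pt01 c0) cx) _; rewrite ler_wpM2l //.
    apply/mx_norm_le; rewrite ?invr_ge0 // => i l; rewrite !mxE (ord1 l) ffunE.
    rewrite inordK ?ltnS ?level_le ?(ltnW (kM i)) //.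
    have [_ z01 _ zE] := kz i.
    have [l1 l2] := level_bounds P0 (k i) (ltn_ord s).
    have {}l1 : (level P s (k i) * P + 1 <= k i + P)%N.
      by move: l1 P0; move: (_ * P)%N; clear; lia.
    have {}l2 : (k i + 1 <= level P s (k i) * P + P)%N by rewrite addn1 -mulSnr.
    rewrite -(ler_nat R) !natrD natrM in l1.
    rewrite -(ler_nat R) !natrD natrM in l2.
    move: z01; rewrite zE /e /mesh natrM => z01.
    set L := (level P s (k i))%:R in l1 l2 *.
    have -> : L / M%:R - x i 0 = (L - M%:R * x i 0) / M%:R by field; rewrite gt_eqF.
    rewrite normrM [`|M%:R^-1|]ger0_norm ?invr_ge0 // ler_piMl ?invr_ge0 //.
    exact: near_level PR z01 l1 l2.
  have badP (s : 'I_P) :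
      `|\sum_c G (pt c) j 0 * bump P s c e - G x j 0| <= hi - lo.
    exact: abs_dhl (s01 e j s) (Gb x j cx).
  have -> : P%:R^-1 * (\sum_(s < P) \sum_c G (pt c) j 0 * bump P s c e) - G x j 0
    = P%:R^-1 * \sum_(s < P) (\sum_c G (pt c) j 0 * bump P s c e - G x j 0).
    rewrite sumrB sumr_const card_ord mulrBr -[X in _ - _ * X]mulr_natl mulrA.
    by rewrite mulVf ?gt_eqF // mul1r.
  rewrite normrM [`|P%:R^-1|]ger0_norm ?invr_ge0 //.
  rewrite mulrC ler_pdivrMr //; apply: le_trans (ler_norm_sum _ _ _) _.
  rewrite (bigID good) /=.
  have hg : \sum_(s < P | good s) `|\sum_c G (pt c) j 0 * bump P s c e - G x j 0|
      <= Lg / M%:R * P%:R.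
    apply: (@le_trans _ _ (\sum_(s < P | good s) Lg / M%:R)); first by apply: ler_sum.
    rewrite sumr_const -[leLHS]mulr_natr ler_wpM2l ?divr_ge0 // ler_nat.
    by rewrite -[leqRHS](card_ord P) max_card.
  have hb : \sum_(s < P | ~~ good s) `|\sum_c G (pt c) j 0 * bump P s c e - G x j 0|
      <= (hi - lo) * a%:R.
    apply: (@le_trans _ _ (\sum_(s < P | ~~ good s) (hi - lo))); first by apply: ler_sum.
    rewrite sumr_const -[leLHS]mulr_natr ler_wpM2l ?subr_ge0 ?(le_trans lo0) // ler_nat.
    (* In the cell of coordinate [i] only the staircase with number [k i] modulo [P] climbs. *)
    pose bad (i : 'I_a) : 'I_P := Ordinal (ltn_pmod (k i) P0).
    apply: (@leq_trans #|[set bad i | i : 'I_a]|); last first.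
      by apply: leq_trans (leq_imset_card _ _) _; rewrite card_ord.
    apply: subset_leq_card; apply/fintype.subsetP => s.
    rewrite unfold_in negb_forall => /existsP[i /negPn/eqP si].
    by apply/imsetP; exists i => //; apply: val_inj.
  apply: le_trans (lerD hg hb) _.
  rewrite ler_pdivrMr // in hM; rewrite ler_pdivrMr // in hP.
  have h1 : Lg / M%:R <= delta / 2.
    by rewrite ler_pdivrMr //; move: hM; clear; lra.
  have h2 : (hi - lo) * a%:R <= delta / 2 * P%:R by move: hP; clear; lra.
  apply: le_trans (lerD (ler_wpM2r (ltW PR) h1) h2) _.
  by rewrite -mulrDl -splitr.
Qed.

End ShallowNet.

(** * Assembly *)

Section Members.
Context {R : realType}.

(** Copying reduces the weights from [r] to [1] and multiplies the budget by [r * r]. Size and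
    Lipschitz constant are required on the whole space, accuracy on the cube. *)
Lemma encdec_inf_le (m o dt L L1 w he hd r s : nat) (p : nat -> nat)
    (F Lip eps : R) (f0 : 'cV[R]_m -> 'cV[R]_o)
    (E : 'I_dt -> ('I_m -> R) -> R) (G : 'I_o -> ('I_dt -> R) -> R)
    (f := fun x j => G j (fun l => relu (E l (fun i : 'I_m => x i 0)))) :
  (0 < r)%N -> net r%:R w he E -> net r%:R w hd G ->
  (he.+1 < L1)%N -> (L1 + hd.+1 <= L)%N -> p L1 = dt ->
  (forall i, (1 <= i <= L)%N -> i <> L1 -> (r * r * w <= p i)%N) ->
  ((he + hd + 4) * (r * r * w).*2 + L * dt.*2 <= s)%N ->
  0 <= F -> 0 <= Lip -> 0 <= eps ->
  (forall (x : 'cV[R]_m) j, `|f x j| <= F) ->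
  (forall (x x' : 'cV[R]_m) j, `|f x j - f x' j| <= Lip * `|x - x'|) ->
  (forall (x : 'cV[R]_m) j, @unit_cube R m x -> `|f x j - f0 x j 0| <= eps) ->
  (ereal_inf [set supnorm (@unit_cube R m) (fun x => (g x - f0 x)%R) ^+ 2
             | g in @encdec_networks R m o dt L L1 p s F Lip] <= (eps ^+ 2)%:E)%E.
Proof.
move=> r0 nE nG heL hdL pL wp ws F0 Lip0 eps0 fF fL fe.
have rR : 0 <= r%:R :> R by [].
have [wn [wnE wb wsp]] := network_of_nets
  (net_copies rR r0 (lexx _) nE) (net_copies rR r0 (lexx _) nG) heL hdL pL wp.
have in_class : @encdec_networks R m o dt L L1 p s F Lip (realize wn).
  split=> //; split; [|split].
  - by exists wn; split=> //; apply: leq_trans ws.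
  - apply: ge_ereal_sup => _ [x _ <-]; rewrite lee_fin.
    by apply/mx_norm_le => // j l; rewrite (ord1 l) wnE; exact: fF.
  - apply: ge_ereal_sup => _ [x [y [xy ->]]]; rewrite lee_fin.
    have xy0 : 0 < `|x - y| by rewrite normr_gt0 subr_eq0; apply/eqP.
    rewrite ler_pdivrMr //; apply/mx_norm_le; first by rewrite mulr_ge0.
    move=> j l; rewrite (ord1 l).
    have -> : (realize wn x - realize wn y) j 0 = f x j - f y j.
      by rewrite [LHS]mxE [X in _ + X]mxE !wnE.
    exact: fL.
apply: le_trans (_ : (supnorm (@unit_cube R m) (fun x => (realize wn x - f0 x)%R) ^+ 2 <= _)%E).
  by apply: ereal_inf_lbound; exists (realize wn).
have sup_le : (supnorm (@unit_cube R m) (fun x => (realize wn x - f0 x)%R) <= eps%:E)%E.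
  apply: ge_ereal_sup => _ [x cx <-]; rewrite lee_fin.
  apply/mx_norm_le => // j l; rewrite (ord1 l).
  have -> : (realize wn x - f0 x) j 0 = f x j - f0 x j 0 by rewrite [LHS]mxE [X in _ + X]mxE wnE.
  exact: fe.
have sup_ge : (0 <= supnorm (@unit_cube R m) (fun x => (realize wn x - f0 x)%R))%E.
  have c0 : @unit_cube R m 0 by move=> i; rewrite mxE lexx ler01.
  by apply: le_trans (supnorm_ge (fun x => realize wn x - f0 x) c0); rewrite lee_fin.
have -> : (eps ^+ 2)%:E = (eps%:E ^+ 2)%E by rewrite EFin_expe.
by rewrite !expe2 lee_pmul.
Qed.

(** The projection to [[0, 1]]. Put before a stage, it turns bounds on the cube into bounds on the
    whole space and does not increase errors or Lipschitz constants. *)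
Definition clip (x : R) : R := relu x - relu (x - 1).

Lemma clip01 x : 0 <= clip x <= 1.
Proof.
rewrite /clip /relu; case: (lerP x 0) => h1; case: (lerP (x - 1) 0) => h2; lra.
Qed.

Lemma clip_id x : 0 <= x <= 1 -> clip x = x.
Proof.
by move=> /andP[x0 x1]; rewrite /clip relu_ge0 // relu_le0 ?subr0 ?subr_le0.
Qed.

(** The ReLU at the bottleneck is invisible to a decoder that starts with a clip. *)
Lemma clip_relu x : clip (relu x) = clip x.
Proof.
rewrite /clip; have [x0|x0] := leP 0 x; first by rewrite !(relu_ge0 x0).
by rewrite !(relu_le0 (ltW x0)) !relu_le0 //; lra.
Qed.

Lemma clip_lip x y : `|clip x - clip y| <= `|x - y|.
Proof.
wlog xy : x y / x <= y => [H|].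
  by have [/H //|/ltW /H] := leP x y; rewrite distrC [`|y - x|]distrC.
have [m0 m1] : clip x <= clip y /\ clip y - clip x <= y - x; last first.
  by rewrite distrC [`|x - y|]distrC !ger0_norm ?subr_ge0.
by rewrite /clip /relu; case: (lerP x 0) => h1; case: (lerP (x - 1) 0) => h2; case: (lerP y 0) => h3; case: (lerP (y - 1) 0) => h4; lra.
Qed.

Lemma clip_net (a : nat) (b : R) w : 1 <= b ->
  ((2 * a).+1 * (2 * a).+1 * 2 <= w)%N ->
  net b w 0 (fun (j : 'I_a) (e : 'I_a -> R) => clip (e j)).
Proof.
move=> b1 wa.
have := @net1_card R 'I_a [the finType of ('I_a * bool)%type] 'I_a b w
  (fun k l => (l == k.1)%:R) (fun k => (k.2)%:R)
  (fun j k => (-1) ^+ k.2 * (k.1 == j)%:R).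
rewrite card_prod card_bool !card_ord => N; apply: net_ext (N _ _ _ _).
- move=> j e.
  rewrite -(pair_big xpredT xpredT (fun k (t : bool) => (-1) ^+ t * (k == j)%:R * relu (\sum_l (l == k)%:R * e l - t%:R))) /=.
  rewrite (bigD1 j) //= [X in _ + X]big1 ?addr0.
    by rewrite big_bool /= (sum_delta j) eqxx /clip (subr0 (e j)) !mulr1; ring.
  by move=> k /negPf kj; rewrite big_bool /= kj !mulr0 !mul0r addr0.
- by move=> k l; exact: normr_delta_le1.
- by move=> k; exact: normr_delta_le1.
- by move=> j k; rewrite normrM normr_sign mul1r (le_trans (normr_delta_le1 _)).
- by apply: leq_trans wa; rewrite addnn -mul2n [(a * 2)%N]mulnC.
Qed.

(** Only the readout is scaled, so no layer is added. *)
Lemma net_scale (I O : finType) (b c : R) w h (F : O -> (I -> R) -> R) :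
  0 <= c <= 1 -> net b w h F -> net b w h (fun o e => c * F o e).
Proof.
move=> /andP[c0 c1] [Ow [H [u [hu [Z [FZ Zb nZ]]]]]]; split=> //.
exists H, u; split=> //; exists (fun o i => c * Z o i); split.
- by move=> o x; rewrite FZ mulr_sumr; apply: eq_bigr => i _; rewrite mulrA.
- by move=> o i; rewrite normrM ger0_norm // -[leRHS]mul1r ler_pM.
- apply: leq_trans nZ; apply: leq_nnzf => o i; rewrite mulf_eq0 negb_or.
  by case/andP.
Qed.

Lemma vholder_net (t : nat) (b : R) : (0 < t)%N -> 1 <= b ->
  exists Q0 : nat, forall (a o : nat) (K : R), (0 < a)%N -> 1 <= K ->
  exists2 A : R, 0 <= A & forall (delta : R) (Q : nat), 0 < delta ->
  exists r W : nat, forall (G : 'cV[R]_a -> 'cV[R]_o) (n N m : nat),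
    vholder_ball (@unit_cube R a) b K G -> depends_on_at_most G t ->
    (1 <= N <= n)%N -> (0 < m)%N -> (n <= 2 ^ (2 * Q * m))%N ->
    exists g : 'I_o -> ('I_a -> R) -> R,
      [/\ net r%:R (W * N) (Q0 * m.+1) g,
          forall x j, @unit_cube R a x ->
            `|g j (fun i => x i 0) - G x j 0|
              <= delta * (N%:R `^ (- (b / t%:R)) + n%:R^-1) &
          forall x x' j, @unit_cube R a x -> @unit_cube R a x' ->
            `|g j (fun i => x i 0) - g j (fun i => x' i 0)| <= A * `|x - x'|].
Proof.
move=> t0 b1; have [Q0 HQ0] := holder_net t0 b1; exists Q0 => a o K a0 K1.
have [A A0 HA] := HQ0 a K a0 K1; exists A => // delta Q d0.
have [r [W H]] := HA delta Q d0; exists r, (o * W)%N => G n N m hG dG Nn m0 nm.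
have /choice[g gP] : forall j : 'I_o, exists g : ('I_a -> R) -> R,
      [/\ snet r%:R (W * N) (Q0 * m.+1) g,
          forall x, @unit_cube R a x ->
            `|g (fun i => x i 0) - G x j 0|
              <= delta * (N%:R `^ (- (b / t%:R)) + n%:R^-1) &
          forall x x', @unit_cube R a x -> @unit_cube R a x' ->
            `|g (fun i => x i 0) - g (fun i => x' i 0)| <= A * `|x - x'|].
  by move=> j; have [S [St dS]] := dG j; apply: (H (fun x => G x j 0) S n N m).
exists g; split.
- have ng j : snet r%:R (W * N) (Q0 * m.+1) (g j) by have [] := gP j.
  by have := net_par (ler0n R r) ng; rewrite card_ord mulnA.
- by move=> x j; have [_ h _] := gP j; exact: h.
- by move=> x x' j; have [_ _ h] := gP j; exact: h.
Qed.

Lemma holder_ball_le (a : nat) (b K : R) (f : 'cV[R]_a -> R) : (0 < a)%N ->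
  1 <= b -> holder_ball (@unit_cube R a) b K f ->
  forall x, @unit_cube R a x -> `|f x| <= K.
Proof.
move=> a0 b1 hf x cx.
have [D D0 [_ hD _]] := holder_ball_data a0 (lt_le_trans ltr01 b1) hf.
by rewrite -D0 //; apply: hD; rewrite // /mdeg big1 // => i _; rewrite ffunE.
Qed.

End Members.

(** * Encoder and decoder nets for large and for small sample sizes *)

Section Deep.
Context {R : realType}.

Definition clipv (a : nat) (e : 'I_a -> R) : 'cV[R]_a := \col_i clip (e i).

Lemma clipv_cube (a : nat) (e : 'I_a -> R) : @unit_cube R a (clipv e).
Proof. by move=> i; rewrite mxE clip01. Qed.

Lemma clipv_dist (a : nat) (e : 'I_a -> R) (x : 'cV[R]_a) (c : R) : 0 <= c ->
  @unit_cube R a x -> (forall i, `|e i - x i 0| <= c) -> `|clipv e - x| <= c.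
Proof.
move=> c0 cx h; apply/mx_norm_le => // i l; rewrite (ord1 l) !mxE.
by rewrite -[x i 0]clip_id //; apply: le_trans (clip_lip _ _) (h i).
Qed.

Lemma clipv_lip (a : nat) (e e' : 'I_a -> R) (c : R) : 0 <= c ->
  (forall i, `|e i - e' i| <= c) -> `|clipv e - clipv e'| <= c.
Proof.
move=> c0 h; apply/mx_norm_le => // i l; rewrite (ord1 l) !mxE.
by apply: le_trans (clip_lip _ _) (h i).
Qed.

Lemma clipv_id (a : nat) (x : 'cV[R]_a) : @unit_cube R a x ->
  clipv (fun i => x i 0) = x.
Proof. by move=> cx; apply/colP => i; rewrite mxE clip_id. Qed.

Lemma clipvE (a : nat) (e : 'I_a -> R) :
  (fun i => clip (e i)) = (fun i => clipv e i 0).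
Proof. by apply/funext => i; rewrite mxE. Qed.

Lemma entry_le (a : nat) (x y : 'cV[R]_a) i : `|x i 0 - y i 0| <= `|x - y|.
Proof.
have /(_ i 0) := (mx_norm_le (x - y) (normr_ge0 _)).1 (lexx _).
by rewrite !mxE.
Qed.

(** [Q] exceeds the sum of the three depth factors by enough to cover clipping and composition. As
    [m.+1 <= 2 * m], encoder and decoder fit into [4 * (Q * m)] and [2 * (Q * m)] layers, the
    proportions guaranteed by the depth hypotheses. *)
Lemma deep_nets (d dt tdec tenc0 tenc1 : nat) (bdec benc0 benc1 : R) :
  (0 < dt)%N -> (0 < tdec)%N -> (0 < tenc0)%N -> (0 < tenc1)%N ->
  1 <= bdec -> 1 <= benc0 -> 1 <= benc1 ->
  exists2 Q : nat, (0 < Q)%N & forall (a D : nat) (K : R),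
    (0 < a)%N -> (0 < D)%N -> 1 <= K ->
  exists (r W : nat) (A : R), [/\ (0 < r)%N, 0 <= A &
  forall (genc0 : 'cV[R]_a -> 'cV[R]_D) (genc1 : 'cV[R]_D -> 'cV[R]_dt)
    (fdec : 'cV[R]_dt -> 'cV[R]_d) (n N m : nat),
    depends_on_at_most genc0 tenc0 -> depends_on_at_most genc1 tenc1 ->
    depends_on_at_most fdec tdec ->
    vholder_ball (@unit_cube R a) benc0 K genc0 ->
    (forall x, @unit_cube R a x -> @unit_cube R D (genc0 x)) ->
    vholder_ball (@unit_cube R D) benc1 K genc1 ->
    (forall x, @unit_cube R D x -> @unit_cube R dt (genc1 x)) ->
    vholder_ball (@unit_cube R dt) bdec K fdec ->
    (1 <= N <= n)%N -> (0 < m)%N -> (n <= 2 ^ (2 * Q * m))%N ->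
  exists (he hd : nat) (E : 'I_dt -> ('I_a -> R) -> R) (G : 'I_d -> ('I_dt -> R) -> R),
    let f (x : 'cV[R]_a) j := G j (fun l => relu (E l (fun i => x i 0))) in
    [/\ net r%:R (W * N) he E, net r%:R (W * N) hd G &
        [/\ he.+1 < 4 * (Q * m), hd.+1 <= 2 * (Q * m) & he + hd + 4 <= 6 * (Q * m)]%N] /\
    [/\ forall x j, `|f x j| <= K,
        forall x x' j, `|f x j - f x' j| <= A * `|x - x'| &
        forall rho, n%:R^-1 <= rho -> N%:R `^ (- (benc0 / tenc0%:R)) <= rho ->
          N%:R `^ (- (benc1 / tenc1%:R)) <= rho -> N%:R `^ (- (bdec / tdec%:R)) <= rho ->
          forall x j, @unit_cube R a x ->
            `|f x j - fdec (genc1 (genc0 x)) j 0| <= rho]].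
Proof.
move=> dt0 td0 t00 t10 bd1 b01 b11.
have [Qd Hd] := vholder_net td0 bd1.
have [Q0 H0] := vholder_net t00 b01.
have [Q1 H1] := vholder_net t10 b11.
pose Q := (Q0 + Q1 + Qd + 8)%N; exists Q => [|a D K a0 D0 K1].
  by rewrite /Q addn_gt0 orbT.
have [A0 A00 {}H0] := H0 a D K a0 K1.
have [A1 A10 {}H1] := H1 D dt K D0 K1.
have [Ad Ad0 {}Hd] := Hd dt d K dt0 K1.
(* Each stage errs by at most [ep = 2 * delta * rho], and shrinking the decoder by [kap] costs
   another [ep]. Amplified by the later Lipschitz constants, the total is
   [ep * (2 + Ad * (A1 + 1))], which this choice keeps below [rho]. *)
pose delta : R := (12 * (Ad + 1) * (A1 + 1))^-1.
have den0 : 0 < 12 * (Ad + 1) * (A1 + 1) by rewrite !mulr_gt0 // ltr_wpDl.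
have delta0 : 0 < delta by rewrite invr_gt0.
have dE : delta * (12 * (Ad + 1) * (A1 + 1)) = 1 by rewrite mulVf // gt_eqF.
have [r0 [W0 {}H0]] := H0 delta Q delta0.
have [r1 [W1 {}H1]] := H1 delta Q delta0.
have [rd [Wd {}Hd]] := Hd delta Q delta0.
pose sq (x : nat) := ((2 * x).+1 * (2 * x).+1 * 2)%N.
pose r := (r0 + r1 + rd + 1)%N.
pose W := (W0 + W1 + Wd + sq a + sq D + sq dt)%N.
exists r, W, (Ad * A1 * A0); split; [by rewrite /r addn1|by rewrite !mulr_ge0|].
move=> genc0 genc1 fdec n N m dep0 dep1 depd h0 c0 h1 c1 hd_ /andP[N1 Nn] m0 nm.
have Nn' : (1 <= N <= n)%N by rewrite N1.
have [g0 [n0 e0 l0]] := H0 genc0 n N m h0 dep0 Nn' m0 nm.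
have [g1 [n1 e1 l1]] := H1 genc1 n N m h1 dep1 Nn' m0 nm.
have [gd [nd ed ld]] := Hd fdec n N m hd_ depd Nn' m0 nm.
have K0 : 0 < K by exact: lt_le_trans K1.
pose eta := delta * (N%:R `^ (- (bdec / tdec%:R)) + n%:R^-1).
have eta0 : 0 <= eta by rewrite mulr_ge0 ?addr_ge0 ?powR_ge0 ?invr_ge0 // ltW.
(* The decoder net is bounded by [K + eta] only, while [F] may equal [K]. Shrinking restores the
   bound [K] and changes the values by at most [eta]. *)
pose kap := K / (K + eta).
have Keta : 0 < K + eta by rewrite ltr_wpDr.
have kap01 : 0 <= kap <= 1.
  by rewrite /kap divr_ge0 ?(ltW K0) ?(ltW Keta) //= ler_pdivrMr // mul1r lerDl.
have kapE : kap * (K + eta) = K by rewrite /kap mulfVK // gt_eqF.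
have r_ge x : (x <= r)%N -> x%:R <= r%:R :> R by rewrite ler_nat.
have rr0 : r0%:R <= r%:R :> R by apply: r_ge; rewrite /r -!addnA leq_addr.
have rr1 : r1%:R <= r%:R :> R by apply: r_ge; rewrite /r addnAC -!addnA addnC -!addnA leq_addr.
have rrd : rd%:R <= r%:R :> R by apply: r_ge; rewrite /r -addnA addnCA leq_addr.
have rr : 1 <= r%:R :> R by rewrite ler1n /r addn1.
have WN x : (x <= W)%N -> (x * N <= W * N)%N by move=> h; rewrite leq_mul2r h orbT.
have WN1 x : (x <= W)%N -> (x <= W * N)%N by move=> h; apply: leq_trans h _; rewrite leq_pmulr.
have [w0 w1 wd] : [/\ W0 <= W, W1 <= W & Wd <= W]%N by rewrite /W; clear; split; lia.
have [wa wD wt] : [/\ sq a <= W, sq D <= W & sq dt <= W]%N by rewrite /W; clear; split; lia.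
have {}n0 := net_mono (ler0n _ _) rr0 (WN _ w0) n0.
have {}n1 := net_mono (ler0n _ _) rr1 (WN _ w1) n1.
have {}nd := net_mono (ler0n _ _) rrd (WN _ wd) nd.
have ca := clip_net rr (WN1 _ wa); have cD := clip_net rr (WN1 _ wD).
have ct := clip_net rr (WN1 _ wt).
pose E l e := g1 l (fun k => clip (g0 k (fun i => clip (e i)))).
pose G j e := kap * gd j (fun l => clip (e l)).
have nE := net_comp rr (net_comp rr (net_comp rr ca n0) cD) n1.
have nG := net_scale kap01 (net_comp rr ct nd).
exists (((0 + Q0 * m.+1).+2 + 0).+2 + Q1 * m.+1).+2, (0 + Qd * m.+1).+2, E, G => f.
pose u0 (x : 'cV[R]_a) := clipv (fun i => x i 0).
pose y0 x := clipv (fun k => g0 k (fun i => u0 x i 0)).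
pose y1 x := clipv (fun k => g1 k (fun i => y0 x i 0)).
have fE x j : f x j = kap * gd j (fun l => y1 x l 0).
  rewrite /f /G; congr (_ * gd j _); apply/funext => l.
  by rewrite clip_relu /E /y1 mxE clipvE clipvE.
split.
  split=> //; split; rewrite /Q; move: m0; clear; nia.
have cy1 x : @unit_cube R dt (y1 x) by exact: clipv_cube.
have cy0 x : @unit_cube R D (y0 x) by exact: clipv_cube.
have cu0 x : @unit_cube R a (u0 x) by exact: clipv_cube.
have fK x j : @unit_cube R dt x -> `|fdec x j 0| <= K.
  by move=> cx; exact: (holder_ball_le dt0 bd1 (hd_ j) cx).
have gK x j : @unit_cube R dt x -> `|gd j (fun l => x l 0)| <= K + eta.
  move=> cx; rewrite -[gd _ _](subrK (fdec x j 0)) addrC.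
  by apply: le_trans (ler_normD _ _) _; rewrite lerD ?fK ?ed.
split.
- move=> x j; rewrite fE normrM ger0_norm; last by case/andP: kap01.
  by rewrite -kapE ler_wpM2l ?gK //; case/andP: kap01.
- move=> x x' j; rewrite !fE -mulrBr normrM ger0_norm; last by case/andP: kap01.
  have d0 : `|u0 x - u0 x'| <= `|x - x'|.
    by apply: clipv_lip => // i; exact: entry_le.
  have d1 : `|y0 x - y0 x'| <= A0 * `|x - x'|.
    apply: clipv_lip => [|k]; first by rewrite mulr_ge0.
    by apply: le_trans (l0 _ _ k (cu0 x) (cu0 x')) _; rewrite ler_wpM2l.
  have d2 : `|y1 x - y1 x'| <= A1 * (A0 * `|x - x'|).
    apply: clipv_lip => [|k]; first by rewrite !mulr_ge0.
    by apply: le_trans (l1 _ _ k (cy0 x) (cy0 x')) _; rewrite ler_wpM2l.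
  have /andP[k0 k1] := kap01.
  rewrite -[leRHS]mul1r; apply: ler_pM => //.
  apply: le_trans (ld _ _ j (cy1 x) (cy1 x')) _.
  by rewrite -!mulrA ler_wpM2l.
- move=> rho hn hr0 hr1 hrd x j cx.
  have dist_le (b t : R) : N%:R `^ (- (b / t)) <= rho ->
      delta * (N%:R `^ (- (b / t)) + n%:R^-1) <= 2 * delta * rho.
    move=> h; rewrite [2 * _]mulrC -mulrA ler_wpM2l ?(ltW delta0) //.
    by rewrite mulr_natl mulr2n lerD.
  have rho0 : 0 <= rho by apply: le_trans hn; rewrite invr_ge0.
  pose ep := 2 * delta * rho.
  have ep0 : 0 <= ep by rewrite !mulr_ge0 // ltW.
  have d1 : `|y0 x - genc0 x| <= ep.
    apply: clipv_dist => // [|k]; first exact: c0.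
    rewrite /u0 clipv_id //; apply: le_trans (e0 x k cx) _; exact: dist_le.
  have d2 : `|y1 x - genc1 (genc0 x)| <= A1 * ep + ep.
    apply: clipv_dist => [||k]; [by rewrite addr_ge0 // mulr_ge0|exact/c1/c0|].
    set v := g1 k _; rewrite -[v](subrK (g1 k (fun i => genc0 x i 0))) -addrA.
    apply: le_trans (ler_normD _ _) _; apply: lerD.
      by apply: le_trans (l1 _ _ k (cy0 x) (c0 _ cx)) _; rewrite ler_wpM2l.
    by apply: le_trans (e1 _ k (c0 _ cx)) _; exact: dist_le.
  have d3 : `|gd j (fun l => y1 x l 0) - fdec (genc1 (genc0 x)) j 0|
      <= Ad * (A1 * ep + ep) + ep.
    set v := gd j _; rewrite -[v](subrK (gd j (fun i => genc1 (genc0 x) i 0))) -addrA.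
    apply: le_trans (ler_normD _ _) _; apply: lerD.
      by apply: le_trans (ld _ _ j (cy1 x) (c1 _ (c0 _ cx))) _; rewrite ler_wpM2l.
    by apply: le_trans (ed _ j (c1 _ (c0 _ cx))) _; exact: dist_le.
  have d4 : `|kap * gd j (fun l => y1 x l 0) - gd j (fun l => y1 x l 0)| <= ep.
    apply: le_trans (_ : eta <= _); last exact: dist_le.
    have -> : kap * gd j (fun l => y1 x l 0) - gd j (fun l => y1 x l 0)
      = - ((1 - kap) * gd j (fun l => y1 x l 0)) by ring.
    rewrite normrN normrM ger0_norm ?subr_ge0; last by case/andP: kap01.
    apply: le_trans (_ : (1 - kap) * (K + eta) <= _).
      by rewrite ler_wpM2l ?gK // subr_ge0; case/andP: kap01.
    by rewrite mulrBl kapE mul1r addrAC subrr add0r.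
  rewrite fE -[_ * gd j _](subrK (gd j (fun l => y1 x l 0))) -addrA.
  apply: le_trans (ler_normD _ _) _; apply: le_trans (lerD d4 d3) _.
  have -> : ep + (Ad * (A1 * ep + ep) + ep) = 2 * delta * (2 + Ad * (A1 + 1)) * rho.
    by rewrite /ep; ring.
  rewrite -[leRHS]mul1r ler_wpM2r //.
  apply: (@le_trans _ _ (delta * (12 * (Ad + 1) * (A1 + 1)))); last by rewrite dE.
  rewrite [2 * delta]mulrC -[leLHS]mulrA ler_wpM2l ?(ltW delta0) //.
  by move: Ad0 A10; clear; nra.
Qed.

(** Encoder and decoder are approximated as two lookups. The depth is fixed, so [net_lip] gives an
    admissible Lipschitz constant; the range bounds hold globally, so neither clipping nor shrinking
    is needed, and encoder values in [[0, 1]] pass ReLU unchanged. *)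
Lemma shallow_nets (d dt a D q : nat) (K bdec benc0 benc1 : R) :
  (0 < dt)%N -> (0 < a)%N -> (0 < D)%N -> 1 <= K ->
  1 <= bdec -> 1 <= benc0 -> 1 <= benc1 ->
  exists (r W : nat) (A : R), [/\ (0 < r)%N, 0 <= A &
  forall (genc0 : 'cV[R]_a -> 'cV[R]_D) (genc1 : 'cV[R]_D -> 'cV[R]_dt)
    (fdec : 'cV[R]_dt -> 'cV[R]_d),
    vholder_ball (@unit_cube R a) benc0 K genc0 ->
    (forall x, @unit_cube R a x -> @unit_cube R D (genc0 x)) ->
    vholder_ball (@unit_cube R D) benc1 K genc1 ->
    (forall x, @unit_cube R D x -> @unit_cube R dt (genc1 x)) ->
    vholder_ball (@unit_cube R dt) bdec K fdec ->
  exists (E : 'I_dt -> ('I_a -> R) -> R) (G : 'I_d -> ('I_dt -> R) -> R),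
    let f (x : 'cV[R]_a) j := G j (fun l => relu (E l (fun i => x i 0))) in
    [/\ net r%:R W 1 E, net r%:R W 1 G,
        forall x j, `|f x j| <= K,
        forall x x' j, `|f x j - f x' j| <= A * `|x - x'| &
        forall x j, @unit_cube R a x ->
            `|f x j - fdec (genc1 (genc0 x)) j 0| <= 2^-1 ^+ q]].
Proof.
move=> dt0 a0 D0 K1 bd1 b01 b11.
have K0 : 0 <= K by exact: le_trans K1.
pose lip b n := 2 * (err_const b K n + lip_const b K n).
have lip0 b n : 0 <= lip b n.
  rewrite mulr_ge0 // addr_ge0 ?err_const_ge0 //.
  by have /andP[] := lip_const_mono b K0 (leqnn n).
pose Ld := lip bdec dt; pose Le := lip benc1 D * lip benc0 a.
have Le0 : 0 <= Le by rewrite mulr_ge0.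
have q0 : 0 < (2^-1 : R) ^+ q by rewrite exprn_gt0 // invr_gt0.
(* The encoder error is amplified by [Ld]; the total [(Ld + 1) * tol] is half of the target. *)
pose tol : R := 2^-1 ^+ q / (2 * (Ld + 1)).
have Ld1 : 0 < Ld + 1 by rewrite ltr_wpDl // lip0.
have tol0 : 0 < tol by rewrite divr_gt0 // mulr_gt0.
have [re [We He]] := @shallow_net R a dt 0 1 Le tol (lexx _) ler01 Le0 tol0.
have [rd [Wd Hd]] := @shallow_net R dt d (- K) K Ld tol ltac:(by rewrite oppr_le0) K0 (lip0 _ _) tol0.
pose r := (re + rd + 1)%N; pose W := (We + Wd)%N.
have rr0 : 0 <= r%:R :> R by [].
pose A := dt%:R * (W%:R * r%:R) ^+ 2 * (a%:R * (W%:R * r%:R) ^+ 2) : R.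
exists r, W, A; split; [by rewrite /r addn1|by rewrite !mulr_ge0 // exprn_ge0 // mulr_ge0|].
move=> genc0 genc1 fdec h0 c0 h1 c1 hd.
have [|x x' j cx cx'|E [nE E01 Ee]] := He (fun x => genc1 (genc0 x)).
- by move=> x j cx; exact: (c1 _ (c0 _ cx) j).
- apply: le_trans (holder_lipschitz D0 b11 K0 (h1 j) (c0 _ cx) (c0 _ cx')) _.
  have -> : Le * `|x - x'| = lip benc1 D * (lip benc0 a * `|x - x'|) by rewrite /Le mulrA.
  apply: (ler_wpM2l (lip0 _ _)); apply/mx_norm_le; first by rewrite mulr_ge0 ?lip0.
  move=> i l; rewrite (ord1 l) !mxE.
  exact: (holder_lipschitz a0 b01 K0 (h0 i) cx cx').
have [|x x' j cx cx'|G [nG GK Ge]] := Hd fdec.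
- by move=> x j cx; have := holder_ball_le dt0 bd1 (hd j) cx; rewrite ler_norml.
- exact: (holder_lipschitz dt0 bd1 K0 (hd j) cx cx').
have {}nE : net r%:R W 1 E.
  by apply: net_mono nE; rewrite ?leq_addr // ler_nat /r -addnA leq_addr.
have {}nG : net r%:R W 1 G.
  by apply: net_mono nG; rewrite ?leq_addl // ler_nat /r addnAC leq_addl.
exists E, G => f; split=> //.
- by move=> x j; rewrite ler_norml GK.
- move=> x x' j; have := net_lip rr0 nG; rewrite card_ord => lG.
  have := net_lip rr0 nE; rewrite card_ord => lE.
  rewrite /A -[X in X <= _]/(`|G j _ - G j _|) -mulrA.
  apply: lG => l; apply: le_trans (relu_lip _ _) _.
  by apply: lE => i; exact: entry_le.
- move=> x j cx; pose y : 'cV[R]_dt := \col_l E l (fun i => x i 0).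
  have cy : @unit_cube R dt y by move=> l; rewrite mxE.
  have -> : f x j = G j (fun l => y l 0).
    by rewrite /f; congr (G j _); apply/funext => l; rewrite mxE relu_ge0 //;
      have /andP[] := E01 (fun i => x i 0) l.
  rewrite -[G j _](subrK (fdec y j 0)) -addrA.
  apply: le_trans (ler_normD _ _) _; apply: le_trans (lerD (Ge y j cy) (_ : _ <= lip bdec dt * tol)) _.
    apply: le_trans (holder_lipschitz dt0 bd1 K0 (hd j) cy (c1 _ (c0 _ cx))) _.
    apply: (ler_wpM2l (lip0 _ _)); apply/mx_norm_le; first exact: ltW.
    by move=> l i; rewrite (ord1 i) !mxE; exact: (Ee x l cx).
  have -> : tol + lip bdec dt * tol = (Ld + 1) * tol by rewrite /Ld; ring.
  have -> : (Ld + 1) * tol = 2^-1 ^+ q / 2.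
    by rewrite /tol; move: (2^-1 ^+ q) => h; field; rewrite gt_eqF.
  by move: q0; clear; lra.
Qed.

End Deep.

(** * Logarithms and the square root of the rate *)

Section Logarithm.
Context {R : realType}.

Lemma ln2_gt0 : 0 < ln 2 :> R.
Proof. by apply: ln_gt0; rewrite ltr1n. Qed.

Lemma log2_ge (k : nat) (x : R) : 2 ^+ k <= x -> k%:R <= log2 x.
Proof.
move=> kx; rewrite /log2 ler_pdivlMr ?ln2_gt0 //.
have k0 : 0 < 2 ^+ k :> R by rewrite exprn_gt0.
have -> : k%:R * ln 2 = ln (2 ^+ k) :> R by rewrite lnXn // mulr_natl.
by rewrite ler_ln // posrE // (lt_le_trans k0).
Qed.

Lemma powR_neg_le (N t : nat) (b rho2 : R) : 0 <= rho2 ->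
  N%:R `^ (- (2 * b / t%:R)) <= rho2 -> N%:R `^ (- (b / t%:R)) <= Num.sqrt rho2.
Proof.
move=> r0 h; rewrite -(ler_pXn2r (n := 2)) ?nnegrE ?powR_ge0 ?sqrtr_ge0 //.
rewrite sqr_sqrtr //; apply: le_trans h.
rewrite -powR_mulrn ?powR_ge0 // -powRrM.
have -> : - (b / t%:R) * 2%:R = - (2 * b / t%:R) by ring.
by [].
Qed.

End Logarithm.

Theorem theorem8p1 (R : realType) (d dt tdec tenc0 tenc1 : nat)
    (bdec benc0 benc1 : R)
    (hdt : (1 <= dt <= d)%N) (htdec : (1 <= tdec <= dt)%N)
    (htenc0 : (1 <= tenc0)%N) (htenc1 : (1 <= tenc1)%N)
    (hbdec : 1 <= bdec) (hbenc0 : 1 <= benc0) (hbenc1 : 1 <= benc1) :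
  exists C : R, 0 < C /\
  forall (r D : nat) (K : R),
    (1 <= r)%N -> (1 <= D)%N -> (tenc0 <= r * d)%N -> (tenc1 <= D)%N ->
    1 <= K ->
  exists c : R, 0 < c /\
  forall (dT : measure_display) (T : measurableType dT) (P : probability T R)
    (X eps : nat -> {RV P >-> d.-tuple R})
    (f0 : 'cV[R]_(r * d) -> 'cV[R]_d)
    (genc0 : 'cV[R]_(r * d) -> 'cV[R]_D)
    (genc1 : 'cV[R]_D -> 'cV[R]_dt)
    (fdec : 'cV[R]_dt -> 'cV[R]_d)
    (n N L L1 : nat) (p : nat -> nat) (s : nat) (F Lip : R),
    (* the time series *)
    (r < n)%N -> iid eps ->
    (forall i, (r.+1 <= i <= n)%N -> forall w : T,
       tvec (X i w) = f0 (lags r (fun j => X j w) i) + tvec (eps i w)) ->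
    (* encoder-decoder structure *)
    (forall x, f0 x = fdec (genc1 (genc0 x))) ->
    depends_on_at_most genc0 tenc0 ->
    depends_on_at_most genc1 tenc1 ->
    depends_on_at_most fdec tdec ->
    (* smoothness *)
    vholder_ball (@unit_cube R (r * d)) benc0 K genc0 ->
    (forall x, @unit_cube R (r * d) x -> @unit_cube R D (genc0 x)) ->
    vholder_ball (@unit_cube R D) benc1 K genc1 ->
    (forall x, @unit_cube R D x -> @unit_cube R dt (genc1 x)) ->
    vholder_ball (@unit_cube R dt) bdec K fdec ->
    (* the network class *)
    (1 <= L1 <= L)%N -> (forall i, (1 <= i <= L)%N -> (1 <= p i)%N) ->
    p L1 = dt -> (1 <= s)%N -> 0 < F -> 0 < Lip ->
    (1 <= N <= n)%N ->
    K <= F ->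
    log2 (4 * Num.max tenc0%:R benc0) * log2 n%:R
      + log2 (4 * Num.max tenc1%:R benc1) * log2 n%:R <= L1%:R ->
    L1%:R + log2 (4 * Num.max tdec%:R bdec) * log2 n%:R <= L%:R ->
    (forall i, (1 <= i <= L)%N -> i <> L1 -> N%:R <= c * (p i)%:R) ->
    N%:R * log2 n%:R <= c * s%:R ->
    (* the class contains only constant functions once [s <= L] *)
    L%:R <= c * s%:R ->
    1 <= c * Lip ->
    (ereal_inf [set supnorm (@unit_cube R (r * d)) (fun x => (f x - f0 x)%R) ^+ 2
               | f in @encdec_networks R (r * d) d dt L L1 p s F Lip]
     <= (C * Num.max (N%:R / n%:R + N%:R `^ (- (2 * bdec / tdec%:R)))
              (Num.max (N%:R / n%:R + N%:R `^ (- (2 * benc0 / tenc0%:R)))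
                       (N%:R / n%:R + N%:R `^ (- (2 * benc1 / tenc1%:R)))))%:E)%E.
Proof.
exists 1; split=> // r D K r0 D0 _ _ K1.
have /andP[dt0 dtd] := hdt; have /andP[td0 _] := htdec.
have a0 : (0 < r * d)%N by rewrite muln_gt0 r0 (leq_trans dt0).
have K0 : 0 <= K by exact: le_trans K1.
have [Q Q0 HA] := @deep_nets R d dt tdec tenc0 tenc1 bdec benc0 benc1
  dt0 td0 htenc0 htenc1 hbdec hbenc0 hbenc1.
have [rA [WA [AA [rA0 AA0 {}HA]]]] := HA (r * d)%N D K a0 D0 K1.
have [rB [WB [AB [rB0 AB0 HB]]]] := @shallow_nets R d dt (r * d) D Q K bdec benc0 benc1
  dt0 a0 D0 K1 hbdec hbenc0 hbenc1.
pose Wt := (rA * rA * WA + rB * rB * WB)%N.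
(* The summand [12 * Wt] covers [6 * log2 n] layers of twice the budget, [2 * dt] the identity
   layers, [AA] and [AB] the two Lipschitz constants; [1] ensures positivity. With [c = Cc^-1] the
   hypotheses bound [Cc] times each quantity. *)
pose Cc : R := 12 * Wt%:R + 2 * dt%:R + AA + AB + 1.
have Wt0 : 0 <= Wt%:R :> R by [].
have dtR0 : 0 <= dt%:R :> R by [].
have Cc0 : 0 < Cc by rewrite /Cc; move: Wt0 dtR0 AA0 AB0; clear; lra.
exists Cc^-1; split; first by rewrite invr_gt0.
move=> dT T P X eps f0 genc0 genc1 fdec n N L L1 p s F Lip rn _ _ f0E
  dep0 dep1 depd h0 c0 h1 c1 hd _ _ pL1 _ F0 Lip0 Nn KF HL1 HL wp wN wL HLip.
have /andP[N1 Nn_] := Nn.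
have n2 : (2 <= n)%N by apply: leq_ltn_trans rn.
have nR : (0 : R) < n%:R by rewrite ltr0n ltnW.
have cs (x y : R) : x <= Cc^-1 * y -> Cc * x <= y by rewrite -ler_pdivlMl.
have {HLip} HLip : Cc <= Lip by have := cs _ _ HLip; rewrite mulr1.
set lg := log2 n%:R in HL1 HL wN.
have lg1 : 1 <= lg by apply: (@log2_ge R 1); rewrite expr1 ler_nat.
(* As [b >= 1], each logarithm is at least [log2 4 = 2]: two encoder stages grant [4 * lg] layers,
   the decoder [2 * lg]. *)
have log4 (t : nat) (b : R) : 1 <= b -> 2 * lg <= log2 (4 * Num.max t%:R b) * lg.
  move=> b1; rewrite ler_wpM2r ?(le_trans ler01) //.
  apply: (@log2_ge R 2); rewrite -[leLHS]mulr1 -natrX ler_wpM2l //.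
  by rewrite le_max b1 orbT.
have L1lg : 4 * lg <= L1%:R.
  by have := log4 tenc0 _ hbenc0; have := log4 tenc1 _ hbenc1; move: HL1; clear; lra.
have Llg : L1%:R + 2 * lg <= L%:R.
  by have := log4 tdec _ hbdec; move: HL; clear; lra.
set RHS := 1 * _.
have NnR0 : 0 <= N%:R / n%:R :> R by rewrite divr_ge0.
have pw (e : R) : 0 <= N%:R `^ e :> R by exact: powR_ge0.
have RHS_ge : [/\ N%:R / n%:R <= RHS, N%:R `^ (- (2 * bdec / tdec%:R)) <= RHS,
    N%:R `^ (- (2 * benc0 / tenc0%:R)) <= RHS & N%:R `^ (- (2 * benc1 / tenc1%:R)) <= RHS].
  rewrite /RHS mul1r !le_max.
  by split; rewrite ?lerDl ?lerDr ?pw ?NnR0 ?orbT.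
have [R0 Rd R0' R1'] := RHS_ge.
have RHS0 : 0 <= RHS by exact: le_trans R0.
rewrite -[RHS]sqr_sqrtr //; set rho := Num.sqrt RHS.
have rho0 : 0 <= rho by exact: sqrtr_ge0.
(* From [n ^ (-2) <= 1 / n <= N / n]. This covers the term [1 / n] in the accuracy of the deep nets
   and the accuracy of the shallow ones. *)
have n_rho : n%:R^-1 <= rho.
  rewrite -(ler_pXn2r (n := 2)) ?nnegrE ?invr_ge0 // sqr_sqrtr //.
  apply: le_trans R0; rewrite expr2 ler_wpM2r ?invr_ge0 //.
  by apply: (@le_trans _ _ 1); rewrite ?ler1n // invf_le1 // ler1n ltnW.
(* The claim shared by both regimes: [h] measures the depth, and [2 ^ h <= n] makes [4 * h], [2 * h]
   and [6 * h] fit the available layers and sparsity. *)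
have member (h r' w' : nat) (A : R) (he hd' : nat)
    (E : 'I_dt -> ('I_(r * d) -> R) -> R) (G : 'I_d -> ('I_dt -> R) -> R) : (0 < r')%N ->
    net r'%:R w' he E -> net r'%:R w' hd' G ->
    (r' * r' * w' <= Wt * N)%N -> (A <= Cc) ->
    (he.+1 < 4 * h)%N -> (hd'.+1 <= 2 * h)%N -> (he + hd' + 4 <= 6 * h)%N ->
    (2 ^ h <= n)%N ->
    let f (x : 'cV[R]_(r * d)) (j : 'I_d) := G j (fun l => relu (E l (fun i => x i 0))) in
    (forall x j, `|f x j| <= K) ->
    (forall x x' j, `|f x j - f x' j| <= A * `|x - x'|) ->
    (forall x j, @unit_cube R (r * d) x -> `|f x j - f0 x j 0| <= rho) ->
    (ereal_inf [set supnorm (@unit_cube R (r * d)) (fun x => (f x - f0 x)%R) ^+ 2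
               | f in @encdec_networks R (r * d) d dt L L1 p s F Lip]
     <= (rho ^+ 2)%:E)%E.
  move=> r'0 nE nG rw ACc heh hdh hh hn f fK fL fe.
  have hlg : h%:R <= lg by apply: log2_ge; rewrite -natrX ler_nat.
  have rwR : (r' * r' * w')%:R <= Wt%:R * N%:R :> R by rewrite -natrM ler_nat.
  apply: (@encdec_inf_le R _ _ _ L L1 w' he hd' r' s p F Lip rho f0 E G) => //.
  - rewrite -(ltr_nat R); apply: lt_le_trans L1lg.
    apply: lt_le_trans (_ : 4 * h%:R <= _); last by rewrite ler_wpM2l.
    by rewrite -natrM ltr_nat.
  - rewrite -(ler_nat R) natrD; apply: le_trans Llg; rewrite lerD2l.
    apply: le_trans (_ : 2 * h%:R <= _); last by rewrite ler_wpM2l.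
    by rewrite -natrM ler_nat.
  - move=> i iL iL1; rewrite -(ler_nat R); apply: le_trans rwR _.
    apply: le_trans (cs _ _ (wp i iL iL1)); rewrite ler_wpM2r // /Cc.
    by move: Wt0 dtR0 AA0 AB0; clear; lra.
  - rewrite -(ler_nat R).
    have hR : (he + hd' + 4)%:R <= 6 * lg.
      apply: le_trans (_ : 6 * h%:R <= _); last by rewrite ler_wpM2l.
      by rewrite -natrM ler_nat.
    have t1 : (he + hd' + 4)%:R * (r' * r' * w')%:R <= 6 * lg * (Wt%:R * N%:R) by rewrite ler_pM.
    have t2 := cs _ _ wN; have t3 := cs _ _ wL.
    have s0 : 0 <= s%:R :> R by [].
    have Nlg0 : 0 <= N%:R * lg by rewrite mulr_ge0 // (le_trans ler01).
    have L0 : 0 <= L%:R :> R by [].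
    have u1 : 12 * Wt%:R * (N%:R * lg) <= 12 * Wt%:R / Cc * s%:R.
      by rewrite -!mulrA; do 2 rewrite ler_wpM2l //.
    have u2 : 2 * dt%:R * L%:R <= 2 * dt%:R / Cc * s%:R.
      by rewrite -!mulrA; do 2 rewrite ler_wpM2l //.
    have u3 : 12 * Wt%:R / Cc * s%:R + 2 * dt%:R / Cc * s%:R <= s%:R.
      rewrite -mulrDl -mulrDl -[leRHS]mul1r ler_wpM2r // ler_pdivrMr // mul1r /Cc.
      by move: AA0 AB0; clear; lra.
    have E1 : ((he + hd' + 4) * (r' * r' * w').*2 + L * dt.*2)%:R
      = 2 * ((he + hd' + 4)%:R * (r' * r' * w')%:R) + 2 * dt%:R * L%:R :> R.
      by rewrite -!muln2 natrD !natrM; ring.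
    rewrite E1; apply: le_trans u3; apply: lerD u2.
    apply: le_trans u1; move: t1; clear; lra.
  - exact: ltW.
  - exact: ltW.
  - by move=> x j; apply: le_trans KF; exact: fK.
  - move=> x x' j; apply: le_trans (fL x x' j) _; rewrite ler_wpM2r //.
    exact: le_trans ACc HLip.
have AAc : AA <= Cc by rewrite /Cc; move: Wt0 dtR0 AB0; clear; lra.
have ABc : AB <= Cc by rewrite /Cc; move: Wt0 dtR0 AA0; clear; lra.
have [nQ|nQ] := leqP (2 ^ Q) n.
  (* Here [m >= 1] and [Q * m <= tl], so the nets fit; and [n < 2 ^ tl.+1 <= 2 ^ (Q * m.+1) <= 2 ^
     (2 * Q * m)], so [m] is large enough for the accuracy. *)
  pose tl := trunc_log 2 n; pose m := (tl %/ Q)%N.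
  have Qtl : (Q <= tl)%N by rewrite /tl trunc_log_max.
  have m0 : (0 < m)%N by rewrite divn_gt0.
  have Qm : (Q * m <= tl)%N by rewrite mulnC leq_trunc_div.
  have nm : (n <= 2 ^ (2 * Q * m))%N.
    apply: leq_trans (ltnW (trunc_log_ltn n (ltnSn 1))) _; rewrite leq_exp2l //.
    apply: leq_trans (ltn_ceil tl Q0) _; rewrite -/m.
    by move: m0; clear; nia.
  have [he [hd' [E [G [[nE nG [k1 k2 k3]] [fK fL fe]]]]]] :=
    HA genc0 genc1 fdec n N m dep0 dep1 depd h0 c0 h1 c1 hd Nn m0 nm.
  apply: (member (Q * m)%N rA (WA * N)%N AA he hd' E G) => //.
  - by rewrite mulnA leq_mul2r /Wt leq_addr orbT.
  - apply: leq_trans (trunc_logP (ltnSn 1) (ltnW n2)); rewrite leq_exp2l //.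
  - move=> x j cx; rewrite f0E; apply: fe => //.
    + exact: powR_neg_le.
    + exact: powR_neg_le.
    + exact: powR_neg_le.
have [E [G [nE nG fK fL fe]]] := HB genc0 genc1 fdec h0 c0 h1 c1 hd.
(* Now [n < 2 ^ Q], so the error [2 ^ (-Q)] is below [1 / n]. Two hidden layers for encoder and
   decoder fit with [h = 1], since [n >= 2]. *)
apply: (member 1%N rB WB AB 1%N 1%N E G) => //.
- by apply: (@leq_trans Wt); [rewrite leq_addl|rewrite leq_pmulr].
- move=> x j cx; rewrite f0E; apply: le_trans (fe x j cx) (le_trans _ n_rho).
  rewrite exprVn lef_pV2 ?posrE ?exprn_gt0 // -natrX ler_nat.
  exact: ltnW.
Qed.
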